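(* Suppose the dilation matrix is $M=\lambda_0\,\mathrm{Id}$ with $\lambda_0>1$, and let $k>s>0$ with $k$ a positive integer. Assume that a finite subset $\Phi=\{\phi_1,\dots,\phi_N\}$ of $k$-regular functions on $\mathbb{R}^n$ satisfies: (a) $\Phi$ has $L^2$-stable shifts; (b) $\Phi$ is $M$-refinable. Then for $x\in\mathbb{R}^n$ and a bounded function $f$ on $\mathbb{R}^n$ the following are equivalent: (i) $f\in C^s(x)$; (ii) there is a constant $C$ such that $|f(y)-P_lf(y)|\le C(\lambda_0^{-l}+|x-y|)^s$ for all integers $l\ge0$ and (almost) all $y\in\mathbb{R}^n$.
   Context: $M=\lambda_0\,\mathrm{Id}$ is an integer matrix on $\mathbb{R}^n$; $m=|\det M|=\lambda_0^n$. $T\subset\mathbb{R}^n$ is a compact set (self-affine tile) such that $\bigcup_{\nu\in\mathbb{Z}^n}(T+\nu)=\mathbb{R}^n$ and $\bigcup_{\gamma\in\Gamma_0}(T+\gamma)=MT$, both unions disjoint up to null sets, where $\Gamma_0\subset\mathbb{Z}^n$ is a complete set of representatives of $\mathbb{Z}^n/M\mathbb{Z}^n$. $Q_0$ is a translate of $T$ containing the origin as an interior point, and $Q_l(x)=M^{-l}Q_0+x$. $\mathbb{P}^{k'}$ is the space of polynomials of degree at most $k'$, and $\mathrm{osc}^{k'}_\infty f(x,l)=\inf_{P\in\mathbb{P}^{k'}}\|f-P\|_{L^\infty(Q_l(x))}$. For $s>0$ and a nonnegative integer $k'$ with $k'+1>s$, $f\in C^s(x)$ means $\sup_{l\ge0}\lambda_0^{ls}\,\mathrm{osc}^{k'}_\infty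 f(x,l)<\infty$. A function is $k$-regular if it is of class $C^k$ and $|\partial^\alpha f(x)|\le C_K(1+|x|)^{-K}$ for all $K=0,1,2,\dots$ and all $|\alpha|\le k$. $\Phi$ has $L^2$-stable shifts if $\|\sum_j\sum_\nu c_j(\nu)\phi_j(\cdot-\nu)\|_2\sim\sum_j\|c_j\|_{l^2}$ for all $c_j\in l^2(\mathbb{Z}^n)$; $\Phi$ is $M$-refinable if there are $c_{jk}\in l^1(\mathbb{Z}^n)$ with $\phi_j(x)=\sum_{k=1}^N\sum_\nu c_{jk}(\nu)\phi_k(Mx-\nu)$ for all $x$ and $j$. Let $\mathcal{L}^\infty$ be the space of $\phi$ with $\sum_{\nu\in\mathbb{Z}^n}|\phi(\cdot-\nu)|\in L^\infty(T)$. Let $\tilde\Phi=\{\tilde\phi_1,\dots,\tilde\phi_N\}\subset\mathcal{L}^\infty$ be the dual set: $\int\phi_j(x-\mu)\overline{\tilde\phi_k(x-\nu)}\,dx=\delta_{\mu\nu}\delta_{jk}$ (taken in the $L^2$-closed span of the integer shifts of $\Phi$). Then $P_lf(x)=\sum_{j=1}^N\sum_{\nu\in\mathbb{Z}^n}m^l\langle f,\tilde\phi_j(M^l\cdot-\nu)\rangle\phi_j(M^lx-\nu)$. *)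

(* Defs.v *)
From HB Require Import structures.
From mathcomp Require Import all_boot all_order all_algebra.
From mathcomp Require Import complex.
From mathcomp Require Import all_classical all_reals all_analysis.
Import Order.TTheory GRing.Theory Num.Theory.
Import numFieldNormedType.Exports.

Set Implicit Arguments.
Unset Strict Implicit.
Unset Printing Implicit Defensive.

Local Open Scope classical_set_scope.
Local Open Scope ring_scope.

(* Lebesgue measure on R^n = 'rV[R]_n: the sigma-algebra generated by the
   coordinates (the Borel sets), and the iterated product of the
   one-dimensional Lebesgue measure. *)

Definition rV_display : measure_display.
Proof. exact: default_measure_display. Qed.

Section measurable_rV.
Context (R : realType) (n : nat).

Let coord (i : 'I_n) (x : 'rV[R]_n) : measurableTypeR R := x 0 i.

Let rV_set0 : g_sigma_preimage coord set0.
Proof. exact: sigma_algebra0. Qed.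

Let rV_setC A : g_sigma_preimage coord A -> g_sigma_preimage coord (~` A).
Proof. exact: sigma_algebraC. Qed.

Let rV_bigcup (F : (set 'rV[R]_n)^nat) :
  (forall i, g_sigma_preimage coord (F i)) ->
  g_sigma_preimage coord (\bigcup_i (F i)).
Proof. exact: sigma_algebra_bigcup. Qed.

HB.instance Definition _ := @isMeasurable.Build rV_display
  'rV[R]_n (g_sigma_preimage coord) rV_set0 rV_setC rV_bigcup.

Lemma measurable_coord (i : 'I_n) :
  measurable_fun [set: 'rV[R]_n] (fun x : 'rV[R]_n => x 0 i : measurableTypeR R).
Proof.
move=> _ Y mY; rewrite setTI; apply: sub_sigma_algebra => /=.
rewrite -bigcup_seq/=; exists i => /=; first by rewrite mem_index_enum.
by exists Y => //; rewrite setTI.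
Qed.

Lemma measurable_fun_rV d (T : measurableType d) (f : T -> 'rV[R]_n) :
  (forall i, measurable_fun [set: T] (fun t => f t 0 i : measurableTypeR R)) ->
  measurable_fun [set: T] f.
Proof.
move=> mf _ A mA; rewrite setTI.
pose G := [set B | measurable (f @^-1` B)].
suff : measurable `<=` G by apply.
apply: smallest_sub.
- split => /=.
  + by rewrite /G/= preimage_set0.
  + by move=> B GB; rewrite /G/= setTD preimage_setC; exact: measurableC.
  + move=> F GF; rewrite /G/= preimage_bigcup.
    by apply: bigcup_measurable => k _; exact: GF.
- move=> B; rewrite -bigcup_seq/= => -[i _ [Y mY <-]].
  rewrite /G/= setTI.
  have := mf i measurableT Y mY.
  by rewrite setTI.
Qed.

End measurable_rV.

Lemma product_sigma_finite d1 d2 (T1 : measurableType d1)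
    (T2 : measurableType d2) (R : realType)
    (m1 : {sigma_finite_measure set T1 -> \bar R})
    (m2 : {sigma_finite_measure set T2 -> \bar R}) :
  sigma_finite setT (m1 \x m2)%E.
Proof.
have /sigma_finiteP[F [TF ndF Foo]] := sigma_finiteT m1.
have /sigma_finiteP[G [TG ndG Goo]] := sigma_finiteT m2.
exists (fun n => F n `*` G n).
  rewrite -setXTT TF TG predeqE => -[x y]; split.
    move=> [/= [n _ Fnx] [k _ Gky]]; exists (maxn n k) => //; split.
    - by move: x Fnx; exact/subsetPset/ndF/leq_maxl.
    - by move: y Gky; exact/subsetPset/ndG/leq_maxr.
  by move=> [n _ []/= ? ?]; split; exists n.
move=> k; have [? ?] := Foo k; have [? ?] := Goo k.
split; first exact: measurableX.
by rewrite product_measure1E// lte_mul_pinfty// ge0_fin_numE.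
Qed.

Section lebesgue_rV.
Context (R : realType).

Definition cons_rV n (p : measurableTypeR R * 'rV[R]_n) : 'rV[R]_n.+1 :=
  \row_i (if unlift ord0 i is Some j then p.2 0 j else p.1).

Lemma measurable_cons_rV n : measurable_fun setT (@cons_rV n).
Proof.
apply: measurable_fun_rV => i.
have [j ->|->] := unliftP ord0 i.
  rewrite (_ : (fun _ => _) = (fun x : 'rV[R]_n => x 0 j : measurableTypeR R) \o snd).
    exact: measurableT_comp (measurable_coord j) _.
  by apply/funext => p; rewrite /cons_rV mxE liftK.
rewrite (_ : (fun _ => _) = fst)//.
by apply/funext => p; rewrite /cons_rV mxE unlift_none.
Qed.

Section step.
Context n (mu : {sigma_finite_measure set 'rV[R]_n -> \bar R}).

Definition lebesgue_step : set 'rV[R]_n.+1 -> \bar R :=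
  pushforward (@lebesgue_measure R \x mu)%E (@cons_rV n).

Let step0 : lebesgue_step set0 = 0%E.
Proof. by rewrite /lebesgue_step /pushforward preimage_set0 measure0. Qed.

Let step_ge0 A : (0 <= lebesgue_step A)%E.
Proof. by rewrite /lebesgue_step /pushforward; apply: measure_ge0. Qed.

Let step_sigma_additive : semi_sigma_additive lebesgue_step.
Proof.
have mc A : measurable A -> measurable (@cons_rV n @^-1` A).
  by move=> mA; rewrite -[X in measurable X]setTI; exact: measurable_cons_rV.
move=> F mF tF mUF; rewrite /lebesgue_step /pushforward preimage_bigcup.
apply: measure_semi_sigma_additive.
- by move=> k; exact: mc.
- apply/trivIsetP => /= i j _ _ ij; rewrite -preimage_setI.
  by move/trivIsetP : tF => /(_ _ _ _ _ ij) ->//; rewrite preimage_set0.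
- by rewrite -preimage_bigcup; exact: mc.
Qed.

HB.instance Definition _ := isMeasure.Build _ _ _ lebesgue_step
  step0 step_ge0 step_sigma_additive.

Let step_sigma_finite : sigma_finite setT lebesgue_step.
Proof.
have [F TF mF] : sigma_finite setT (@lebesgue_measure R \x mu)%E.
  exact: product_sigma_finite.
pose hd (x : 'rV[R]_n.+1) : measurableTypeR R * 'rV[R]_n :=
  (x 0 ord0 : measurableTypeR R, \row_j x 0 (lift ord0 j)).
have mhd : measurable_fun setT hd.
  apply/measurable_fun_pairP; split; first exact: measurable_coord.
  apply: measurable_fun_rV => j.
  rewrite (_ : (fun _ => _) = (fun x : 'rV[R]_n.+1 => x 0 (lift ord0 j))).
    exact: measurable_coord.
  by apply/funext => x /=; rewrite mxE.
have hdK p : hd (cons_rV p) = p.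
  case: p => a v; rewrite /hd /cons_rV/= mxE unlift_none; congr pair.
  by apply/rowP => j; rewrite !mxE liftK.
exists (fun k => hd @^-1` F k).
  by rewrite -preimage_bigcup -TF preimage_setT.
move=> k; have [mFk Fk] := mF k; split.
  by rewrite -[X in measurable X]setTI; exact: mhd.
rewrite /lebesgue_step /pushforward -comp_preimage.
by rewrite (_ : hd \o _ = id)//; apply/funext => p /=; rewrite hdK.
Qed.

HB.instance Definition _ := Measure_isSigmaFinite.Build _ _ _ lebesgue_step
  step_sigma_finite.

End step.

Fixpoint lebesgue_rV n : {sigma_finite_measure set 'rV[R]_n -> \bar R} :=
  match n with
  | 0 => [the {sigma_finite_measure set 'rV[R]_0 -> \bar R}
            of @dirac _ 'rV[R]_0 0 R]
  | n'.+1 => [the {sigma_finite_measure set 'rV[R]_n'.+1 -> \bar R}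
            of lebesgue_step (lebesgue_rV n')]
  end.

End lebesgue_rV.

Section analysis_Rn.
Context (R : realType) (n : nat).
Local Notation vec := 'rV[R]_n.
Local Notation lattice := 'rV[int]_n.
Local Notation C := (complex R).
Local Notation mu := (lebesgue_rV R n).
Local Notation cmod := (@ComplexField.Normc.normc R).

(* The norm of 'rV[R]_n in the library is the sup norm. *)
Definition enorm (x : vec) : R := Num.sqrt (\sum_(i < n) x 0 i ^+ 2).

Definition zvec (nu : lattice) : vec := map_mx intr nu.

(* The sigma-algebra on 'rV[R]_n is the Borel one, so Lebesgue measurability
   is equality a.e. with a measurable function. *)
Definition lebesgue_measurable_fun (g : vec -> R) : Prop :=
  exists2 h : vec -> R, measurable_fun setT h &
    {ae mu, forall x, g x = h x}.

Definition cmeasurable (g : vec -> C) : Prop :=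
  lebesgue_measurable_fun (fun x => complex.Re (g x)) /\
  lebesgue_measurable_fun (fun x => complex.Im (g x)).

Definition cintegral (g : vec -> C) : C :=
  Complex (Rintegral mu setT (fun x => complex.Re (g x)))
          (Rintegral mu setT (fun x => complex.Im (g x))).

Definition inner (f g : vec -> C) : C := cintegral (fun y => f y * conjc (g y)).

Definition L2norm (g : vec -> C) : \bar R :=
  Lnorm mu 2%:E (fun x => (cmod (g x))%:E).

Definition Linfnorm_on (Q : set vec) (g : vec -> C) : \bar R :=
  Lnorm mu +oo%E (fun x => (\1_Q x * cmod (g x))%:E).

(* The sum over Z^n of an absolutely summable family, as positive part minus
   negative part; without summability the value is meaningless. *)
Definition rsum (a : lattice -> R) : R :=
  fine (\esum_(nu in setT) ((EFin \o a)^\+)%E nu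
        - \esum_(nu in setT) ((EFin \o a)^\-)%E nu)%E.

Definition csum (a : lattice -> C) : C :=
  Complex (rsum (fun nu => complex.Re (a nu)))
          (rsum (fun nu => complex.Im (a nu))).

Definition in_l1 (c : lattice -> C) : Prop :=
  (\esum_(nu in setT) (cmod (c nu))%:E < +oo)%E.

Definition in_l2 (c : lattice -> C) : Prop :=
  (\esum_(nu in setT) (cmod (c nu) ^+ 2)%:E < +oo)%E.

Definition l2norm (c : lattice -> C) : R :=
  Num.sqrt (fine (\esum_(nu in setT) (cmod (c nu) ^+ 2)%:E)).

Definition translate (a : vec) (A : set vec) : set vec := [set x + a | x in A].

Definition partial (i : 'I_n) (f : vec -> R) : vec -> R :=
  fun x => 'D_(delta_mx 0 i) f x.

Fixpoint class_C (k : nat) (f : vec -> R) : Prop :=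
  match k with
  | 0 => continuous f
  | k'.+1 => continuous f /\
      forall i : 'I_n, (forall x, derivable f x (delta_mx 0 i)) /\
                       class_C k' (partial i f)
  end.

Definition mpartial (alpha : 'I_n -> nat) (f : vec -> R) : vec -> R :=
  foldr (fun i g => iter (alpha i) (partial i) g) f (enum 'I_n).

Definition cmpartial (alpha : 'I_n -> nat) (f : vec -> C) : vec -> C :=
  fun x => Complex (mpartial alpha (fun y => complex.Re (f y)) x)
                   (mpartial alpha (fun y => complex.Im (f y)) x).

Definition k_regular (k : nat) (f : vec -> C) : Prop :=
  [/\ class_C k (fun x => complex.Re (f x)),
      class_C k (fun x => complex.Im (f x)) &
      forall K : nat, exists CK : R, forall (x : vec) (alpha : 'I_n -> nat),
        (\sum_(i < n) alpha i <= k)%N ->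
        cmod (cmpartial alpha f x) <= CK * (1 + enorm x) ^- K].

Definition L2_stable_shifts (N : nat) (Phi : 'I_N -> vec -> C) : Prop :=
  exists A B : R, [/\ 0 < A, 0 < B &
    forall c : 'I_N -> lattice -> C, (forall j, in_l2 (c j)) ->
      let F := L2norm (fun x =>
                 \sum_(j < N) csum (fun nu => c j nu * Phi j (x - zvec nu))) in
      let S := \sum_(j < N) l2norm (c j) in
      ((A * S)%:E <= F)%E /\ (F <= (B * S)%:E)%E].

Definition refinable (lambda0 N : nat) (Phi : 'I_N -> vec -> C) : Prop :=
  exists c : 'I_N -> 'I_N -> lattice -> C,
    (forall j k, in_l1 (c j k)) /\
    forall j x, Phi j x =
      \sum_(k < N) csum (fun nu => c j k nu * Phi k (lambda0%:R *: x - zvec nu)).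

(* The first clause on Gamma0 says that it is a complete set of representatives
   of Z^n / M Z^n. *)
Definition self_affine_tile (lambda0 : nat) (Gamma0 : set lattice)
    (T : set vec) : Prop :=
  (compact T /\
   forall nu : lattice, exists! gamma : lattice,
     Gamma0 gamma /\ exists eta : lattice, nu = gamma + eta *+ lambda0) /\
  [/\ \bigcup_(nu in [set: lattice]) translate (zvec nu) T = [set: vec],
      forall nu nu' : lattice, nu != nu' ->
        mu.-negligible (translate (zvec nu) T `&` translate (zvec nu') T),
      \bigcup_(gamma in Gamma0) translate (zvec gamma) T =
        [set lambda0%:R *: x | x in T] &
      forall gamma gamma' : lattice, Gamma0 gamma -> Gamma0 gamma' ->
        gamma != gamma' ->
        mu.-negligible (translate (zvec gamma) T `&` translate (zvec gamma') T)].

(* \sum_nu |phi (. - nu)| is essentially bounded on T. *)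
Definition in_calLinf (T : set vec) (phi : vec -> C) : Prop :=
  cmeasurable phi /\
  exists B : R, {ae mu, forall x, T x ->
    (\esum_(nu in setT) (cmod (phi (x - zvec nu)))%:E <= B%:E)%E}.

(* The L^2-closure of the finite linear combinations of the shifts. *)
Definition in_closed_span (N : nat) (Phi : 'I_N -> vec -> C) (g : vec -> C)
    : Prop :=
  [/\ cmeasurable g, (L2norm g < +oo)%E &
      forall e : R, 0 < e -> exists s : seq (C * 'I_N * lattice),
        (L2norm (fun x => (g x -
           \sum_(p <- s) p.1.1 * Phi p.1.2 (x - zvec p.2))%R) < e%:E)%E].

Definition is_dual (T : set vec) (N : nat) (Phi tPhi : 'I_N -> vec -> C)
    : Prop :=
  [/\ forall j, in_calLinf T (tPhi j),
      forall j, in_closed_span Phi (tPhi j) &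
      forall (j k : 'I_N) (eta nu : lattice),
        inner (fun x => Phi j (x - zvec eta)) (fun x => tPhi k (x - zvec nu))
        = ((eta == nu) && (j == k))%:R].

(* P_l f: M = lambda0 Id acts as lambda0%:R *: _, and lambda0 ^ n is |det M|. *)
Definition shift_proj (lambda0 N : nat) (Phi tPhi : 'I_N -> vec -> C) (l : nat)
    (f : vec -> C) (x : vec) : C :=
  \sum_(j < N) csum (fun nu =>
    ((lambda0 ^ n) ^ l)%:R
    * inner f (fun y => tPhi j (lambda0%:R ^+ l *: y - zvec nu))
    * Phi j (lambda0%:R ^+ l *: x - zvec nu)).

(* Q_l(x) = M^(-l) Q_0 + x *)
Definition cube_at (lambda0 : nat) (Q0 : set vec) (l : nat) (x : vec)
    : set vec :=
  translate x [set lambda0%:R ^- l *: y | y in Q0].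

Definition is_polynomial (k' : nat) (P : vec -> C) : Prop :=
  exists c : {ffun 'I_n -> 'I_k'.+1} -> C, forall y : vec,
    P y = \sum_(alpha : {ffun 'I_n -> 'I_k'.+1} |
                  (\sum_(i < n) alpha i <= k')%N)
            c alpha * (\prod_(i < n) y 0 i ^+ alpha i)%:C%C.

Definition osc (lambda0 : nat) (Q0 : set vec) (k' : nat) (f : vec -> C)
    (x : vec) (l : nat) : \bar R :=
  ereal_inf [set Linfnorm_on (cube_at lambda0 Q0 l x) (fun y => f y - P y)
            | P in is_polynomial k'].

(* f \in C^s(x), computed with polynomials of degree at most k', k' + 1 > s. *)
Definition C_pointwise (lambda0 : nat) (Q0 : set vec) (s : R) (k' : nat)
    (f : vec -> C) (x : vec) : Prop :=
  (ereal_sup (range (fun l : nat =>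
     ((lambda0%:R : R) `^ (l%:R * s))%:E * osc lambda0 Q0 k' f x l)) < +oo)%E.

Definition bounded_measurable (f : vec -> C) : Prop :=
  cmeasurable f /\ exists B : R, forall y, cmod (f y) <= B.

End analysis_Rn.

(* Main.v *)
Require Import Defs.
From HB Require Import structures.
From mathcomp Require Import all_boot all_order all_algebra.
From mathcomp Require Import complex.
From mathcomp Require Import all_classical all_reals all_analysis.
From mathcomp Require Import ring lra measurable_realfun ess_sup_inf.
Import Order.TTheory GRing.Theory Num.Theory.
Import numFieldNormedType.Exports.

Set Implicit Arguments.
Unset Strict Implicit.
Unset Printing Implicit Defensive.

Local Open Scope classical_set_scope.
Local Open Scope ring_scope.

(** A dual function is an L2 limit of finite combinations of shifts, whose coefficients solve a
    system with the Gram matrix of the shifts. That matrix decays off its diagonal and is bounded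
    below by stability; a weighted energy estimate shows that the coefficients decay rapidly, so
    that a dual function is a.e. a rapidly decreasing [psi]. The kernel of [P_l] then decays
    rapidly at scale [lambda0 ^- l].

    [P_0] fixes [V], the combinations of the shifts with coefficients of polynomial growth, and
    refinability makes [V] stable under dilation by [lambda0 ^-1]. [P_0] reproduces the polynomials
    of degree less than [k], by induction on the degree [d]. Let [x] be a [lambda0]-adic point and
    [F] in [V]; rescaling around [x] the remainder of a Taylor expansion of [F] shows that [P_0]
    fixes the part of degree [d] of the expansion. For a form [q] of degree [d], [q - P_0 q] is
    periodic, so that the average, over a fine grid of the torus, of the parts of degree [d] of the
    expansions of [P_0 q] is close to [q]; hence [P_0 q = q].

    (i) => (ii): if [P] is the polynomial approximating [f] at the scale [i] with [lambda0 ^- i]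
    comparable to [lambda0 ^- l + |x - y|], then [f - P_l f = (f - P) - P_l (f - P)].
    (ii) => (i): [P_(l+1) f - P_l f = P_(l+1) (f - P_l f)] has a good Taylor expansion at [x], and
    the Taylor polynomials are summed over [l]. *)

(** * Lebesgue measure on R^n *)

(** The hypotheses give no rapid decay of the dual functions, while applying [P_l] to polynomials
    and to weighted errors requires it; hence the study of the Gram system. Polynomial reproduction
    is obtained without the Fourier transform. Rescaling works only around lambda-adic points,
    because [F (x + lam^-l u)] is a function of [V] in [u] when [lam^l x] is a lattice point. One
    such point yields one form of degree [d] fixed by [P_0], possibly zero; averaging is what
    reaches every form. With [t = lam^-l] the grid has mesh [t^(d+1)]: rounding a vector to the grid
    then costs no more than the Taylor remainder on the ball of radius [t], and extracting the part
    of degree [d] loses [t^-d], so that an error [O(t)] remains. Weights are integer powers of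
    [1 + |y - u|], with constants uniform in the centre [u]; this lets one estimate of [P_0] serve
    at all scales and base points. In (i) the degree [k'] is arbitrary above [s - 1], whereas [P_l]
    reproduces the degrees below [k]; dropping the homogeneous parts of high degree connects the
    two. *)

Section one_dim.
Context (R : realType).
Local Notation leb := (@lebesgue_measure R).

Definition affine (a b : R) (t : measurableTypeR R) : measurableTypeR R := a * t + b.

Lemma measurable_affine (a b : R) : measurable_fun setT (affine a b).
Proof.
apply: measurable_funD; last exact: measurable_cst.
apply: measurable_funM; first exact: measurable_cst.
exact: measurable_id.
Qed.

HB.instance Definition _ (a b : R) :=
  isMeasurableFun.Build _ _ _ _ (affine a b) (measurable_affine a b).

(** Uniqueness of Lebesgue measure reduces the identity to half-open intervals, whose preimages are
    intervals with lengths divided by [a]. *)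
Lemma lebesgue_measure_affine (a b : R) (A : set (measurableTypeR R)) :
  0 < a -> measurable A ->
  (a%:E * pushforward leb (affine a b) A)%E = leb A.
Proof.
move=> a0 mA; apply/esym.
apply: (@lebesgue_measure_unique _ (mscale (NngNum (ltW a0)) (pushforward leb (affine a b)))) => // _ [[c d]] _ <-.
rewrite /= /mscale/= /pushforward.
have -> : affine a b @^-1` `]c, d] = `](c - b) / a, (d - b) / a]%classic.
  apply/seteqP; split => t /=; rewrite !in_itv/= /affine ltr_pdivrMr// ler_pdivlMr// => /andP[h1 h2]; apply/andP; split; lra.
rewrite !lebesgue_measure_itv /= !lte_fin ltr_pM2r ?invr_gt0// ltrD2r.
case: ifP => _; last by rewrite mule0.
by rewrite -!EFinB -EFinM; congr EFin; field; rewrite gt_eqF.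
Qed.

Lemma integral_affine1 (a b : R) (g : measurableTypeR R -> \bar R) :
  0 < a -> measurable_fun setT g -> (forall t, 0 <= g t)%E ->
  (\int[leb]_t g (affine a b t) = (a^-1)%:E * \int[leb]_t g t)%E.
Proof.
move=> a0 mg g0.
have := @ge0_integral_pushforward _ _ (measurableTypeR R) (measurableTypeR R) R
  (affine a b) (measurable_affine a b) leb setT g measurableT mg (fun y _ => g0 y).
rewrite preimage_setT => <-.
rewrite (@eq_measure_integral _ (measurableTypeR R) R setT
  (mscale (NngNum (ltW a0)) (pushforward leb (affine a b))) leb g); last first.
  by move=> A mA _; apply: esym; exact: (lebesgue_measure_affine b a0 mA).
rewrite ge0_integral_mscale//= muleA -EFinM mulVf ?gt_eqF// mul1e//.
Qed.

End one_dim.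

Section rV_integral.
Context (R : realType).
Local Notation leb := (@lebesgue_measure R).
Local Notation mu n := (lebesgue_rV R n).

(** Tonelli for one step of the recursion that defines [lebesgue_rV]; the inductions on the
    dimension for integrals rest on it. *)
Lemma integral_rV_cons n (g : 'rV[R]_n.+1 -> \bar R) :
  measurable_fun setT g -> (forall x, 0 <= g x)%E ->
  (\int[mu n.+1]_y g y = \int[leb]_t \int[mu n]_v g (cons_rV (t, v)))%E.
Proof.
move=> mg g0.
have mc := @measurable_cons_rV R n.
have := @ge0_integral_pushforward _ _ (measurableTypeR R * 'rV[R]_n)%type _ R (@cons_rV R n)
  mc (leb \x mu n)%E setT g measurableT mg (fun y _ => g0 y).
rewrite preimage_setT => H.
rewrite -[LHS]/(\int[pushforward (leb \x mu n)%E (@cons_rV R n)]_y g y)%E H.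
rewrite (fubini_tonelli1 (g \o @cons_rV R n)) //=.
by apply: measurableT_comp.
Qed.

Lemma measurable_scale_rV n (a : R) (b : 'rV[R]_n) :
  measurable_fun setT (fun y : 'rV[R]_n => a *: y + b).
Proof.
apply: measurable_fun_rV => i.
rewrite (_ : (fun _ => _) = (fun y : 'rV[R]_n => a * y 0 i + b 0 i)); last first.
  by apply/funext => y; rewrite !mxE.
apply: (measurableT_comp (measurable_affine a (b 0 i))).
exact: measurable_coord.
Qed.

Lemma integral_affine n (a : R) (b : 'rV[R]_n) (g : 'rV[R]_n -> \bar R) :
  0 < a -> measurable_fun setT g -> (forall x, 0 <= g x)%E ->
  (\int[mu n]_y g (a *: y + b)%R = (a^-1 ^+ n)%:E * \int[mu n]_y g y)%E.
Proof.
move=> a0; elim: n b g => [|n IH] b g mg g0.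
  rewrite expr0 mul1e; apply: eq_integral => y _.
  by congr g; apply/rowP => -[].
rewrite integral_rV_cons //; last first.
  by apply: measurableT_comp => //; exact: measurable_scale_rV.
rewrite integral_rV_cons //.
have E t v : a *: cons_rV (t, v) + b = cons_rV (affine a (b ord0 ord0) t, a *: v + \row_j b 0 (lift ord0 j)).
  apply/rowP => i; rewrite !mxE; case: unliftP => [j ->|->]//=.
  by rewrite !mxE.
have mG : measurable_fun setT (fun t : measurableTypeR R =>
    (\int[mu n]_v g (cons_rV (t, v)))%E).
  apply: (measurable_fun_fubini_tonelli_F (m2 := mu n) (g \o @cons_rV R n)) => /=.
    by apply: measurableT_comp => //; exact: measurable_cons_rV.
  by move=> x; exact: g0.
transitivity (\int[leb]_t ((a^-1 ^+ n)%:E * \int[mu n]_v g (cons_rV (affine a (b ord0 ord0) t, v))))%E.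
  apply: eq_integral => t _.
  under eq_integral do rewrite E.
  rewrite (IH (\row_j b 0 (lift ord0 j)) (fun v => g (cons_rV (affine a (b ord0 ord0) t, v)))) //.
  apply: measurableT_comp => //.
  apply: measurableT_comp; first exact: measurable_cons_rV.
  exact: measurable_pair1.
rewrite ge0_integralZl; last 4 first.
- exact: measurableT.
- exact: (measurableT_comp mG (measurable_affine a (b 0 0))).
- by move=> t _; exact: integral_ge0.
- by rewrite lee_fin exprn_ge0 // invr_ge0 ltW.
rewrite (integral_affine1 (b 0 0) a0 mG); last by move=> t; apply: integral_ge0.
by rewrite muleA -EFinM exprSr.
Qed.

End rV_integral.

Section rV_topology.
Context (R : realType) (n : nat).
Local Notation vec := 'rV[R]_n.
Implicit Types x y : vec.

Lemma rV_norm_leP x (e : R) : 0 <= e ->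
  reflect (forall i, `|x 0 i| <= e) (`|x| <= e).
Proof.
move=> e0; rewrite /Num.norm /= mx_normrE; apply: (iffP idP) => [/bigmax_leP[_ H] i|H].
  exact: (H (0, i)).
by apply/bigmax_leP; split => // -[i j] _ /=; rewrite ord1; exact: H.
Qed.

Lemma rV_norm_ltP x (e : R) : 0 < e ->
  reflect (forall i, `|x 0 i| < e) (`|x| < e).
Proof.
move=> e0; rewrite /Num.norm /= mx_normrE; apply: (iffP idP) => [/bigmax_ltP[_ H] i|H].
  exact: (H (0, i)).
by apply/bigmax_ltP; split => // -[i j] _ /=; rewrite ord1; exact: H.
Qed.

Lemma rV_coord_le x i : `|x 0 i| <= `|x|.
Proof. by have /(rV_norm_leP _ (normr_ge0 x)) := lexx `|x|; exact. Qed.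

Lemma measurable_cylinder (A : 'I_n -> set (measurableTypeR R)) :
  (forall i, measurable (A i)) -> measurable [set y : vec | forall i, A i (y 0 i)].
Proof.
move=> mA; rewrite (_ : [set _ | _] =
    \bigcap_(i in [set: 'I_n]) ((fun y : vec => y 0 i : measurableTypeR R) @^-1` A i)).
  apply: fin_bigcap_measurable => // i _.
  by rewrite -[X in measurable X]setTI; apply: measurable_coord.
by apply/seteqP; split => y /= H i; [move=> _; exact: H|exact: H].
Qed.

Lemma measurable_rV_ball x (e : R) : measurable [set y : vec | `|x - y| < e].
Proof.
have [e0|e0] := ltP 0 e; last first.
  rewrite (_ : [set _ | _] = set0) //; apply/seteqP; split => // y /= h.
  by have := le_lt_trans (normr_ge0 _) h; rewrite ltNge e0.
rewrite (_ : [set _ | _] = [set y : vec | forall i, `]x 0 i - e, x 0 i + e[%classic (y 0 i)]).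
  by apply: (@measurable_cylinder (fun i => `]x 0 i - e, x 0 i + e[%classic)) => i; exact: measurable_itv.
apply/seteqP; split => y /= => [/(rV_norm_ltP _ e0) H i|H].
  by have := H i; rewrite !mxE in_itv/= ltr_norml => /andP[? ?]; apply/andP; split; lra.
apply/(rV_norm_ltP _ e0) => i; have := H i; rewrite !mxE in_itv/= ltr_norml => /andP[? ?].
by apply/andP; split; lra.
Qed.

(** The sigma-algebra is generated by the coordinates. An open set is the countable union of the
    balls with rational centre and radius [1 / (k + 1)] that it contains, and balls of the sup norm
    are products of intervals. *)
Lemma open_measurable_rV (A : set vec) : open A -> measurable A.
Proof.
move=> oA.
pose B (p : 'rV[rat]_n * nat) := [set y : vec | `|map_mx ratr p.1 - y| < p.2.+1%:R^-1].
pose D := [set p | B p `<=` A].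
have -> : A = \bigcup_(p in [set: 'rV[rat]_n * nat]) (if `[< D p >] then B p else set0).
  apply/seteqP; split => [y Ay|y [p _]]; last by case: asboolP => // Dp; exact: Dp.
  have /nbhs_ballP[e /= e0 He] : nbhs y A by exact: open_nbhs_nbhs.
  have [k Hk] : exists k : nat, k.+1%:R^-1 < e / 2.
    exists (Num.truncn (e / 2)^-1); rewrite invf_plt ?posrE ?divr_gt0 //.
    exact: truncnS_gt.
  have k0 : 0 < k.+1%:R^-1 :> R by rewrite invr_gt0.
  have /choice[q Hq] : forall i, exists q : rat, `|ratr q - y 0 i| < k.+1%:R^-1.
    move: (k.+1%:R^-1) k0 => d d0 i.
    have [|q] := @rat_in_itvoo R (y 0 i - d) (y 0 i + d); first lra.
    by rewrite in_itv/= => /andP[? ?]; exists q; rewrite ltr_norml; apply/andP; split; lra.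
  have qy : `|map_mx ratr (\row_i q i) - y| < k.+1%:R^-1.
    by apply/(rV_norm_ltP _ k0) => i; rewrite !mxE.
  exists (\row_i q i, k) => //.
  case: asboolP => [_ //|[]] => z /= Hz; apply: He.
  rewrite -ball_normE /=.
  rewrite (_ : y - z = (y - map_mx ratr (\row_i q i)) + (map_mx ratr (\row_i q i) - z)); last first.
    by rewrite addrA subrK.
  by apply: le_lt_trans (ler_normD _ _) _; rewrite [`|y - _|]distrC (splitr e) ltrD // (lt_trans _ Hk).
apply: countable_bigcupT_measurable; first exact: countableP.
by move=> p; case: asboolP => _; [exact: measurable_rV_ball|exact: measurable0].
Qed.

Lemma continuous_measurable_rV (f : vec -> R) : continuous f ->
  measurable_fun setT (f : vec -> measurableTypeR R).
Proof.
move=> cf; apply: (measurability _ (RGenOInfty.measurableE R)) => _ /= [_ [a ->] <-].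
rewrite setTI; apply: open_measurable_rV.
by apply: open_comp => // x _; exact: cf.
Qed.

End rV_topology.

Section rV_measure.
Context (R : realType).
Local Notation leb := (@lebesgue_measure R).
Local Notation mu n := (lebesgue_rV R n).

Lemma lebesgue_cylinder n (A : 'I_n -> set (measurableTypeR R)) (c : 'I_n -> R) :
  (forall i, measurable (A i)) -> (forall i, leb (A i) = (c i)%:E) ->
  mu n [set y : 'rV[R]_n | forall i, A i (y 0 i)] = (\prod_i c i)%:E.
Proof.
elim: n A c => [|n IH] A c mA HA.
  rewrite big_ord0 /= diracE mem_set // => -[] //.
transitivity ((leb \x mu n)%E (A ord0 `*` [set v : 'rV[R]_n | forall i, A (lift ord0 i) (v 0 i)])).
  rewrite /= /lebesgue_step /pushforward; congr (_ _).
  apply/seteqP; split => [[t v] /= H|[t v] /= [H0 H] i].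
    split; first by have := H ord0; rewrite mxE unlift_none.
    by move=> i; have := H (lift ord0 i); rewrite mxE liftK.
  by rewrite mxE; case: unliftP => [j ->|->].
rewrite product_measure1E //; last first.
  by apply: (@measurable_cylinder R n (fun i => A (lift ord0 i))) => i; exact: mA.
rewrite (IH (fun i => A (lift ord0 i)) (fun i => c (lift ord0 i))) //.
by rewrite big_ord_recl EFinM; congr (_ * _)%E; exact: HA.
Qed.

Lemma lebesgue_rV_ball n (x : 'rV[R]_n) (e : R) : 0 < e ->
  (0 < mu n [set y | `|x - y| < e]%R)%E.
Proof.
move=> e0.
rewrite (_ : [set _ | _] = [set y : 'rV[R]_n | forall i, `]x 0 i - e, x 0 i + e[%classic (y 0 i)]).
  rewrite (@lebesgue_cylinder _ (fun i => `]x 0 i - e, x 0 i + e[%classic) (fun=> 2 * e)).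
  - by rewrite lte_fin prodr_gt0 // => i _; rewrite mulr_gt0.
  - by move=> i; exact: measurable_itv.
  - move=> i; rewrite lebesgue_measure_itv /= lte_fin.
    rewrite ifT; last lra.
    by rewrite -EFinB; congr EFin; ring.
apply/seteqP; split => y /= => [/(rV_norm_ltP _ e0) H i|H].
  by have := H i; rewrite !mxE in_itv/= ltr_norml => /andP[? ?]; apply/andP; split; lra.
apply/(rV_norm_ltP _ e0) => i; have := H i; rewrite !mxE in_itv/= ltr_norml => /andP[? ?].
by apply/andP; split; lra.
Qed.

Lemma ae_ball_ex n (x : 'rV[R]_n) (e : R) (P : set 'rV[R]_n) : 0 < e ->
  {ae mu n, forall y, P y} -> exists2 y, `|x - y| < e & P y.
Proof.
move=> e0 [N [mN N0 HN]]; apply: contrapT => H.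
have : (mu n [set y | `|x - y| < e]%R <= mu n N)%E.
  apply: le_measure; rewrite ?inE //; first exact: measurable_rV_ball.
  move=> y /= Hy; apply: HN => /= Py; apply: H; exists y => //.
by rewrite N0 leNgt lebesgue_rV_ball.
Qed.

(** The part of the ball where [g] exceeds [B] is open, and a nonempty open set is not null. This
    upgrades a.e. bounds on polynomials to pointwise ones. *)
Lemma ae_ball_continuous n (x : 'rV[R]_n) (e B : R) (g : 'rV[R]_n -> R) :
  continuous g -> {ae mu n, forall y, `|x - y| < e -> g y <= B} ->
  forall y, `|x - y| < e -> g y <= B.
Proof.
move=> cg H y Hy; rewrite leNgt; apply/negP => gB.
have e0 : 0 < e := le_lt_trans (normr_ge0 _) Hy.
have : nbhs y [set z | B < g z /\ `|x - z| < e].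
  near=> z; split; near: z.
    by apply: (cvgr_gt (g y)) => //; exact: cg.
  apply/nbhs_ballP; exists (e - `|x - y|); first by rewrite /= subr_gt0.
  move=> z; rewrite -ball_normE /= => Hz; rewrite -(subrKA y).
  by apply: le_lt_trans (ler_normD _ _) _; rewrite -ltrBrDl.
move=> /nbhs_ballP[d /= d0 Hd].
have [z /= Hz1 Hz2] := ae_ball_ex y d0 H.
have := Hd z; rewrite -ball_normE /= => /(_ Hz1)[h1 h2].
by have := Hz2 h2; rewrite leNgt h1.
Unshelve. all: by end_near. Qed.

Lemma integral_oneDsqrV :
  (\int[leb]_t ((1 + t ^+ 2)^-1)%:E = pi%:E :> \bar R)%E.
Proof.
rewrite (@ge0_symfun_integralT R (fun t => (1 + t ^+ 2)^-1)).
- rewrite (_ : [set x | _] = `[0, +oo[%classic); last first.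
    by apply/seteqP; split => x/=; rewrite in_itv/= andbT.
  by rewrite (integral0y_oneDsqr R) -EFinM; congr EFin; field.
- by move=> t; rewrite invr_ge0 addr_ge0 ?sqr_ge0.
- exact: continuous_oneDsqrV.
- by move=> t /=; rewrite sqrrN.
Qed.

Lemma measurable_prod_coord n (h : R -> R) :
  measurable_fun setT (h : measurableTypeR R -> measurableTypeR R) ->
  measurable_fun setT (fun y : 'rV[R]_n => \prod_i h (y 0 i) : measurableTypeR R).
Proof.
move=> mh; apply: measurable_prod => i _.
apply: (measurableT_comp mh); exact: measurable_coord.
Qed.

Lemma integral_prod_coord n (h : R -> R) (c : R) :
  measurable_fun setT (h : measurableTypeR R -> measurableTypeR R) ->
  (forall t, 0 <= h t) -> (\int[leb]_t (h t)%:E = c%:E)%E ->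
  (\int[mu n]_y (\prod_i h (y 0 i)%R)%:E = (c ^+ n)%:E)%E.
Proof.
move=> mh h0 hc; elim: n => [|n IH].
  transitivity (\int[mu 0]_y (cst 1 y))%E.
    by apply: eq_integral => y _; rewrite big_ord0.
  by rewrite integral_cst //= diracT mule1.
rewrite integral_rV_cons; last 2 first.
- by apply/measurable_EFinP; exact: measurable_prod_coord.
- by move=> y; rewrite lee_fin prodr_ge0.
transitivity (\int[leb]_t ((c ^+ n)%:E * (h t)%:E))%E.
  apply: eq_integral => t _.
  rewrite -IH muleC -ge0_integralZl_EFin //=; last 2 first.
  - by move=> v _; rewrite lee_fin prodr_ge0.
  - by apply/measurable_EFinP; exact: measurable_prod_coord.
  apply: eq_integral => v _; rewrite big_ord_recl -EFinM mxE unlift_none; congr (_ * _)%:E.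
  by apply: eq_bigr => i _; rewrite mxE liftK.
rewrite ge0_integralZl_EFin //.
- by rewrite hc -EFinM exprSr.
- by move=> t _; rewrite lee_fin.
- by apply/measurable_EFinP.
- by rewrite exprn_ge0 // -lee_fin -hc integral_ge0 // => t _; rewrite lee_fin.
Qed.

End rV_measure.

Section normed_continuity.
Context (R : realType) (V : normedModType R) (u : V).

Lemma continuous_dist : continuous (fun z : V => `|z - u|).
Proof.
move=> y; apply: cvg_norm; apply: cvgB; first exact: cvg_id.
exact: cvg_cst.
Qed.

Lemma continuous_weight E : continuous (fun z : V => (1 + `|z - u|)^-1 ^+ E).
Proof.
move=> y.
apply: (@continuous_comp _ _ _ (fun z : V => (1 + `|z - u|)^-1) (fun t : R => t ^+ E)); last exact: exprn_continuous.
apply: cvgV; first by rewrite gt_eqF // ltr_wpDr.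
by apply: cvgD; [exact: cvg_cst|exact: continuous_dist].
Qed.

End normed_continuity.

(** * Polynomial weights and their sums over the lattice *)

Section weight.
Context (R : realType) (n : nat).
Local Notation vec := 'rV[R]_n.
Local Notation lattice := 'rV[int]_n.
Local Notation mu := (lebesgue_rV R n).
Implicit Types x y u : vec.

(** The norm is the sup norm, for which the weight compares well with products over the coordinates;
    [enorm_ge] and [enorm_le] relate it to the Euclidean norm. *)
Definition wt y : R := 1 + `|y|.

Lemma wt_ge1 y : 1 <= wt y. Proof. by rewrite lerDl. Qed.

Lemma wt_gt0 y : 0 < wt y. Proof. by rewrite (lt_le_trans ltr01) ?wt_ge1. Qed.

Lemma wt_ge0 y : 0 <= wt y. Proof. exact/ltW/wt_gt0. Qed.

Hint Resolve wt_ge1 wt_gt0 wt_ge0 : core.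

Lemma wtN y : wt (- y) = wt y. Proof. by rewrite /wt normrN. Qed.

Lemma wtBC x y : wt (x - y) = wt (y - x). Proof. by rewrite -wtN opprB. Qed.

(** A form of Peetre's inequality: a weight centred at one point is traded for a weight centred at
    another, at the cost of a factor that rapid decay absorbs. *)
Lemma wtD x y : wt (x + y) <= wt x * wt y.
Proof.
have := ler_normD x y; have := mulr_ge0 (normr_ge0 x) (normr_ge0 y).
by rewrite /wt; lra.
Qed.

Lemma wt_triangle x y u : wt (x - u) <= wt (x - y) * wt (y - u).
Proof. by rewrite -{1}(subrKA y) wtD. Qed.

Lemma wtX_triangle E x y u : wt (x - u) ^+ E <= wt (x - y) ^+ E * wt (y - u) ^+ E.
Proof. by rewrite -exprMn lerXn2r ?nnegrE ?mulr_ge0 ?wt_triangle. Qed.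

Lemma measurable_wtX u E :
  measurable_fun setT (fun y => (wt (y - u))^-1 ^+ E : measurableTypeR R).
Proof. exact: (continuous_measurable_rV (@continuous_weight R 'rV[R]_n u E)). Qed.

(** In the sup norm [(1 + |y|)^2] dominates [1 + y_i^2] for every coordinate, so the weight of order
    [2 * n] is at most a product of [n] functions [1 / (1 + t^2)], each of integral [pi]. *)
Lemma integral_wt u :
  (\int[mu]_y ((wt (y - u))^-1 ^+ (2 * n))%:E <= (pi ^+ n)%:E)%E.
Proof.
pose h (t : R) := (1 + t ^+ 2)^-1.
have mh : measurable_fun setT (h : measurableTypeR R -> measurableTypeR R).
  exact: continuous_measurable_fun (@continuous_oneDsqrV R).
have h0 t : 0 <= h t by rewrite invr_ge0 addr_ge0 ?sqr_ge0.
rewrite -(integral_prod_coord n mh h0 (integral_oneDsqrV R)).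
have mph : measurable_fun setT (fun y : vec => (\prod_i h (y 0 i)%R)%:E).
  by apply/measurable_EFinP; exact: measurable_prod_coord.
have := @integral_affine R n 1 (- u) _ ltr01 mph.
rewrite invr1 expr1n mul1e => <-; last by move=> y; rewrite lee_fin prodr_ge0.
apply: ge0_le_integral => //.
- by move=> y _; rewrite lee_fin exprn_ge0 // invr_ge0.
- by apply/measurable_EFinP; exact: measurable_wtX.
- exact: (measurableT_comp mph (measurable_scale_rV 1 (- u))).
move=> y _; rewrite lee_fin scale1r.
rewrite (_ : (2 * n)%N = \sum_(i < n) 2)%N; last by rewrite sum_nat_const card_ord mulnC.
rewrite -prodrXr; apply: ler_prod => i _; rewrite exprn_ge0 ?invr_ge0 //=.
rewrite exprVn lef_pV2 ?posrE ?exprn_gt0 //; last first.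
  by rewrite ltr_wpDr ?sqr_ge0.
set t := (y - u) 0 i; have tle : `|t| <= `|y - u| by exact: rV_coord_le.
rewrite -(real_normK (num_real t)) /wt; have := normr_ge0 t; nra.
Qed.

Lemma zvecD (a b : lattice) : zvec R (a + b) = zvec R a + zvec R b.
Proof. by apply/rowP => i; rewrite !mxE intrD. Qed.

Lemma zvecN (a : lattice) : zvec R (- a) = - zvec R a.
Proof. by apply/rowP => i; rewrite !mxE mulrNz. Qed.

Lemma zvec0 : zvec R (0 : lattice) = 0.
Proof. by apply/rowP => i; rewrite !mxE. Qed.

Definition unit_cube (nu : lattice) : set vec :=
  [set y | forall i, `[(nu 0 i)%:~R, (nu 0 i)%:~R + 1[%classic (y 0 i)].

Lemma unit_cubeP nu y : unit_cube nu y -> nu = \row_i Num.floor (y 0 i).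
Proof.
move=> H; apply/rowP => i; rewrite mxE; apply/esym/floor_def.
by have := H i; rewrite /= in_itv /= intrD.
Qed.

Lemma measurable_unit_cube nu : measurable (unit_cube nu).
Proof.
by apply: (@measurable_cylinder R n (fun i => `[(nu 0 i)%:~R, (nu 0 i)%:~R + 1[%classic)) => i; exact: measurable_itv.
Qed.

Lemma lebesgue_unit_cube nu : mu (unit_cube nu) = 1%E.
Proof.
rewrite (@lebesgue_cylinder _ _ (fun i => `[(nu 0 i)%:~R, (nu 0 i)%:~R + 1[%classic) (fun=> 1)).
- by rewrite big1_eq.
- by move=> i; exact: measurable_itv.
- move=> i; rewrite lebesgue_measure_itv /= lte_fin ltrDl ltr01.
  by rewrite -EFinB addrAC subrr add0r.
Qed.

Lemma unit_cube_norm nu y : unit_cube nu y -> wt (zvec R nu - y) <= 2.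
Proof.
move=> H; rewrite /wt -[leRHS]/(1 + 1) lerD2l; apply/rV_norm_leP => // i.
by have := H i; rewrite !mxE /= in_itv /= ler_norml => /andP[? ?]; apply/andP; split; lra.
Qed.

(** [pi ^+ n] bounds the integral of the weight, and [2 ^+ (2 * n)] pays for moving a lattice point
    to an arbitrary point of its unit cube. *)
Definition wt_sum : R := 2 ^+ (2 * n) * pi ^+ n.

Lemma wt_sum_ge0 : 0 <= wt_sum.
Proof. by rewrite mulr_ge0 ?exprn_ge0 ?pi_ge0. Qed.

(** Comparison with the integral: each term is the integral of a constant over the unit cube at
    [nu], and on that cube the constant is at most [2 ^+ (2 * n)] times the weight at the current
    point. *)
Lemma lattice_wt u :
  (\esum_(nu in setT) ((wt (u - zvec R nu))^-1 ^+ (2 * n))%:E <= wt_sum%:E)%E.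
Proof.
apply: ge_ereal_sup => _ [A [Afin _] <-].
pose c nu : R := (wt (u - zvec R nu))^-1 ^+ (2 * n).
have c0 nu : 0 <= c nu by rewrite exprn_ge0 // invr_ge0.
pose G y : R := (wt (y - u))^-1 ^+ (2 * n).
have G0 y : 0 <= G y by rewrite exprn_ge0 // invr_ge0.
have mG : measurable_fun setT (G : vec -> measurableTypeR R) by exact: measurable_wtX.
have -> : (\sum_(nu \in A) (c nu)%:E =
    \sum_(nu \in A) \int[mu]_y (c nu * \1_(unit_cube nu) y)%:E)%E.
  apply: eq_fsbigr => nu _; under eq_integral do rewrite EFinM.
  rewrite ge0_integralZl_EFin //.
  - rewrite integral_indic //; last exact: measurable_unit_cube.
    rewrite setIT -[LHS]mule1; congr (_ * _)%E.
    exact/esym/lebesgue_unit_cube.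
  - by apply/measurable_EFinP; apply: measurable_indic; exact: measurable_unit_cube.
rewrite -ge0_integral_fsum //; last 2 first.
- move=> nu; apply/measurable_EFinP; apply: measurable_funM => //.
  by apply: measurable_indic; exact: measurable_unit_cube.
- by move=> nu y _; rewrite lee_fin mulr_ge0.
apply: (@le_trans _ _ (\int[mu]_y ((2 ^+ (2 * n))%:E * (G y)%:E))%E); last first.
  rewrite ge0_integralZl_EFin ?exprn_ge0 //; [|by move=> y _; rewrite lee_fin|exact/measurable_EFinP].
  by rewrite EFinM lee_pmul2l // ?lte_fin ?exprn_gt0 //; exact: integral_wt.
apply: ge0_le_integral => //.
- by move=> y _; apply: fsume_ge0 => nu _; rewrite lee_fin mulr_ge0.
- apply: emeasurable_fsum => // nu; apply/measurable_EFinP; apply: measurable_funM => //.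
  by apply: measurable_indic; exact: measurable_unit_cube.
- by apply/measurable_EFinP; apply: measurable_funM.
(* The cubes are disjoint: only the one indexed by the floors of the coordinates of [y] can contain
   [y], so at most one term of the sum survives. *)
move=> y _; pose nu := \row_i Num.floor (y 0 i).
have [yA|yA] := pselect (A nu).
  rewrite (fsbigD1 nu) //=.
  rewrite fsbig1 ?adde0; last first.
    move=> nu' /= [_ neq]; rewrite indicE memNset ?mulr0 // => /unit_cubeP.
    by move=> E; apply: neq; rewrite E.
  rewrite -EFinM lee_fin.
  have [/set_mem cy|/negPf ncy] := boolP (y \in unit_cube nu); last first.
    by rewrite indicE ncy mulr0 mulr_ge0 // exprn_ge0.
  rewrite indicE mem_set // mulr1 /c /G !exprVn ler_pdivlMr ?exprn_gt0 //.
  rewrite ler_pdivrMl ?exprn_gt0 // -exprMn.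
  rewrite lerXn2r ?nnegrE ?mulr_ge0 // (le_trans (wt_triangle y (zvec R nu) u)) //.
  by rewrite [leLHS]mulrC (wtBC _ u) ler_wpM2l // wtBC unit_cube_norm.
rewrite fsbig1; first by rewrite -EFinM lee_fin mulr_ge0 // exprn_ge0.
move=> nu' nA'; rewrite indicE memNset ?mulr0 // => /unit_cubeP E.
by apply: yA; rewrite /nu -E.
Qed.

End weight.
#[global] Hint Resolve wt_ge1 wt_gt0 wt_ge0 : core.

Local Notation cmod := (@ComplexField.Normc.normc _).
Local Notation Re := complex.Re.
Local Notation Im := complex.Im.

(** * Complex-valued integrals and lattice sums *)

Section cmod_theory.
Context (R : realType).
Implicit Types z w : complex R.

Lemma ReD z w : Re (z + w) = Re z + Re w. Proof. by case: z w => [? ?] []. Qed.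
Lemma ImD z w : Im (z + w) = Im z + Im w. Proof. by case: z w => [? ?] []. Qed.
Lemma ReN z : Re (- z) = - Re z. Proof. by case: z. Qed.
Lemma ImN z : Im (- z) = - Im z. Proof. by case: z. Qed.
Lemma ReM z w : Re (z * w) = Re z * Re w - Im z * Im w.
Proof. by case: z w => [? ?] []. Qed.
Lemma ImM z w : Im (z * w) = Re z * Im w + Im z * Re w.
Proof. by case: z w => [? ?] []. Qed.
Lemma ReJ z : Re (conjc z) = Re z. Proof. by case: z. Qed.
Lemma ImJ z : Im (conjc z) = - Im z. Proof. by case: z. Qed.

Lemma complex_ext z w : Re z = Re w -> Im z = Im w -> z = w.
Proof. by case: z w => [? ?] [? ?] /= -> ->. Qed.

Lemma cmodE z : cmod z = Num.sqrt (Re z ^+ 2 + Im z ^+ 2). Proof. by case: z. Qed.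

Lemma cmod_ge0 z : 0 <= cmod z. Proof. by rewrite cmodE sqrtr_ge0. Qed.

Lemma cmod0 : cmod 0 = 0 :> R. Proof. exact: ComplexField.Normc.normc0. Qed.

Lemma cmodM z w : cmod (z * w) = cmod z * cmod w.
Proof. exact: ComplexField.Normc.normcM. Qed.

Lemma cmodD z w : cmod (z + w) <= cmod z + cmod w.
Proof. exact: le_normcD. Qed.

Lemma cmodN z : cmod (- z) = cmod z. Proof. exact: normcN. Qed.

Lemma cmodB z w : cmod (z - w) <= cmod z + cmod w.
Proof. by rewrite -(cmodN w) cmodD. Qed.

Lemma cmodJ z : cmod (conjc z) = cmod z.
Proof. by rewrite !cmodE ReJ ImJ sqrrN. Qed.

Lemma cmod_real (t : R) : cmod (t%:C)%C = `|t|.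
Proof. by rewrite cmodE /= expr0n addr0 sqrtr_sqr. Qed.

Lemma sqr_cmod z : cmod z ^+ 2 = Re z ^+ 2 + Im z ^+ 2.
Proof. by rewrite cmodE sqr_sqrtr // addr_ge0 ?sqr_ge0. Qed.

Lemma Re_le_cmod z : `|Re z| <= cmod z.
Proof. by rewrite cmodE -sqrtr_sqr ler_wsqrtr // lerDl sqr_ge0. Qed.

Lemma Im_le_cmod z : `|Im z| <= cmod z.
Proof. by rewrite cmodE -sqrtr_sqr ler_wsqrtr // lerDr sqr_ge0. Qed.

Lemma cmod_le_ReIm z : cmod z <= `|Re z| + `|Im z|.
Proof.
rewrite -(ler_pXn2r (_ : 0 < 2)%N) ?nnegrE ?addr_ge0 ?cmod_ge0 //.
rewrite sqr_cmod sqrrD !real_normK ?num_real // addrAC lerDl.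
by rewrite mulrn_wge0 // mulr_ge0.
Qed.

Lemma cmod_eq0 z : cmod z = 0 -> z = 0.
Proof. exact: ComplexField.Normc.eq0_normc. Qed.

Lemma cmod_sum I (r : seq I) (P : pred I) (F : I -> complex R) :
  cmod (\sum_(i <- r | P i) F i) <= \sum_(i <- r | P i) cmod (F i).
Proof.
elim/big_rec2 : _ => [|i y x _ H]; first by rewrite cmod0.
by apply: le_trans (cmodD _ _) _; rewrite lerD2l.
Qed.

Lemma Re_sum I (r : seq I) (P : pred I) (F : I -> complex R) :
  Re (\sum_(i <- r | P i) F i) = \sum_(i <- r | P i) Re (F i).
Proof. by elim/big_rec2 : _ => // i y x _ <-; rewrite ReD. Qed.

Lemma Im_sum I (r : seq I) (P : pred I) (F : I -> complex R) :
  Im (\sum_(i <- r | P i) F i) = \sum_(i <- r | P i) Im (F i).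
Proof. by elim/big_rec2 : _ => // i y x _ <-; rewrite ImD. Qed.

End cmod_theory.

Section cint.
Context d (T : measurableType d) (R : realType) (m : {measure set T -> \bar R}).
Implicit Types g h : T -> complex R.
Local Notation mfun f := (measurable_fun setT (f : T -> measurableTypeR R)).

Definition cmeas g := mfun (fun x => Re (g x)) /\ mfun (fun x => Im (g x)).

(** The measure is arbitrary, so that integrals over R^n and, through the counting measure, sums
    over the lattice share one theory, Fubini included. *)
Definition cint g : complex R :=
  Complex (Rintegral m setT (fun x => Re (g x))) (Rintegral m setT (fun x => Im (g x))).

Definition cintegrable g :=
  cmeas g /\ (\int[m]_x (cmod (g x))%:E < +oo)%E.

Lemma cmeasD g h : cmeas g -> cmeas h -> cmeas (fun x => g x + h x).
Proof.
move=> [g1 g2] [h1 h2]; split.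
  by under eq_fun do rewrite ReD; exact: measurable_funD.
by under eq_fun do rewrite ImD; exact: measurable_funD.
Qed.

Lemma cmeasN g : cmeas g -> cmeas (fun x => - g x).
Proof.
move=> [g1 g2]; split.
  by under eq_fun do rewrite ReN; exact: measurable_funN.
by under eq_fun do rewrite ImN; exact: measurable_funN.
Qed.

Lemma cmeasB g h : cmeas g -> cmeas h -> cmeas (fun x => g x - h x).
Proof. by move=> mg mh; exact: cmeasD mg (cmeasN mh). Qed.

Lemma cmeasM g h : cmeas g -> cmeas h -> cmeas (fun x => g x * h x).
Proof.
move=> [g1 g2] [h1 h2]; split.
  by under eq_fun do rewrite ReM; apply: measurable_funB; exact: measurable_funM.
by under eq_fun do rewrite ImM; apply: measurable_funD; exact: measurable_funM.
Qed.

Lemma cmeasJ g : cmeas g -> cmeas (fun x => conjc (g x)).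
Proof.
move=> [g1 g2]; split.
  by under eq_fun do rewrite ReJ.
by under eq_fun do rewrite ImJ; exact: measurable_funN.
Qed.

Lemma cmeas_cst (c : complex R) : cmeas (fun=> c).
Proof. by split; exact: measurable_cst. Qed.

Lemma cmeas_sum I (r : seq I) (P : pred I) (F : I -> T -> complex R) :
  (forall i, P i -> cmeas (F i)) -> cmeas (fun x => \sum_(i <- r | P i) F i x).
Proof.
move=> H; elim: r => [|i r IH].
  by under eq_fun do rewrite big_nil; exact: cmeas_cst.
under eq_fun do rewrite big_cons.
by case Pi: (P i) => //; apply: cmeasD => //; exact: H.
Qed.

Lemma measurable_cmod g : cmeas g -> mfun (fun x => cmod (g x)).
Proof.
move=> [g1 g2]; under eq_fun do rewrite cmodE.
apply: (measurableT_comp (continuous_measurable_fun (@sqrt_continuous R))).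
by apply: measurable_funD; apply: measurable_funX.
Qed.

Lemma measurable_ecmod g : cmeas g -> measurable_fun setT (fun x => (cmod (g x))%:E).
Proof. by move=> /measurable_cmod; move/measurable_EFinP. Qed.

Hint Resolve measurable_ecmod : core.

Lemma cintegrable_Re g : cintegrable g -> m.-integrable setT (EFin \o (fun x => Re (g x))).
Proof.
move=> [[mg1 mg2] H]; apply/integrableP; split; first exact/measurable_EFinP.
apply: le_lt_trans H; apply: ge0_le_integral => //.
- by apply: measurableT_comp => //; exact/measurable_EFinP.
- exact: measurable_ecmod.
- by move=> x _; rewrite /= lee_fin Re_le_cmod.
Qed.

Lemma cintegrable_Im g : cintegrable g -> m.-integrable setT (EFin \o (fun x => Im (g x))).
Proof.
move=> [[mg1 mg2] H]; apply/integrableP; split; first exact/measurable_EFinP.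
apply: le_lt_trans H; apply: ge0_le_integral => //.
- by apply: measurableT_comp => //; exact/measurable_EFinP.
- exact: measurable_ecmod.
- by move=> x _; rewrite /= lee_fin Im_le_cmod.
Qed.

Hint Resolve cintegrable_Re cintegrable_Im : core.

Lemma le_cintegral g (F : T -> \bar R) : cmeas g -> measurable_fun setT F ->
  (forall x, (cmod (g x))%:E <= F x)%E ->
  (\int[m]_x (cmod (g x))%:E <= \int[m]_x F x)%E.
Proof.
move=> mg mF H; apply: ge0_le_integral => //; last exact: measurable_ecmod.
by move=> x _; rewrite lee_fin cmod_ge0.
Qed.

Lemma integrable_cintegrable g : m.-integrable setT (EFin \o (fun x => Re (g x))) ->
  m.-integrable setT (EFin \o (fun x => Im (g x))) -> cintegrable g.
Proof.
move=> /integrableP[mR iR] /integrableP[mI iI].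
have mg : cmeas g by split; exact/measurable_EFinP.
split => //; apply: (@le_lt_trans _ _ (\int[m]_x (`|(Re (g x))%:E| + `|(Im (g x))%:E|))%E).
  apply: le_cintegral => //.
    by apply: emeasurable_funD; apply: measurableT_comp.
  by move=> x; rewrite -EFinD lee_fin cmod_le_ReIm.
rewrite ge0_integralD //; first exact: lte_add_pinfty.
  by apply: measurableT_comp.
by apply: measurableT_comp.
Qed.

Lemma cintegrable0 : cintegrable (fun=> 0).
Proof.
split; first exact: cmeas_cst.
by under eq_integral do rewrite cmod0; rewrite integral0.
Qed.

Lemma cintegrableD g h : cintegrable g -> cintegrable h -> cintegrable (fun x => g x + h x).
Proof.
move=> [mg ig] [mh ih]; have mgh := cmeasD mg mh; split => //.
apply: (@le_lt_trans _ _ (\int[m]_x ((cmod (g x))%:E + (cmod (h x))%:E))%E).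
  apply: le_cintegral => //; first by apply: emeasurable_funD; exact: measurable_ecmod.
  by move=> x; rewrite -EFinD lee_fin cmodD.
rewrite ge0_integralD //; first exact: lte_add_pinfty.
- by move=> x _; rewrite lee_fin cmod_ge0.
- exact: measurable_ecmod.
- by move=> x _; rewrite lee_fin cmod_ge0.
- exact: measurable_ecmod.
Qed.

Lemma integral_cmodZ c g : cmeas g ->
  (\int[m]_x (cmod (c * g x))%:E = (cmod c)%:E * \int[m]_x (cmod (g x))%:E)%E.
Proof.
move=> mg; under eq_integral do rewrite cmodM EFinM.
rewrite ge0_integralZl_EFin ?cmod_ge0 //.
- by move=> x _; rewrite lee_fin cmod_ge0.
- exact: measurable_ecmod.
Qed.

Lemma cintegrableZ c g : cintegrable g -> cintegrable (fun x => c * g x).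
Proof.
move=> [mg ig]; split; first by apply: cmeasM => //; exact: cmeas_cst.
rewrite integral_cmodZ // lte_mul_pinfty // lee_fin; exact: cmod_ge0.
Qed.

Lemma cintegrableN g : cintegrable g -> cintegrable (fun x => - g x).
Proof.
move=> [mg ig]; split; first exact: cmeasN.
by under eq_integral do rewrite cmodN.
Qed.

Lemma cintegrable_le g (F : T -> R) : cmeas g -> mfun F ->
  (forall x, cmod (g x) <= F x) -> (\int[m]_x (F x)%:E < +oo)%E -> cintegrable g.
Proof.
move=> mg mF H iF; split => //; apply: le_lt_trans iF; apply: le_cintegral => //.
by apply/measurable_EFinP.
Qed.

Lemma eq_cint g h : (forall x, g x = h x) -> cint g = cint h.
Proof. by move=> gh; have -> : g = h by apply/funext. Qed.

Lemma cintD g h : cintegrable g -> cintegrable h ->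
  cint (fun x => g x + h x) = cint g + cint h.
Proof.
move=> ig ih; apply: complex_ext; rewrite /= ?ReD ?ImD.
  rewrite -RintegralD //; [|exact: cintegrable_Re..].
  by apply: eq_Rintegral => x _; rewrite ReD.
rewrite -RintegralD //; [|exact: cintegrable_Im..].
by apply: eq_Rintegral => x _; rewrite ImD.
Qed.

Lemma cintZ c g : cintegrable g -> cint (fun x => c * g x) = c * cint g.
Proof.
move=> ig; have iR := cintegrable_Re ig; have iI := cintegrable_Im ig.
have iZ (a : R) (f : T -> R) : m.-integrable setT (EFin \o f) ->
    m.-integrable setT (EFin \o (fun x => a * f x)).
  by move=> i; have := integrableZl measurableT a i.
apply: complex_ext; rewrite /= ?ReM ?ImM /=.
  rewrite -!RintegralZl // -RintegralB //; [|exact: iZ..].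
  by apply: eq_Rintegral => x _; rewrite ReM.
rewrite -!RintegralZl // -RintegralD //; [|exact: iZ..].
by apply: eq_Rintegral => x _; rewrite ImM.
Qed.

Lemma cintN g : cintegrable g -> cint (fun x => - g x) = - cint g.
Proof.
move=> ig; rewrite -mulN1r -cintZ //.
by apply: eq_cint => x; rewrite mulN1r.
Qed.

Lemma cintB g h : cintegrable g -> cintegrable h ->
  cint (fun x => g x - h x) = cint g - cint h.
Proof. by move=> ig ih; rewrite cintD ?cintN //; exact: cintegrableN. Qed.

Lemma cint0 : cint (fun=> 0) = 0.
Proof. by apply: complex_ext; rewrite /= /Rintegral integral0. Qed.

Lemma cintegrable_sum I (r : seq I) (P : pred I) (F : I -> T -> complex R) :
  (forall i, P i -> cintegrable (F i)) ->
  cintegrable (fun x => \sum_(i <- r | P i) F i x).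
Proof.
move=> H; elim: r => [|i r IH].
  by under eq_fun do rewrite big_nil; exact: cintegrable0.
under eq_fun do rewrite big_cons.
by case Pi: (P i) => //; apply: cintegrableD => //; exact: H.
Qed.

Lemma cint_sum I (r : seq I) (P : pred I) (F : I -> T -> complex R) :
  (forall i, P i -> cintegrable (F i)) ->
  cint (fun x => \sum_(i <- r | P i) F i x) = \sum_(i <- r | P i) cint (F i).
Proof.
move=> H; elim: r => [|i r IH].
  by under eq_fun do rewrite big_nil; rewrite big_nil cint0.
under eq_fun do rewrite big_cons; rewrite big_cons.
case Pi: (P i) => //; rewrite cintD ?IH //; first exact: H.
exact: cintegrable_sum.
Qed.

Lemma cint_conj g : cintegrable g -> cint (fun x => conjc (g x)) = conjc (cint g).
Proof.
move=> ig; apply: complex_ext; rewrite /= ?ReJ ?ImJ.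
  by apply: eq_Rintegral => x _; rewrite ReJ.
rewrite -[RHS]mulN1r -RintegralZl //; last exact: cintegrable_Im.
by apply: eq_Rintegral => x _; rewrite ImJ mulN1r.
Qed.

(* The factor 2 spares the rotation argument; only orders of magnitude matter. *)
Lemma cmod_cint_le g (B : R) : cintegrable g ->
  (\int[m]_x (cmod (g x))%:E <= B%:E)%E -> cmod (cint g) <= 2 * B.
Proof.
move=> ig HB; have [mg _] := ig; apply: (le_trans (cmod_le_ReIm _)).
have K (f : T -> R) : m.-integrable setT (EFin \o f) ->
    (forall x, `|f x| <= cmod (g x)) -> `|Rintegral m setT f| <= B.
  move=> iF H; rewrite -lee_fin EFin_normr_Rintegral //.
  apply: le_trans (le_abse_integral _ _ _) _ => //; first exact: measurable_int iF.
  apply: le_trans HB; apply: ge0_le_integral => //.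
  - by apply: measurableT_comp => //; exact: measurable_int iF.
  - exact: measurable_ecmod.
  - by move=> x _; rewrite lee_fin.
have := K _ (cintegrable_Re ig) (fun x => Re_le_cmod _).
have := K _ (cintegrable_Im ig) (fun x => Im_le_cmod _).
rewrite /=; lra.
Qed.

End cint.

Section cint_fubini.
Context d1 d2 (T1 : measurableType d1) (T2 : measurableType d2) (R : realType).
Variables (m1 : {sigma_finite_measure set T1 -> \bar R}).
Variables (m2 : {sigma_finite_measure set T2 -> \bar R}).

Lemma Rintegral_fubini (f : T1 * T2 -> R) :
  (m1 \x m2)%E.-integrable setT (EFin \o f) ->
  (forall x, m2.-integrable setT (EFin \o (fun y => f (x, y)))) ->
  (forall y, m1.-integrable setT (EFin \o (fun x => f (x, y)))) ->
  m1.-integrable setT (EFin \o (fun x => Rintegral m2 setT (fun y => f (x, y)))) /\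
  Rintegral m1 setT (fun x => Rintegral m2 setT (fun y => f (x, y))) =
  Rintegral m2 setT (fun y => Rintegral m1 setT (fun x => f (x, y))).
Proof.
move=> fi f1 f2.
have E1 x : (Rintegral m2 setT (fun y => f (x, y)))%:E = (\int[m2]_y (f (x, y))%:E)%E.
  by rewrite fineK // integrable_fin_num //; exact: f1.
have E2 y : (Rintegral m1 setT (fun x => f (x, y)))%:E = (\int[m1]_x (f (x, y))%:E)%E.
  by rewrite fineK // integrable_fin_num //; exact: f2.
split.
  rewrite (_ : _ \o _ = (fun x => \int[m2]_y (EFin \o f) (x, y))%E).
    exact: (integrable_fubini_F fi).
  by apply/funext => x /=; rewrite E1.
congr fine; under eq_integral do rewrite E1.
under [RHS]eq_integral do rewrite E2.
exact: (Fubini fi).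
Qed.

(** Every slice is required to be absolutely integrable, so that the inner integrals are finite at
    every point and [fine] in [Rintegral] loses nothing. *)
Lemma cint_fubini (F : T1 * T2 -> complex R) : cmeas F ->
  (\int[m1]_x \int[m2]_y (cmod (F (x, y)))%:E < +oo)%E ->
  (forall x, \int[m2]_y (cmod (F (x, y)))%:E < +oo)%E ->
  (forall y, \int[m1]_x (cmod (F (x, y)))%:E < +oo)%E ->
  cintegrable m1 (fun x => cint m2 (fun y => F (x, y))) /\
  cint m1 (fun x => cint m2 (fun y => F (x, y))) =
  cint m2 (fun y => cint m1 (fun x => F (x, y))).
Proof.
move=> mF iF i1 i2.
have iF' : cintegrable (m1 \x m2)%E F.
  split => //; rewrite (fubini_tonelli1 (fun p => (cmod (F p))%:E)) //.
    exact: measurable_ecmod.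
  by move=> p; rewrite lee_fin cmod_ge0.
have j1 x : cintegrable m2 (fun y => F (x, y)).
  split; last exact: i1.
  by split; [have := mF.1 | have := mF.2] => h; apply: (measurableT_comp h); exact: measurable_pair1.
have j2 y : cintegrable m1 (fun x => F (x, y)).
  split; last exact: i2.
  by split; [have := mF.1 | have := mF.2] => h; apply: (measurableT_comp h); exact: measurable_pair2.
have [RI RE] := Rintegral_fubini (cintegrable_Re iF') (fun x => cintegrable_Re (j1 x)) (fun y => cintegrable_Re (j2 y)).
have [II IE] := Rintegral_fubini (cintegrable_Im iF') (fun x => cintegrable_Im (j1 x)) (fun y => cintegrable_Im (j2 y)).
split; last by apply: complex_ext.
exact: integrable_cintegrable.
Qed.

End cint_fubini.

(** * Lattice sums as integrals for the counting measure *)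

Section lattice_sum.
Context (R : realType) (n : nat).
Hypothesis n_gt0 : (0 < n)%N.
Local Notation lattice := 'rV[int]_n.
Local Notation count := (@counting _ R).
Implicit Types a b : lattice -> complex R.

(** The lattice is countable, and infinite because [n > 0]; a bijection with [nat] turns its sums
    into integrals for the counting measure. *)
Lemma lattice_enum : exists e : nat -> lattice, bijective e.
Proof.
have inf : infinite_set [set: lattice].
  pose f (k : nat) : lattice := const_mx k%:Z.
  move=> fin; apply: infinite_nat; rewrite -(preimage_setT f).
  apply: finite_preimage fin => k1 k2 _ _ /matrixP /(_ 0 (Ordinal n_gt0)).
  by rewrite !mxE => -[].
have := eq_card_nat (countableP _) inf.
move=> /card_set_bijP[h hb].
by move: hb; rewrite setTT_bijective => -[e eh he]; exists e; exists h.
Qed.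

Definition enum_lattice : nat -> lattice := projT1 (cid lattice_enum).

Lemma enum_lattice_bij : bijective enum_lattice.
Proof. exact: projT2 (cid lattice_enum). Qed.

Lemma esum_lattice (a : lattice -> \bar R) : (forall nu, 0 <= a nu)%E ->
  (\esum_(nu in setT) a nu = \int[count]_k a (enum_lattice k))%E.
Proof.
move=> a0; rewrite ge0_integral_count; last by move=> k; exact: a0.
rewrite nneseries_esumT; last by move=> k; exact: a0.
apply: reindex_esum.
by rewrite setTT_bijective; exact: enum_lattice_bij.
Qed.

Lemma rsumE (a : lattice -> R) :
  rsum a = Rintegral count setT (fun k => a (enum_lattice k)).
Proof.
rewrite /rsum /Rintegral integralE; congr (fine (_ - _)%E).
  rewrite esum_lattice //; apply: eq_integral => k _.
  by rewrite !funeposE.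
by rewrite esum_lattice //; apply: eq_integral => k _; rewrite !funenegE.
Qed.

Lemma csumE a : csum a = cint count (fun k => a (enum_lattice k)).
Proof. by rewrite /csum !rsumE. Qed.

Definition csummable a := (\esum_(nu in setT) (cmod (a nu))%:E < +oo)%E.

Lemma cmeas_nat (g : nat -> complex R) : cmeas g.
Proof. by split. Qed.

Lemma csummableE a : csummable a <-> cintegrable count (fun k => a (enum_lattice k)).
Proof.
rewrite /csummable esum_lattice; last by move=> nu; rewrite lee_fin cmod_ge0.
by split=> [H|[]//]; split => //; exact: cmeas_nat.
Qed.

Lemma csummable_le a (B : R) :
  (\esum_(nu in setT) (cmod (a nu))%:E <= B%:E)%E -> csummable a.
Proof. by move=> H; apply: le_lt_trans H _; rewrite ltry. Qed.

Lemma eq_csum a b : (forall nu, a nu = b nu) -> csum a = csum b.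
Proof. by move=> ab; have -> : a = b by apply/funext. Qed.

Lemma csumD a b : csummable a -> csummable b ->
  csum (fun nu => a nu + b nu) = csum a + csum b.
Proof. by move=> /csummableE ia /csummableE ib; rewrite !csumE cintD. Qed.

Lemma csumB a b : csummable a -> csummable b ->
  csum (fun nu => a nu - b nu) = csum a - csum b.
Proof. by move=> /csummableE ia /csummableE ib; rewrite !csumE cintB. Qed.

Lemma csumZ c a : csummable a -> csum (fun nu => c * a nu) = c * csum a.
Proof. by move=> /csummableE ia; rewrite !csumE cintZ. Qed.

Lemma csum0 : csum (fun _ : lattice => 0 : complex R) = 0.
Proof. by rewrite csumE cint0. Qed.

Lemma csummableD a b : csummable a -> csummable b -> csummable (fun nu => a nu + b nu).
Proof. by move=> /csummableE ia /csummableE ib; apply/csummableE; exact: cintegrableD. Qed.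

Lemma csummableZ c a : csummable a -> csummable (fun nu => c * a nu).
Proof. by move=> /csummableE ia; apply/csummableE; exact: cintegrableZ. Qed.

Lemma csum_sum I (r : seq I) (P : pred I) (F : I -> lattice -> complex R) :
  (forall i, P i -> csummable (F i)) ->
  csum (fun nu => \sum_(i <- r | P i) F i nu) = \sum_(i <- r | P i) csum (F i).
Proof.
move=> H; rewrite csumE (@cint_sum _ _ _ count I r P (fun i k => F i (enum_lattice k))).
  by apply: eq_bigr => i _; rewrite csumE.
by move=> i /H /csummableE.
Qed.

Lemma cmod_csum_le a (B : R) :
  (\esum_(nu in setT) (cmod (a nu))%:E <= B%:E)%E -> cmod (csum a) <= 2 * B.
Proof.
move=> H; have /csummableE ia := csummable_le H.
rewrite csumE; apply: cmod_cint_le => //.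
by rewrite -(esum_lattice (a := fun nu => (cmod (a nu))%:E)) // => nu; rewrite lee_fin cmod_ge0.
Qed.

(** No summability is asked: the positive and the negative parts are extended sums over the whole
    lattice, each invariant under a bijection. *)
Lemma csum_shift a mu : csum (fun nu => a (nu + mu)) = csum a.
Proof.
have H (b : lattice -> \bar R) : (forall nu, 0 <= b nu)%E ->
    (\esum_(nu in setT) b (nu + mu)%R = \esum_(nu in setT) b nu)%E.
  move=> b0; apply/esym.
  apply: (reindex_esum [set: lattice] [set: lattice] (fun nu => nu + mu)) => //.
  by rewrite setTT_bijective; exists (fun nu => nu - mu) => nu; rewrite ?addrK ?subrK.
have K (b : lattice -> R) : rsum (fun nu => b (nu + mu)) = rsum b.
  rewrite /rsum; congr (fine (_ - _)%E).
    by rewrite -[RHS]H //; apply: eq_esum => nu _; rewrite !funeposE.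
  by rewrite -[RHS]H //; apply: eq_esum => nu _; rewrite !funenegE.
rewrite /csum; congr Complex; first exact: (K (fun nu => Re (a nu))).
exact: (K (fun nu => Im (a nu))).
Qed.

Lemma csum_delta (mu : lattice) (z : complex R) : csum (fun nu : lattice => (nu == mu)%:R * z) = z.
Proof.
(* [f] stands for the positive part and then for the negative part, both of which vanish at 0. *)
have H (f : \bar R -> \bar R) (t : R) : f 0%E = 0%E -> (0 <= f t%:E)%E ->
    (\esum_(nu in [set: lattice]) f ((nu == mu)%:R * t)%:E = f t%:E)%E.
  move=> f0 ft; rewrite (esumID [set mu]); last first.
    by move=> nu _; case: eqP => _; rewrite ?mul1r ?mul0r ?f0.
  rewrite setTI esum_set1 ?eqxx ?mul1r //.
  by rewrite esum1 ?adde0 // => nu [_ /eqP/negPf ->]; rewrite mul0r f0.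
have K (t : R) : rsum (fun nu => (nu == mu)%:R * t) = t.
  rewrite /rsum.
  have -> : (\esum_(nu in [set: lattice]) ((EFin \o (fun nu => (nu == mu)%:R * t)%R)^\+) nu = maxe t%:E 0)%E.
    rewrite -(H (fun e => maxe e 0%E)) ?maxxx ?le_max ?lexx ?orbT //.
    by apply: eq_esum => nu _; rewrite funeposE.
  have -> : (\esum_(nu in [set: lattice]) ((EFin \o (fun nu => (nu == mu)%:R * t)%R)^\-) nu = maxe (- t%:E) 0)%E.
    rewrite -(H (fun e => maxe (- e)%E 0%E)) ?oppe0 ?maxxx ?le_max ?lexx ?orbT //.
    by apply: eq_esum => nu _; rewrite funenegE.
  rewrite -EFinN -!EFin_max -EFinB /= /Num.max; case: ltP => ?; case: ltP => ?; lra.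
rewrite /csum; apply: complex_ext => /=.
  rewrite -[RHS]K; congr rsum; apply/funext => nu.
  by rewrite ReM; case: eqP => _ /=; rewrite ?mul0r ?mul1r subr0.
rewrite -[RHS]K; congr rsum; apply/funext => nu.
by rewrite ImM; case: eqP => _ /=; rewrite ?mul0r ?mul1r addr0.
Qed.

End lattice_sum.

Section nonmeasurable_integral.
Context d (T : measurableType d) (R : realType) (m : {measure set T -> \bar R}).

(** For a nonnegative function, measurable or not, the integral is a supremum over simple functions
    below it, hence monotone. The functions of the theorem are only a.e. equal to Borel
    functions. *)
Lemma ge0_le_integral_nonmeasurable (f g : T -> \bar R) :
  (forall x, 0 <= f x)%E -> (forall x, f x <= g x)%E ->
  (\int[m]_x f x <= \int[m]_x g x)%E.
Proof.
move=> f0 fg; have g0 x : (0 <= g x)%E := le_trans (f0 x) (fg x).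
rewrite !ge0_integralTE //; apply: le_ereal_sup => _ /= [h hf <-].
by exists h => // x; exact: le_trans (hf x) (fg x).
Qed.

(** [f] lies between two measurable modifications of [g] on the null set, with the values 0 and
    infinity there, and both have the integral of [g]. *)
Lemma ge0_ae_eq_integral_nonmeasurable (f g : T -> \bar R) :
  (forall x, 0 <= f x)%E -> (forall x, 0 <= g x)%E -> measurable_fun setT g ->
  {ae m, forall x, f x = g x} -> (\int[m]_x f x = \int[m]_x g x)%E.
Proof.
move=> f0 g0 mg [N [mN N0 HN]].
have fgN x : ~ N x -> f x = g x by move=> nN; apply: contrapT => H; apply: nN; exact: HN.
have patch (c : \bar R) : (0 <= c)%E ->
    (\int[m]_x (if x \in N then c else g x) = \int[m]_x g x)%E.
  move=> c0; apply: ge0_ae_eq_integral => //.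
  - apply: measurable_fun_if => //; first apply: (measurable_fun_bool true).
    + by rewrite setTI (_ : _ @^-1` _ = N) //; apply/seteqP; split => x /= => [/set_mem|/mem_set].
    + exact: measurable_funTS.
  - by move=> x _; case: ifP.
  - exists N; split => // x /= H; apply: contrapT => nN; apply: H => _.
    by rewrite memNset.
apply/eqP; rewrite eq_le; apply/andP; split.
  rewrite -(patch +oo%E) ?leey //; apply: ge0_le_integral_nonmeasurable => // x.
  by case: ifPn => [_|]; rewrite ?leey // notin_setE => /fgN ->.
rewrite -(patch 0%E) //; apply: ge0_le_integral_nonmeasurable => x.
  by case: ifP.
by case: ifPn => [_|]; rewrite // notin_setE => /fgN ->.
Qed.

Lemma ae_eq_Rintegral (f g : T -> R) :
  measurable_fun setT (g : T -> measurableTypeR R) ->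
  {ae m, forall x, f x = g x} -> Rintegral m setT f = Rintegral m setT g.
Proof.
move=> mg fg; rewrite /Rintegral !(integralE _ _ (fun x => (_ x)%:E)).
have mg' : measurable_fun setT (fun x => (g x)%:E) by apply/measurable_EFinP.
congr (fine (_ - _)%E); apply: ge0_ae_eq_integral_nonmeasurable => //.
- exact: measurable_funepos.
- by apply: filterS fg => x fgx; rewrite !funeposE fgx.
- exact: measurable_funeneg.
- by apply: filterS fg => x fgx; rewrite !funenegE fgx.
Qed.

Lemma ae_eq_cint (f g : T -> complex R) : cmeas g ->
  {ae m, forall x, f x = g x} -> cint m f = cint m g.
Proof.
move=> [mg1 mg2] fg; apply: complex_ext => /=; apply: ae_eq_Rintegral => //.
- by apply: filterS fg => x ->.
- by apply: filterS fg => x ->.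
Qed.

End nonmeasurable_integral.

HB.instance Definition _ (R : realType) := Measure_isSigmaFinite.Build _ _ _
  (@counting nat R) (sigma_finite_counting R).

Section lattice_integral.
Context (R : realType) (n : nat).
Hypothesis n_gt0 : (0 < n)%N.
Local Notation lattice := 'rV[int]_n.
Local Notation vec := 'rV[R]_n.
Local Notation mu := (lebesgue_rV R n).
Local Notation count := (@counting nat R).
Local Notation enum_lattice := (enum_lattice n_gt0).

Section sum_integral.
Context d (T : measurableType d) (m : {sigma_finite_measure set T -> \bar R}).
Variable F : lattice -> T -> complex R.
Hypothesis mF : forall nu, cmeas (F nu).

Let G (p : T * nat) : complex R := F (enum_lattice p.2) p.1.

Let measurable_prod_nat (h : T * nat -> R) :
  (forall k, measurable_fun setT (fun x => h (x, k) : measurableTypeR R)) ->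
  measurable_fun setT (h : T * nat -> measurableTypeR R).
Proof.
move=> mh _ B mB; rewrite setTI.
rewrite (_ : h @^-1` B = \bigcup_k ((fun x => h (x, k)) @^-1` B `*` [set k])).
  apply: bigcupT_measurable => k; apply: measurableX => //.
  by rewrite -[X in measurable X]setTI; exact: mh.
by apply/seteqP; split => [[x k] /= H|[x k] [k' _ [/= H ->]] //]; exists k.
Qed.

Let mG : cmeas G.
Proof.
by split; apply: measurable_prod_nat => k; [exact: (mF (enum_lattice k)).1|exact: (mF (enum_lattice k)).2].
Qed.

Lemma cmeas_csum : cmeas (fun x => csum (fun nu => F nu x)).
Proof.
under eq_fun do rewrite (csumE n_gt0).
have K (h : T * nat -> R) : measurable_fun setT (h : T * nat -> measurableTypeR R) ->
    measurable_fun setT (fun x => Rintegral count setT (fun k => h (x, k)) : measurableTypeR R).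
  move=> mh; apply: (measurableT_comp (fine_measurable measurableT)).
  under eq_fun do rewrite integralE.
  have mh' : measurable_fun setT (EFin \o h) by exact/measurable_EFinP.
  apply: emeasurable_funB.
    rewrite (_ : (fun _ => _) = (fun x => \int[count]_k ((EFin \o h)^\+ (x, k))%E)%E).
      exact: (@measurable_fun_fubini_tonelli_F _ _ T nat R count _ (measurable_funepos mh') (funepos_ge0 _)).
    by apply/funext => x; apply: eq_integral => k _; rewrite !funeposE.
  rewrite (_ : (fun _ => _) = (fun x => \int[count]_k ((EFin \o h)^\- (x, k))%E)%E).
    exact: (@measurable_fun_fubini_tonelli_F _ _ T nat R count _ (measurable_funeneg mh') (funeneg_ge0 _)).
  by apply/funext => x; apply: eq_integral => k _; rewrite !funenegE.
by split; [exact: (K _ mG.1)|exact: (K _ mG.2)].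
Qed.

(** Fubini for the product with the counting measure. Domination by [H] at every point makes each
    inner sum absolutely convergent, and integrability of [H] does the rest. *)
Lemma cint_csum (H : T -> R) : measurable_fun setT (H : T -> measurableTypeR R) ->
  (\int[m]_x (H x)%:E < +oo)%E ->
  (forall x, \esum_(nu in setT) (cmod (F nu x))%:E <= (H x)%:E)%E ->
  [/\ cintegrable m (fun x => csum (fun nu => F nu x)),
      forall nu, cintegrable m (F nu) &
      cint m (fun x => csum (fun nu => F nu x)) = csum (fun nu => cint m (F nu))].
Proof.
move=> mH iH HF.
have HF' x : (\int[count]_k (cmod (G (x, k)))%:E <= (H x)%:E)%E.
  apply: le_trans (HF x); rewrite (esum_lattice n_gt0) // => nu.
  by rewrite lee_fin cmod_ge0.
have FH nu x : cmod (F nu x) <= H x.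
  rewrite -lee_fin; apply: le_trans (HF x).
  by apply: esum_ge; exists [set nu]; rewrite ?fsbig_set1 //; split.
have iF nu : cintegrable m (F nu) by apply: (cintegrable_le (mF nu) mH).
have [|||h1 h2] := @cint_fubini _ _ T nat R m count G mG.
- apply: le_lt_trans iH; apply: ge0_le_integral => //.
  + by move=> x _; apply: integral_ge0 => k _; rewrite lee_fin cmod_ge0.
  + apply: (@measurable_fun_fubini_tonelli_F _ _ T nat R count (fun p => (cmod (G p))%:E)).
      exact: measurable_ecmod.
    by move=> p; rewrite lee_fin cmod_ge0.
  + by apply/measurable_EFinP.
- by move=> x; apply: le_lt_trans (HF' x) _; rewrite ltry.
- by move=> k; exact: (iF (enum_lattice k)).2.
split; [|exact: iF|].
  by under eq_fun do rewrite (csumE n_gt0).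
under eq_cint do rewrite (csumE n_gt0).
by rewrite (csumE n_gt0).
Qed.

Lemma esum_integral_cmod :
  (\esum_(nu in setT) \int[m]_x (cmod (F nu x))%:E =
   \int[m]_x \esum_(nu in setT) (cmod (F nu x))%:E)%E.
Proof.
rewrite (esum_lattice n_gt0); last first.
  by move=> nu; apply: integral_ge0 => x _; rewrite lee_fin cmod_ge0.
transitivity (\int[m]_x \int[count]_k (cmod (G (x, k)))%:E)%E; last first.
  apply: eq_integral => x _; rewrite (esum_lattice n_gt0) // => nu.
  by rewrite lee_fin cmod_ge0.
rewrite (@fubini_tonelli _ _ T nat R m count (fun p => (cmod (G p))%:E)) //.
  exact: measurable_ecmod.
by move=> p; rewrite lee_fin cmod_ge0.
Qed.

Lemma esum_cint_le (H : T -> R) (B : R) :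
  measurable_fun setT (H : T -> measurableTypeR R) ->
  (\int[m]_x (H x)%:E <= B%:E)%E ->
  (forall x, \esum_(nu in setT) (cmod (F nu x))%:E <= (H x)%:E)%E ->
  (\esum_(nu in setT) (cmod (cint m (F nu)))%:E <= (2 * B)%:E)%E.
Proof.
move=> mH iH HF.
have [_ iF _] := cint_csum mH (le_lt_trans iH (ltry _)) HF.
have I0 nu : (0 <= \int[m]_x (cmod (F nu x))%:E)%E.
  by apply: integral_ge0 => y _; rewrite lee_fin cmod_ge0.
apply: (@le_trans _ _ (\esum_(nu in setT) (2%:E * \int[m]_x (cmod (F nu x))%:E))%E).
  apply: le_esum => nu _; have [_] := iF nu; have := I0 nu.
  case E1 : (\int[m]_y (cmod (F nu y))%:E)%E => [r| |] //= _ _.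
  by rewrite -EFinM lee_fin; apply: (cmod_cint_le (iF nu)); rewrite E1.
apply: ge_ereal_sup => _ [A Afin <-].
rewrite -ge0_mule_fsumr // EFinM lee_wpmul2l //; apply: le_trans iH.
apply: (@le_trans _ _ (\esum_(nu in setT) \int[m]_x (cmod (F nu x))%:E)%E).
  by apply: ereal_sup_ubound; exists A.
rewrite esum_integral_cmod; apply: ge0_le_integral_nonmeasurable => //.
by move=> x; apply: esum_ge0 => nu _; rewrite lee_fin cmod_ge0.
Qed.

End sum_integral.

(** The case of [cint_csum] in which the other measure is a counting measure as well. *)
Lemma csum_csum (F : lattice -> lattice -> complex R) (H : lattice -> R) :
  (\esum_(mu in setT) (H mu)%:E < +oo)%E ->
  (forall mu, \esum_(nu in setT) (cmod (F nu mu))%:E <= (H mu)%:E)%E ->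
  [/\ csummable (fun mu => csum (fun nu => F nu mu)),
      forall nu, csummable (F nu), csummable (fun nu => csum (F nu)) &
      csum (fun mu => csum (fun nu => F nu mu)) = csum (fun nu => csum (F nu))].
Proof.
move=> iH HF.
have H0 mu : (0 <= (H mu)%:E)%E.
  by apply: le_trans (HF mu); apply: esum_ge0 => nu _; rewrite lee_fin cmod_ge0.
have [||||h1 h2 h3] := @cint_csum _ _ count (fun nu k => F nu (enum_lattice k)) _
    (fun k => H (enum_lattice k)).
- by move=> nu; exact: cmeas_nat.
- by [].
- by rewrite -(esum_lattice n_gt0 (a := fun mu => (H mu)%:E)).
- by move=> k; exact: HF.
split.
- by apply/(csummableE n_gt0).
- by move=> nu; apply/(csummableE n_gt0); exact: h2.
- have [B HB] : exists B : R, (\int[count]_k (H (enum_lattice k))%:E <= B%:E)%E.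
    rewrite -(esum_lattice n_gt0 (a := fun mu => (H mu)%:E)) //.
    have : (0 <= \esum_(mu in setT) (H mu)%:E)%E by apply: esum_ge0.
    by case: (\esum_(mu in setT) (H mu)%:E)%E iH => // r _ _; exists r.
  apply: (@csummable_le _ _ _ (2 * B)).
  under eq_esum do rewrite (csumE n_gt0).
  by apply: (@esum_cint_le _ _ count (fun nu k => F nu (enum_lattice k)) _ (fun k => H (enum_lattice k))).
- rewrite (csumE n_gt0) h3; apply: eq_csum => nu.
  by rewrite (csumE n_gt0).
Qed.

Lemma esum_wt_le (a : lattice -> complex R) (u : vec) (B : R) : 0 <= B ->
  (forall nu, cmod (a nu) <= B * (wt (u - zvec R nu))^-1 ^+ (2 * n)) ->
  (\esum_(nu in setT) (cmod (a nu))%:E <= (B * wt_sum R n)%:E)%E.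
Proof.
move=> B0 H.
apply: (@le_trans _ _ (\esum_(nu in setT) (B * (wt (u - zvec R nu))^-1 ^+ (2 * n))%:E)%E).
  by apply: le_esum => nu _; rewrite lee_fin.
apply: ge_ereal_sup => _ [A Afin <-].
under eq_fsbigr do rewrite EFinM.
rewrite -ge0_mule_fsumr; last by move=> nu; rewrite lee_fin exprn_ge0 ?invr_ge0 ?wt_ge0.
rewrite EFinM lee_wpmul2l ?lee_fin //.
apply: le_trans (lattice_wt u); apply: ereal_sup_ubound.
by exists A.
Qed.

Lemma integral_wt_le (g : vec -> complex R) (u : vec) (B : R) : 0 <= B -> cmeas g ->
  {ae mu, forall y, cmod (g y) <= B * (wt (y - u))^-1 ^+ (2 * n)} ->
  (\int[mu]_y (cmod (g y))%:E <= (B * pi ^+ n)%:E)%E.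
Proof.
move=> B0 mg H.
apply: (@le_trans _ _ (\int[mu]_y (B%:E * ((wt (y - u))^-1 ^+ (2 * n))%:E))%E).
  apply: ae_ge0_le_integral => //.
  - by move=> y _; rewrite lee_fin cmod_ge0.
  - exact: measurable_ecmod.
  - by move=> y _; rewrite mule_ge0 ?lee_fin // exprn_ge0 ?invr_ge0 ?wt_ge0.
  - by apply: emeasurable_funM => //; apply/measurable_EFinP; exact: measurable_wtX.
  - by apply: filterS H => y Hy _; rewrite -EFinM lee_fin.
rewrite ge0_integralZl_EFin //.
- by rewrite EFinM lee_wpmul2l ?lee_fin // integral_wt.
- by move=> y _; rewrite lee_fin exprn_ge0 ?invr_ge0 ?wt_ge0.
- by apply/measurable_EFinP; exact: measurable_wtX.
Qed.

Lemma cintegrable_wt (g : vec -> complex R) (u : vec) (B : R) : 0 <= B -> cmeas g ->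
  {ae mu, forall y, cmod (g y) <= B * (wt (y - u))^-1 ^+ (2 * n)} ->
  cintegrable mu g /\ cmod (cint mu g) <= 2 * (B * pi ^+ n).
Proof.
move=> B0 mg H; have := integral_wt_le B0 mg H => K.
have ig : cintegrable mu g by split => //; apply: le_lt_trans K _; rewrite ltry.
by split => //; exact: cmod_cint_le.
Qed.

End lattice_integral.

Lemma lerX_ge0 (R : realDomainType) (K : nat) (a b : R) : 0 <= a -> a <= b -> a ^+ K <= b ^+ K.
Proof. by move=> a0 ab; apply: lerXn2r => //; rewrite nnegrE // (le_trans a0). Qed.

(** * Rapid decay of the dual functions *)

Section rapid_decay.
Context (R : realType) (n : nat).
Hypothesis n_gt0 : (0 < n)%N.
Local Notation lattice := 'rV[int]_n.
Local Notation vec := 'rV[R]_n.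
Local Notation mu := (lebesgue_rV R n).
Implicit Types (phi psi : vec -> complex R) (u x y : vec).

Definition rapid phi := forall K : nat, exists2 C : R, 0 <= C &
  forall y, cmod (phi y) <= C * (wt y)^-1 ^+ K.

Lemma wtV_gt0 y : 0 < (wt y)^-1. Proof. by rewrite invr_gt0 wt_gt0. Qed.

Lemma wtVX_ge0 y K : 0 <= (wt y)^-1 ^+ K. Proof. by rewrite exprn_ge0 // ltW // wtV_gt0. Qed.

Lemma wtX_ge0 y K : 0 <= wt y ^+ K. Proof. by rewrite exprn_ge0 // wt_ge0. Qed.

Lemma wtVXK y K : (wt y)^-1 ^+ K * wt y ^+ K = 1.
Proof. by rewrite -exprMn mulVf ?expr1n // gt_eqF // wt_gt0. Qed.

Lemma wtVX_triangle K x y u :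
  (wt (x - y))^-1 ^+ K * (wt (y - u))^-1 ^+ K <= (wt (x - u))^-1 ^+ K.
Proof.
rewrite -exprMn; apply: lerX_ge0; first by rewrite mulr_ge0 // ltW // wtV_gt0.
by rewrite -invfM lef_pV2 ?posrE ?mulr_gt0 ?wt_gt0 // wt_triangle.
Qed.

Lemma wtX_wtVX_le E x y u :
  wt (x - u) ^+ E * (wt (x - y))^-1 ^+ E <= wt (y - u) ^+ E.
Proof.
apply: le_trans (ler_wpM2r (wtVX_ge0 _ _) (wtX_triangle E x y u)) _.
by rewrite mulrAC -exprMn mulfV ?gt_eqF ?wt_gt0 // expr1n mul1r.
Qed.

Lemma rapid_bounded phi : rapid phi -> exists2 C : R, 0 <= C & forall y, cmod (phi y) <= C.
Proof. by move=> /(_ 0%N)[C C0 H]; exists C => // y; have := H y; rewrite mulr1. Qed.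

(** A weight of order [E] centred at [u] is moved to [x] at the price of [E] orders of the decay of
    [phi]; [2 * n] more orders pay for the summation. The constant is independent of [u] and [x],
    which all later rescalings exploit. *)
Lemma esum_growth_le phi E : rapid phi -> exists2 C : R, 0 <= C &
  forall (a : lattice -> complex R) u (Y : R) x, 0 <= Y ->
    (forall nu, cmod (a nu) <= Y * wt (zvec R nu - u) ^+ E) ->
    (\esum_(nu in setT) (cmod (a nu * phi (x - zvec R nu)))%:E <= (C * Y * wt (x - u) ^+ E)%:E)%E.
Proof.
move=> /(_ (E + 2 * n)%N)[C C0 Hphi]; exists (C * wt_sum R n) => [|a u Y x Y0 Ha].
  by rewrite mulr_ge0 // wt_sum_ge0.
rewrite (_ : _ * _ * _ = C * Y * wt (x - u) ^+ E * wt_sum R n); last by ring.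
apply: (esum_wt_le (u := x)) => [|nu]; first by rewrite !mulr_ge0 // wtX_ge0.
rewrite cmodM; apply: le_trans (ler_pM _ _ (Ha nu) (Hphi _)) _; rewrite ?cmod_ge0 //.
rewrite exprD mulrACA (mulrC Y) -!mulrA ler_wpM2l //.
rewrite ler_wpM2l // mulrA ler_wpM2r ?wtVX_ge0 //.
by rewrite (wtBC x (zvec R nu)); exact: wtX_wtVX_le.
Qed.

(** Of the decay of the coefficients, [2 * n] orders pay for the summation, and the other [K]
    combine with the decay of [phi] by the triangle inequality. *)
Lemma esum_rapid_le phi K : rapid phi -> exists2 C : R, 0 <= C &
  forall (a : lattice -> complex R) (Y : R) x, 0 <= Y ->
    (forall nu, cmod (a nu) <= Y * (wt (zvec R nu))^-1 ^+ (K + 2 * n)) ->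
    (\esum_(nu in setT) (cmod (a nu * phi (x - zvec R nu)))%:E <= (C * Y * (wt x)^-1 ^+ K)%:E)%E.
Proof.
move=> /(_ K)[C C0 Hphi]; exists (C * wt_sum R n) => [|a Y x Y0 Ha].
  by rewrite mulr_ge0 // wt_sum_ge0.
rewrite (_ : _ * _ * _ = C * Y * (wt x)^-1 ^+ K * wt_sum R n); last by ring.
apply: (esum_wt_le (u := 0)) => [|nu]; first by rewrite !mulr_ge0 // wtVX_ge0.
rewrite cmodM; apply: le_trans (ler_pM _ _ (Ha nu) (Hphi _)) _; rewrite ?cmod_ge0 //.
rewrite exprD mulrACA (mulrC Y) -!mulrA ler_wpM2l // ler_wpM2l //.
rewrite sub0r wtN mulrCA mulrC ler_wpM2r ?wtVX_ge0 // mulrC.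
by have := wtVX_triangle K x (zvec R nu) 0; rewrite !subr0.
Qed.

Lemma measurable_subr (x : vec) : measurable_fun setT (fun y : vec => y - x).
Proof.
rewrite (_ : (fun _ => _) = (fun y : vec => 1 *: y - x)); last first.
  by apply/funext => y; rewrite scale1r.
exact: measurable_scale_rV.
Qed.

Lemma cmeas_subr psi x : cmeas psi -> cmeas (fun y => psi (y - x)).
Proof.
move=> mpsi; have mt := measurable_subr x.
by split; [exact: (measurableT_comp mpsi.1 mt)|exact: (measurableT_comp mpsi.2 mt)].
Qed.

Lemma cint_growth psi E : rapid psi -> cmeas psi -> exists2 C : R, 0 <= C &
  forall (G : vec -> complex R) u (Y : R) x, 0 <= Y -> cmeas G ->
    {ae mu, forall y, cmod (G y) <= Y * wt (y - u) ^+ E} ->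
    cintegrable mu (fun y => G y * conjc (psi (y - x))) /\
    cmod (cint mu (fun y => G y * conjc (psi (y - x)))) <= C * Y * wt (x - u) ^+ E.
Proof.
move=> /(_ (E + 2 * n)%N)[C C0 Hpsi] mpsi.
exists (2 * C * pi ^+ n) => [|G u Y x Y0 mG HG].
  by rewrite !mulr_ge0 // exprn_ge0 // pi_ge0.
have mtr := cmeas_subr x mpsi.
have := @cintegrable_wt R n (fun y => G y * conjc (psi (y - x))) x (C * Y * wt (x - u) ^+ E).
rewrite (_ : 2 * (_ * pi ^+ n) = 2 * C * pi ^+ n * Y * wt (x - u) ^+ E); last by ring.
apply.
- by rewrite !mulr_ge0 // wtX_ge0.
- by apply: cmeasM => //; exact: cmeasJ.
apply: filterS HG => y Hy; rewrite cmodM cmodJ.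
apply: le_trans (ler_pM _ _ Hy (Hpsi _)) _; rewrite ?cmod_ge0 //.
rewrite exprD mulrACA (mulrC Y) -!mulrA ler_wpM2l // ler_wpM2l // mulrA.
by rewrite ler_wpM2r ?wtVX_ge0 // wtX_wtVX_le.
Qed.

End rapid_decay.

(** * Square integrals and finite combinations of shifts *)

Section energy.
Context (R : realType) (n : nat).
Local Notation vec := 'rV[R]_n.
Local Notation mu := (lebesgue_rV R n).
Implicit Types u v : vec -> complex R.

(** The square of [L2norm]. Working without square roots, the triangle inequality becomes [energyD],
    whose factors 2 are harmless. *)
Definition energy u : \bar R := (\int[mu]_y (cmod (u y) ^+ 2)%:E)%E.

Definition ip u v : complex R := cint mu (fun y => u y * conjc (v y)).

Definition square_integrable u := cmeas u /\ (energy u < +oo)%E.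

Lemma energy_ge0 u : (0 <= energy u)%E.
Proof. by apply: integral_ge0 => y _; rewrite lee_fin sqr_ge0. Qed.

Lemma measurable_sqr_cmod u : cmeas u -> measurable_fun setT (fun y => (cmod (u y) ^+ 2)%:E).
Proof. by move=> mu0; apply/measurable_EFinP; apply: measurable_funX; exact: measurable_cmod. Qed.

Lemma L2normE u : L2norm u = sqrte (energy u).
Proof.
rewrite /L2norm unlock -poweR12_sqrt ?energy_ge0 //; congr (poweR _ _).
apply: eq_integral => y _; rewrite gee0_abs ?lee_fin ?cmod_ge0 //.
by rewrite poweR_EFin powR_mulrn ?cmod_ge0.
Qed.

Lemma L2norm_leE u (b : R) : 0 <= b -> (L2norm u <= b%:E)%E = (energy u <= (b ^+ 2)%:E)%E.
Proof.
move=> b0; rewrite L2normE; have := energy_ge0 u.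
case: (energy u) => [r| |] //= r0; rewrite !lee_fin in r0 *.
by rewrite -(ler_sqr (sqrtr_ge0 r)) ?nnegrE // sqr_sqrtr.
Qed.

Lemma L2norm_ltE u (b : R) : 0 < b -> (L2norm u < b%:E)%E = (energy u < (b ^+ 2)%:E)%E.
Proof.
move=> b0; rewrite L2normE; have := energy_ge0 u.
case: (energy u) => [r| |] //= r0; rewrite lee_fin in r0; rewrite !lte_fin.
by rewrite -(ltr_sqr (sqrtr_ge0 r)) ?nnegrE ?(ltW b0) // sqr_sqrtr.
Qed.

Lemma L2norm_geE u (b : R) : 0 <= b -> (b%:E <= L2norm u)%E = ((b ^+ 2)%:E <= energy u)%E.
Proof.
move=> b0; rewrite L2normE; have := energy_ge0 u.
case: (energy u) => [r| |] //= r0; last by rewrite !leey.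
rewrite !lee_fin in r0 *.
by rewrite -(ler_sqr b0) ?nnegrE ?sqrtr_ge0 // sqr_sqrtr.
Qed.

Lemma eq_energy u v : (forall y, u y = v y) -> energy u = energy v.
Proof. by move=> uv; have -> : u = v by apply/funext. Qed.

Lemma ae_eq_energy u v : cmeas v -> {ae mu, forall y, u y = v y} -> energy u = energy v.
Proof.
move=> mv uv; apply: ge0_ae_eq_integral_nonmeasurable.
- by move=> y; rewrite lee_fin sqr_ge0.
- by move=> y; rewrite lee_fin sqr_ge0.
- exact: measurable_sqr_cmod.
- by apply: filterS uv => y ->.
Qed.

Lemma energyD u v : cmeas u -> cmeas v ->
  (energy (fun y => (u y + v y)%R) <= 2%:E * energy u + 2%:E * energy v)%E.
Proof.
move=> mu0 mv; rewrite /energy.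
have P w : forall x : vec, setT x -> (0 <= (cmod (w x) ^+ 2)%:E)%E by move=> x _; rewrite lee_fin sqr_ge0.
rewrite -!ge0_integralZl_EFin //; try exact: measurable_sqr_cmod; try exact: P.
rewrite -ge0_integralD //.
- apply: ge0_le_integral => //.
  + by move=> y _; rewrite lee_fin sqr_ge0.
  + exact: (measurable_sqr_cmod (cmeasD mu0 mv)).
  + apply: emeasurable_funD; apply: emeasurable_funM => //; exact: measurable_sqr_cmod.
  move=> y _; rewrite -!EFinM -EFinD lee_fin.
  apply: (@le_trans _ _ ((cmod (u y) + cmod (v y)) ^+ 2)).
    by apply: lerX_ge0; [exact: cmod_ge0|exact: cmodD].
  by have := sqr_ge0 (cmod (u y) - cmod (v y)); rewrite sqrrB sqrrD; lra.
- by move=> x _; rewrite -EFinM lee_fin mulr_ge0 // sqr_ge0.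
- by apply: emeasurable_funM => //; exact: measurable_sqr_cmod.
- by move=> x _; rewrite -EFinM lee_fin mulr_ge0 // sqr_ge0.
- by apply: emeasurable_funM => //; exact: measurable_sqr_cmod.
Qed.

Lemma energyN u : energy (fun y => - u y) = energy u.
Proof. by apply: eq_integral => y _; rewrite cmodN. Qed.

Lemma energyB u v : cmeas u -> cmeas v ->
  (energy (fun y => (u y - v y)%R) <= 2%:E * energy u + 2%:E * energy v)%E.
Proof. by move=> hu hv; rewrite -(energyN v); exact: energyD hu (cmeasN hv). Qed.

Lemma energyB_fin u v (a b : R) : cmeas u -> cmeas v -> (energy u <= a%:E)%E ->
  (energy v <= b%:E)%E -> (energy (fun y => (u y - v y)%R) <= (2 * a + 2 * b)%:E)%E.
Proof.
move=> hu hv ha hb; apply: le_trans (energyB hu hv) _.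
by rewrite (EFinD (2 * a)) (EFinM _ a) (EFinM _ b); apply: leeD; apply: lee_wpmul2l.
Qed.

Lemma energyB_triangle u v w (a b : R) : cmeas u -> cmeas v -> cmeas w ->
  (energy (fun y => (u y - w y)%R) <= a%:E)%E ->
  (energy (fun y => (v y - w y)%R) <= b%:E)%E ->
  (energy (fun y => (u y - v y)%R) <= (2 * a + 2 * b)%:E)%E.
Proof.
move=> hu hv hw ha hb; rewrite (eq_energy (v := fun y => (u y - w y) - (v y - w y))).
  by apply: energyB_fin => //; exact: cmeasB.
by move=> y; rewrite opprB addrA subrK.
Qed.

Lemma energyC u v : energy (fun y => u y - v y) = energy (fun y => v y - u y).
Proof. by rewrite -energyN; apply: eq_energy => y; rewrite opprB. Qed.

(* Young's inequality [|u||v| <= (t |u|^2 + |v|^2 / t) / 2] replaces Cauchy-Schwarz. *)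
Lemma ip_young u v (a b t : R) : cmeas u -> cmeas v -> 0 < t ->
  (energy u <= a%:E)%E -> (energy v <= b%:E)%E ->
  cintegrable mu (fun y => u y * conjc (v y)) /\ cmod (ip u v) <= t * a + t^-1 * b.
Proof.
move=> hu hv t0 ha hb.
have mp : cmeas (fun y => u y * conjc (v y)) by apply: cmeasM => //; exact: cmeasJ.
suff H : (\int[mu]_y (cmod (u y * conjc (v y)))%:E <= ((t * a + t^-1 * b) / 2)%:E)%E.
  have ig : cintegrable mu (fun y => u y * conjc (v y)).
    by split => //; apply: le_lt_trans H _; rewrite ltry.
  split => //; have := cmod_cint_le ig H.
  by rewrite (mulrC 2) divfK // pnatr_eq0.
apply: (@le_trans _ _ (\int[mu]_y ((t / 2)%:E * (cmod (u y) ^+ 2)%:E + (t^-1 / 2)%:E * (cmod (v y) ^+ 2)%:E))%E).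
  apply: le_cintegral => //.
    by apply: emeasurable_funD; apply: emeasurable_funM => //; exact: measurable_sqr_cmod.
  move=> y; rewrite cmodM cmodJ -!EFinM -EFinD lee_fin.
  have : 0 <= t * cmod (u y) ^+ 2 - 2 * (cmod (u y) * cmod (v y)) + t^-1 * cmod (v y) ^+ 2.
    rewrite (_ : _ + _ = t^-1 * (t * cmod (u y) - cmod (v y)) ^+ 2).
      by rewrite mulr_ge0 ?sqr_ge0 // invr_ge0 ltW.
    by field; rewrite gt_eqF.
  lra.
have P w : forall x : vec, setT x -> (0 <= (cmod (w x) ^+ 2)%:E)%E by move=> x _; rewrite lee_fin sqr_ge0.
rewrite ge0_integralD //.
- rewrite !ge0_integralZl_EFin //; try exact: measurable_sqr_cmod; try exact: P.
  + rewrite (_ : ((t * a + t^-1 * b) / 2)%:E = (t / 2)%:E * a%:E + (t^-1 / 2)%:E * b%:E)%E; last first.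
      by rewrite -!EFinM -EFinD; congr EFin; field; rewrite gt_eqF.
    apply: leeD.
      by apply: lee_wpmul2l => //; rewrite lee_fin divr_ge0 // ltW.
    by apply: lee_wpmul2l => //; rewrite lee_fin divr_ge0 // invr_ge0 ltW.
  + by rewrite divr_ge0 // invr_ge0 ltW.
  + by rewrite divr_ge0 // ltW.
- by move=> x _; rewrite -EFinM lee_fin mulr_ge0 ?sqr_ge0 // divr_ge0 // ltW.
- by apply: emeasurable_funM => //; exact: measurable_sqr_cmod.
- by move=> x _; rewrite -EFinM lee_fin mulr_ge0 ?sqr_ge0 // divr_ge0 // invr_ge0 ltW.
- by apply: emeasurable_funM => //; exact: measurable_sqr_cmod.
Qed.

Lemma energy_le_ip u : square_integrable u -> (energy u <= (cmod (ip u u))%:E)%E.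
Proof.
move=> [hu fu]; have [a Ha] : exists a, energy u = a%:E.
  by move: fu (energy_ge0 u); case: (energy u) => // a; exists a.
apply: (@le_trans _ _ (Re (ip u u))%:E); last first.
  by rewrite lee_fin (le_trans (ler_norm _)) // Re_le_cmod.
rewrite /ip /= /Rintegral.
have -> : (\int[mu]_y (Re (u y * conjc (u y)))%:E = energy u)%E.
  apply: eq_integral => y _; rewrite ReM ReJ ImJ mulrN opprK sqr_cmod.
  by rewrite -!expr2.
by rewrite Ha.
Qed.

Lemma energy_eq0 u : cmeas u -> energy u = 0%E -> {ae mu, forall y, u y = 0}.
Proof.
move=> hu H.
have := (ae_eq_integral_abs mu measurableT (measurable_sqr_cmod hu)).1.
have -> : (\int[mu]_x `|(cmod (u x) ^+ 2)%:E| = energy u)%E.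
  by apply: eq_integral => y _; rewrite gee0_abs // lee_fin sqr_ge0.
move=> /(_ H); apply: filterS => y /(_ I) /= [] /eqP.
by rewrite sqrf_eq0 => /eqP /cmod_eq0.
Qed.

End energy.

Section finite_combinations.
Context (R : realType) (n N : nat).
Hypothesis n_gt0 : (0 < n)%N.
Local Notation lattice := 'rV[int]_n.
Local Notation vec := 'rV[R]_n.
Local Notation mu := (lebesgue_rV R n).
Local Notation index := ('I_N * lattice)%type.
Variable phi : 'I_N -> vec -> complex R.
Hypothesis mphi : forall j, cmeas (phi j).
Hypothesis rphi : forall j, rapid (phi j).
Implicit Types (S : seq lattice) (c : index -> complex R).

Lemma rapid_family K : exists2 C : R, 0 <= C &
  forall j y, cmod (phi j y) <= C * (wt y)^-1 ^+ K.
Proof.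
have /choice[C HC] : forall j, exists C : R, 0 <= C /\ forall y, cmod (phi j y) <= C * (wt y)^-1 ^+ K.
  by move=> j; have [C C0 H] := rphi j K; exists C.
exists (\sum_j C j) => [|j y]; first by apply: sumr_ge0 => j _; case: (HC j).
apply: le_trans ((HC j).2 y) _; rewrite ler_wpM2r ?wtVX_ge0 //.
by rewrite (bigD1 j) //= lerDl sumr_ge0 // => i _; case: (HC i).
Qed.

Definition atom (p : index) (y : vec) : complex R := phi p.1 (y - zvec R p.2).

Lemma cmeas_atom p : cmeas (atom p).
Proof. exact: cmeas_subr. Qed.

Definition pairs S : seq index := [seq (k, nu) | k <- enum 'I_N, nu <- S].

Lemma big_pairs (T : Type) (idx : T) (op : Monoid.com_law idx) S (F : index -> T) :
  \big[op/idx]_(p <- pairs S) F p = \big[op/idx]_(k < N) \big[op/idx]_(nu <- S) F (k, nu).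
Proof. by rewrite big_allpairs big_enum. Qed.

Definition fcomb S c (y : vec) : complex R := \sum_(p <- pairs S) c p * atom p y.

Definition nrm2 S c : R := \sum_(p <- pairs S) cmod (c p) ^+ 2.

Lemma nrm2_ge0 S c : 0 <= nrm2 S c.
Proof. by apply: sumr_ge0 => p _; rewrite sqr_ge0. Qed.

(** One atom is given [2 * n] extra orders of decay, which pay for the integral; the remaining [K]
    orders of both atoms combine by the triangle inequality into decay in the distance of the two
    shifts. *)
Lemma gram_decay K : exists2 D : R, 0 <= D & forall p q,
  cintegrable mu (fun y => atom p y * conjc (atom q y)) /\
  cmod (ip (atom p) (atom q)) <= D * (wt (zvec R p.2 - zvec R q.2))^-1 ^+ K.
Proof.
have [C C0 HC] := rapid_family (K + 2 * n)%N.
have [C' C'0 HC'] := rapid_family K.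
exists (2 * C * C' * pi ^+ n) => [|p q]; first by rewrite !mulr_ge0 // exprn_ge0 // pi_ge0.
have := @cintegrable_wt R n (fun y => atom p y * conjc (atom q y)) (zvec R p.2)
  (C * C' * (wt (zvec R p.2 - zvec R q.2))^-1 ^+ K).
rewrite (_ : 2 * (_ * pi ^+ n) = 2 * C * C' * pi ^+ n * (wt (zvec R p.2 - zvec R q.2))^-1 ^+ K); last by ring.
apply.
- by rewrite !mulr_ge0 // wtVX_ge0.
- by apply: cmeasM; [exact: cmeas_atom|apply: cmeasJ; exact: cmeas_atom].
apply/nearW => y; rewrite cmodM cmodJ.
apply: le_trans (ler_pM _ _ (HC _ _) (HC' _ _)) _; rewrite ?cmod_ge0 //.
rewrite exprD mulrACA -!mulrA ler_wpM2l // ler_wpM2l // mulrCA mulrC.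
rewrite ler_wpM2r ?wtVX_ge0 //; rewrite [in leLHS]wtBC.
exact: wtVX_triangle.
Qed.

Lemma cintegrable_atoms p q : cintegrable mu (fun y => atom p y * conjc (atom q y)).
Proof. by have [D _ H] := gram_decay 0; exact: (H p q).1. Qed.

Lemma cmeas_fcomb S c : cmeas (fcomb S c).
Proof.
by apply: cmeas_sum => p _; apply: cmeasM; [exact: cmeas_cst|exact: cmeas_atom].
Qed.

Lemma energy_atom p : (energy (atom p) < +oo)%E.
Proof.
have [_ H] := cintegrable_atoms p p.
rewrite /energy; under eq_integral do rewrite expr2 -{2}cmodJ -cmodM.
exact: H.
Qed.

Lemma energy_fcomb S c : (energy (fcomb S c) < +oo)%E.
Proof.
rewrite /fcomb; elim: (pairs S) => [|p s IH].
  under eq_energy do rewrite big_nil.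
  by rewrite /energy; under eq_integral do rewrite cmod0 expr0n /=; rewrite integral0.
under eq_energy do rewrite big_cons.
apply: le_lt_trans (energyD _ _) _.
- by apply: cmeasM; [exact: cmeas_cst|exact: cmeas_atom].
- by apply: cmeas_sum => q _; apply: cmeasM; [exact: cmeas_cst|exact: cmeas_atom].
rewrite lte_add_pinfty //; last by rewrite lte_mul_pinfty.
rewrite lte_mul_pinfty // /energy.
under eq_integral do rewrite cmodM exprMn EFinM.
rewrite ge0_integralZl_EFin ?sqr_ge0 //.
- by rewrite lte_mul_pinfty ?lee_fin ?sqr_ge0 //; exact: energy_atom.
- by move=> y _; rewrite lee_fin sqr_ge0.
- by apply: measurable_sqr_cmod; exact: cmeas_atom.
Qed.

Lemma ip_fcomb S a b :
  ip (fcomb S a) (fcomb S b) =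
  \sum_(q <- pairs S) \sum_(p <- pairs S) a p * conjc (b q) * ip (atom p) (atom q).
Proof.
rewrite /ip (@eq_cint _ _ _ mu _ (fun y => \sum_(q <- pairs S) \sum_(p <- pairs S)
   a p * conjc (b q) * (atom p y * conjc (atom q y)))).
  rewrite cint_sum; last first.
    by move=> q _; apply: cintegrable_sum => p _; apply: cintegrableZ; exact: cintegrable_atoms.
  apply: eq_bigr => q _; rewrite cint_sum; last first.
    by move=> p _; apply: cintegrableZ; exact: cintegrable_atoms.
  by apply: eq_bigr => p _; rewrite cintZ //; exact: cintegrable_atoms.
move=> y; rewrite /fcomb rmorph_sum /= mulr_sumr; apply: eq_bigr => q _.
rewrite mulr_suml; apply: eq_bigr => p _; rewrite rmorphM /=; ring.
Qed.

(** Schur's test: each product is split by Young's inequality with parameter [t], and row and column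
    sums of the kernel are bounded by [N] times [wt_sum]. A small [t] makes the part in [al]
    absorbable, at the expense of the part in [be]. *)
Lemma schur_bound : exists2 W : R, 0 <= W & forall S (h : vec -> R) (al be : index -> R) (t D : R),
  uniq S -> 0 < t -> 0 <= D ->
  (forall p, 0 <= al p) -> (forall p, 0 <= be p) ->
  \sum_(q <- pairs S) \sum_(p <- pairs S)
     D * (wt (zvec R p.2 - zvec R q.2))^-1 ^+ (2 * n) * (al q * be p) <=
  D * W * (t * \sum_(q <- pairs S) al q ^+ 2 + t^-1 * \sum_(p <- pairs S) be p ^+ 2).
Proof.
exists (N%:R * wt_sum R n) => [|S h al be t D uS t0 D0 al0 be0].
  by rewrite mulr_ge0 // wt_sum_ge0.
pose H (p q : index) := (wt (zvec R p.2 - zvec R q.2))^-1 ^+ (2 * n).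
have HC p q : H p q = H q p by rewrite /H wtBC.
have H0 p q : 0 <= H p q by rewrite /H wtVX_ge0.
have rowsum q : \sum_(p <- pairs S) H p q <= N%:R * wt_sum R n.
  rewrite big_pairs /=.
  apply: le_trans (_ : \sum_(k < N) wt_sum R n <= _); last first.
    by rewrite sumr_const card_ord mulr_natl.
  apply: ler_sum => k _; rewrite -lee_fin; apply: le_trans (lattice_wt (zvec R q.2)).
  rewrite -sumEFin fsbig_seq //; apply: ereal_sup_ubound.
  exists [set` S]; first by split => //; exact: finite_seq.
  apply: eq_fsbigr => nu _.
  by rewrite /H /= wtBC.
have ti0 : 0 < t^-1 by rewrite invr_gt0.
apply: (@le_trans _ _ (\sum_(q <- pairs S) \sum_(p <- pairs S)
   (D * t * (al q ^+ 2 * H p q) + D * t^-1 * (be p ^+ 2 * H p q)))).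
  apply: ler_sum => q _; apply: ler_sum => p _; rewrite -/(H p q).
  have : 0 <= t * al q ^+ 2 - al q * be p + t^-1 * be p ^+ 2.
    have : 0 <= t * al q ^+ 2 - 2 * (al q * be p) + t^-1 * be p ^+ 2.
      rewrite (_ : _ + _ = t^-1 * (t * al q - be p) ^+ 2).
        by rewrite mulr_ge0 ?sqr_ge0 // ltW.
      by field; rewrite gt_eqF.
    by have := mulr_ge0 (al0 q) (be0 p); lra.
  move=> K; have := mulr_ge0 (mulr_ge0 D0 (H0 p q)) K.
  rewrite -subr_ge0 => L; apply: le_trans L _; rewrite le_eqVlt; apply/orP; left; apply/eqP; ring.
under eq_bigr do rewrite big_split /=.
rewrite big_split /= mulrDr; apply: lerD.
  under eq_bigr do rewrite -mulr_sumr -mulr_sumr.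
  rewrite -mulr_sumr [leRHS](_ : _ = D * t * (N%:R * wt_sum R n * \sum_(q <- pairs S) al q ^+ 2)); last by ring.
  apply: ler_wpM2l; first by rewrite mulr_ge0 // ltW.
  rewrite mulr_sumr; apply: ler_sum => q _.
  by rewrite mulrC ler_wpM2r ?sqr_ge0.
rewrite exchange_big /=.
under eq_bigr do rewrite -mulr_sumr -mulr_sumr.
rewrite -mulr_sumr [leRHS](_ : _ = D * t^-1 * (N%:R * wt_sum R n * \sum_(q <- pairs S) be q ^+ 2)); last by ring.
apply: ler_wpM2l; first by rewrite mulr_ge0 // ltW.
rewrite mulr_sumr; apply: ler_sum => q _.
rewrite mulrC ler_wpM2r ?sqr_ge0 //.
by apply: le_trans (rowsum q); apply: ler_sum => p _; rewrite HC.
Qed.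

Lemma esum_supp S (a : lattice -> \bar R) : uniq S -> (forall nu, 0 <= a nu)%E ->
  (forall nu, nu \notin S -> a nu = 0%E) ->
  (\esum_(nu in setT) a nu = \sum_(nu <- S) a nu)%E.
Proof.
move=> uS a0 Sa; rewrite (esumID [set` S]); last by move=> nu _; exact: a0.
rewrite setTI esum_fset; [|exact: finite_seq|by move=> nu _; exact: a0].
rewrite esum1 ?adde0; last by move=> nu [_ /= /negP H]; exact: Sa.
by rewrite -fsbig_seq.
Qed.

Lemma csum_supp S (a : lattice -> complex R) : uniq S ->
  (forall nu, nu \notin S -> a nu = 0) -> csum a = \sum_(nu <- S) a nu.
Proof.
move=> uS Sa.
rewrite (@eq_csum _ _ _ (fun nu => \sum_(nu' <- S) (nu == nu')%:R * a nu')).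
  rewrite csum_sum //.
    by apply: eq_bigr => nu _; rewrite csum_delta.
  move=> nu' _; apply: (@csummable_le _ _ _ (cmod (a nu'))).
  rewrite (@esum_supp [:: nu']) //.
  - by rewrite big_seq1 eqxx mul1r.
  - by move=> nu; rewrite lee_fin cmod_ge0.
  - by move=> nu; rewrite inE => /negPf ->; rewrite mul0r cmod0.
move=> nu; have [nS|nS] := boolP (nu \in S).
  rewrite (bigD1_seq nu) //= eqxx mul1r big1 ?addr0 // => nu' /negPf.
  by rewrite eq_sym => ->; rewrite mul0r.
rewrite Sa // big_seq big1 // => nu' S'; case: eqP => [E|_]; last by rewrite mul0r.
by rewrite E S' in nS.
Qed.

(** Stability is stated with the sum over [j] of the l^2 norms; its square is compared with the sum
    of squares, whence [A ^+ 2] below and a factor for the number of generators above. [N%:R + 1]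
    keeps that factor positive even for [N = 0]. *)
Lemma stable_energy : L2_stable_shifts phi -> exists A B : R, [/\ 0 < A, 0 < B,
  forall S c, uniq S -> ((A * nrm2 S c)%:E <= energy (fcomb S c))%E,
  forall S c, uniq S -> (energy (fcomb S c) <= (B * nrm2 S c)%:E)%E &
  forall (c : 'I_N -> lattice -> complex R) (b : R), 0 <= b ->
    (forall j, \esum_(nu in setT) (cmod (c j nu) ^+ 2)%:E <= b%:E)%E ->
    (energy (fun x => (\sum_(j < N) csum (fun nu => c j nu * phi j (x - zvec R nu)))%R) <= (B * b)%:E)%E].
Proof.
move=> [A [B [A0 B0 H]]].
have N1 : (0 : R) < N%:R + 1 by rewrite ltr_wpDl.
have l2b (c : 'I_N -> lattice -> complex R) (b : R) j : 0 <= b ->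
    (\esum_(nu in setT) (cmod (c j nu) ^+ 2)%:E <= b%:E)%E ->
    in_l2 (c j) /\ l2norm (c j) <= Num.sqrt b.
  move=> b0 Hb; split; first by apply: le_lt_trans Hb _; rewrite ltry.
  have : (0 <= \esum_(nu in setT) (cmod (c j nu) ^+ 2)%:E)%E.
    by apply: esum_ge0 => nu _; rewrite lee_fin sqr_ge0.
  rewrite /l2norm; case: (\esum_(nu in setT) _)%E Hb => //= r; rewrite !lee_fin => rb r0.
  by rewrite ler_wsqrtr.
have up (c : 'I_N -> lattice -> complex R) (b : R) : 0 <= b ->
    (forall j, \esum_(nu in setT) (cmod (c j nu) ^+ 2)%:E <= b%:E)%E ->
    (energy (fun x => (\sum_(j < N) csum (fun nu => c j nu * phi j (x - zvec R nu)))%R) <=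
      (B ^+ 2 * (N%:R + 1) ^+ 2 * b)%:E)%E.
  move=> b0 Hb; have [_] := H c (fun j => (l2b c b j b0 (Hb j)).1).
  rewrite L2norm_leE; last first.
    by rewrite mulr_ge0 ?sumr_ge0 // ?ltW // => j _; rewrite sqrtr_ge0.
  move=> /le_trans; apply; rewrite lee_fin exprMn -mulrA.
  rewrite ler_wpM2l ?sqr_ge0 // -[X in _ <= _ * X](sqr_sqrtr b0) -exprMn.
  apply: lerX_ge0; first by rewrite sumr_ge0 // => j _; rewrite sqrtr_ge0.
  apply: (@le_trans _ _ (\sum_(j < N) Num.sqrt b)).
    by apply: ler_sum => j _; exact: (l2b c b j b0 (Hb j)).2.
  by rewrite sumr_const card_ord -[leLHS]mulr_natl ler_wpM2r ?sqrtr_ge0 // lerDl.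
(* Extension by zero makes a finite combination a lattice sum, to which stability applies. *)
pose ext S c (j : 'I_N) (nu : lattice) := if nu \in S then c (j, nu) else 0 : complex R.
have extE S c x : uniq S -> \sum_(j < N) csum (fun nu => ext S c j nu * phi j (x - zvec R nu)) = fcomb S c x.
  move=> uS; rewrite /fcomb big_pairs; apply: eq_bigr => j _.
  rewrite (csum_supp (S := S)) //; last by move=> nu /negPf Sn; rewrite /ext Sn mul0r.
  rewrite big_seq [RHS]big_seq; apply: eq_bigr => nu Sn.
  by rewrite /ext Sn.
have ext2 S c j : uniq S ->
    (\esum_(nu in setT) (cmod (ext S c j nu) ^+ 2)%:E = (\sum_(nu <- S) cmod (c (j, nu)) ^+ 2)%:E)%E.
  move=> uS; rewrite (esum_supp (S := S)) //.
  - rewrite sumEFin; congr EFin; rewrite big_seq [RHS]big_seq; apply: eq_bigr => nu Sn.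
    by rewrite /ext Sn.
  - by move=> nu; rewrite lee_fin sqr_ge0.
  - by move=> nu /negPf Sn; rewrite /ext Sn cmod0 expr0n.
have nrm2E S c : nrm2 S c = \sum_(j < N) \sum_(nu <- S) cmod (c (j, nu)) ^+ 2.
  by rewrite /nrm2 big_pairs.
exists (A ^+ 2), (B ^+ 2 * (N%:R + 1) ^+ 2); split => //.
- by rewrite exprn_gt0.
- by rewrite mulr_gt0 // exprn_gt0.
- move=> S c uS.
  have [|L _] := H (ext S c).
    by move=> j; rewrite /in_l2 ext2 // ltry.
  move: L; rewrite (_ : (fun x => _) = fcomb S c); last by apply/funext => x; exact: extE.
  rewrite L2norm_geE; last first.
    by rewrite mulr_ge0 ?sumr_ge0 // ?ltW // => j _; rewrite sqrtr_ge0.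
  apply: le_trans; rewrite lee_fin exprMn ler_wpM2l ?sqr_ge0 //.
  have q0 (j : 'I_N) : 0 <= \sum_(nu <- S) cmod (c (j, nu)) ^+ 2.
    by apply: sumr_ge0 => nu _; rewrite sqr_ge0.
  rewrite nrm2E expr2 mulr_suml; apply: ler_sum => j _.
  rewrite /l2norm ext2 //= -{1}(sqr_sqrtr (q0 j)) expr2 ler_wpM2l ?sqrtr_ge0 //.
  by rewrite (bigD1 j) //= ext2 //= lerDl sumr_ge0 // => i _; rewrite sqrtr_ge0.
- move=> S c uS; rewrite -(eq_energy (fun x => extE S c x uS)).
  apply: up; first exact: nrm2_ge0.
  move=> j; rewrite ext2 // lee_fin nrm2E (bigD1 j) //= lerDl.
  by apply: sumr_ge0 => i _; apply: sumr_ge0 => nu _; rewrite sqr_ge0.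
Qed.

End finite_combinations.

Lemma conjcM (R : realType) (z w : complex R) : conjc (z * w) = conjc z * conjc w.
Proof. exact: rmorphM. Qed.

(** * Weighted estimate of the coefficients *)

Section weighted_estimate.
Context (R : realType) (n N : nat).
Hypothesis n_gt0 : (0 < n)%N.
Local Notation lattice := 'rV[int]_n.
Local Notation vec := 'rV[R]_n.
Local Notation mu := (lebesgue_rV R n).
Local Notation index := ('I_N * lattice)%type.
Implicit Types (nu eta : lattice).

(** Bounded by [M], yet varying as slowly as [wt], uniformly in [M]; this is the content of
    [trunc_wt_mul] and [trunc_wt_lip]. *)
Definition trunc_wt (M : R) nu : R := Num.min (wt (zvec R nu)) M.

Lemma trunc_wt_ge1 M nu : 1 <= M -> 1 <= trunc_wt M nu.
Proof. by move=> M1; rewrite le_min wt_ge1. Qed.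

Lemma trunc_wt_ge0 M nu : 1 <= M -> 0 <= trunc_wt M nu.
Proof. by move=> M1; apply: le_trans ler01 (trunc_wt_ge1 _ M1). Qed.

Lemma trunc_wt_le M nu : trunc_wt M nu <= M.
Proof. by rewrite ge_min lexx orbT. Qed.

Lemma trunc_wt0 M : 1 <= M -> trunc_wt M 0 = 1.
Proof. by move=> M1; rewrite /trunc_wt zvec0 /wt normr0 addr0 min_l. Qed.

Lemma trunc_wt_mul M nu eta : 1 <= M ->
  trunc_wt M eta <= trunc_wt M nu * wt (zvec R nu - zvec R eta).
Proof.
move=> M1; set d := wt _; have d1 : 1 <= d := wt_ge1 _.
have H : wt (zvec R eta) <= wt (zvec R nu) * d.
  have := wt_triangle (zvec R eta) (zvec R nu) 0.
  by rewrite !subr0 mulrC (wtBC (zvec R eta)).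
rewrite /trunc_wt minr_pMl ?(le_trans ler01) // le_min !ge_min H /=.
by apply/orP; right; rewrite -[leLHS]mulr1 ler_wpM2l // (le_trans ler01).
Qed.

Lemma trunc_wt_lip M nu eta :
  `|trunc_wt M nu - trunc_wt M eta| <= wt (zvec R nu - zvec R eta).
Proof.
have H (a b : lattice) : wt (zvec R a) <= wt (zvec R b) + `|zvec R a - zvec R b|.
  rewrite /wt -addrA lerD2l -{1}(subrK (zvec R b) (zvec R a)) addrC.
  exact: ler_normD.
apply: le_trans (_ : `|zvec R nu - zvec R eta| <= _); last by rewrite /wt lerDr.
have := H nu eta; have := H eta nu; rewrite (distrC (zvec R eta)).
rewrite /trunc_wt; have := normr_ge0 (zvec R nu - zvec R eta).
move: `|zvec R nu - zvec R eta| (wt (zvec R nu)) (wt (zvec R eta)) => d a b d0 h1 h2.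
rewrite ler_norml; apply/andP.
by split; rewrite /Num.min; case: ltP => ?; case: ltP => ?; lra.
Qed.

(** A difference of powers of order [K.+1] costs only a power of order [K] of the weight, besides
    powers of the distance that the Gram matrix absorbs. This gain of one order drives the induction
    on [K]. *)
Lemma trunc_wtX_lip M K nu eta : 1 <= M ->
  `|trunc_wt M nu ^+ K.+1 - trunc_wt M eta ^+ K.+1| <=
  K.+1%:R * wt (zvec R nu - zvec R eta) ^+ K.+1 * trunc_wt M nu ^+ K.
Proof.
move=> M1; have L := trunc_wt_lip M nu eta; have P := trunc_wt_mul nu eta M1.
have a1 := trunc_wt_ge1 nu M1; have b1 := trunc_wt_ge1 eta M1.
move: (trunc_wt M nu) (trunc_wt M eta) (wt_ge1 (zvec R nu - zvec R eta)) L P a1 b1.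
move: (wt _) => d a b d1 L P a1 b1.
have a0 : 0 <= a by lra.
have b0 : 0 <= b by lra.
have d0 : 0 <= d by lra.
elim: K => [|K IH]; first by rewrite !expr1 expr0 mul1r mulr1.
rewrite (_ : _ - _ = a * (a ^+ K.+1 - b ^+ K.+1) + (a - b) * b ^+ K.+1); last by rewrite !exprS; ring.
apply: le_trans (ler_normD _ _) _; rewrite !normrM (ger0_norm a0) (ger0_norm (exprn_ge0 _ b0)).
rewrite -[in leRHS]natr1 !mulrDl mul1r; apply: lerD.
  apply: le_trans (ler_wpM2l a0 IH) _.
  rewrite [leLHS](_ : _ = K.+1%:R * d ^+ K.+1 * a ^+ K.+1); last by rewrite [a ^+ K.+1]exprS; ring.
  rewrite ler_wpM2r ?exprn_ge0 // ler_wpM2l //.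
  by rewrite [leRHS]exprS; apply: ler_peMl => //; exact: exprn_ge0.
rewrite [d ^+ _]exprS -mulrA; apply: ler_pM; [by []|exact: exprn_ge0|exact: L|].
by rewrite -exprMn mulrC; apply: lerX_ge0.
Qed.

Section dual.
Variable phi : 'I_N -> vec -> complex R.
Hypothesis mphi : forall j, cmeas (phi j).
Hypothesis rphi : forall j, rapid (phi j).
Hypothesis sphi : L2_stable_shifts phi.
Variables (tphi : vec -> complex R) (j0 : 'I_N).
Hypothesis mtphi : cmeas tphi.
Hypothesis etphi : (energy tphi < +oo)%E.
Hypothesis dphi : forall (k : 'I_N) (eta : lattice),
  ip (atom phi (k, eta)) tphi = ((eta == 0) && (k == j0))%:R.

Let tphi_energy : exists2 e0 : R, 0 <= e0 & energy tphi = e0%:E.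
Proof.
by move: etphi (energy_ge0 tphi); case: (energy tphi) => // r _; rewrite lee_fin => ?; exists r.
Qed.

Let ip_tphi_atom p : cintegrable mu (fun y => tphi y * conjc (atom phi p y)) /\
  ip tphi (atom phi p) = (p == (j0, 0))%:R.
Proof.
have [e0 e00 He0] := tphi_energy.
have := energy_atom mphi rphi p; have := energy_ge0 (atom phi p).
case Ea : (energy (atom phi p)) => [r| |] // _ _.
have K1 : (energy tphi <= e0%:E)%E by rewrite He0.
have K2 : (energy (atom phi p) <= r%:E)%E by rewrite Ea.
have [i1 _] := ip_young mtphi (cmeas_atom mphi p) ltr01 K1 K2.
have [i2 _] := ip_young (cmeas_atom mphi p) mtphi ltr01 K2 K1.
split => //; transitivity (conjc (ip (atom phi p) tphi)).
  rewrite /ip -cint_conj //; apply: eq_cint => y.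
  by rewrite conjcM conjcK mulrC.
case: p {Ea K2 i1 i2} => k eta; rewrite dphi conjc_nat.
by rewrite xpair_eqE andbC.
Qed.

Let wmul (w : lattice -> R) (c : index -> complex R) (p : index) : complex R :=
  ((w p.2)%:C)%C * c p.

Lemma uniq_pairs (S : seq lattice) : uniq S -> uniq (pairs N S).
Proof. by move=> uS; rewrite allpairs_uniq ?enum_uniq // => -[? ?] [? ?]. Qed.

(* By decay of the Gram matrix, its commutator with the weight of order K.+1 is controlled by the
   weight of order K; the truncation M keeps the sums finite and does not enter the bound. *)
Lemma weighted_coef_bound K : exists2 C : R, 0 <= C & forall M : R, 1 <= M ->
  exists2 e : R, 0 < e & forall (S : seq lattice) (c : index -> complex R), uniq S ->
    (energy (fun y => (tphi y - fcomb phi S c y)%R) <= e%:E)%E ->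
    nrm2 S (wmul (fun nu => trunc_wt M nu ^+ K) c) <= C.
Proof.
have [A [B [A0 B0 lo up _]]] := stable_energy n_gt0 sphi.
have [e0 e00 He0] := tphi_energy.
(* Order 0: a combination within energy 1 of [tphi] has bounded energy, and the lower stability
   bound passes to its coefficients. *)
have base : exists2 C : R, 0 <= C & forall (S : seq lattice) (c : index -> complex R), uniq S ->
    (energy (fun y => (tphi y - fcomb phi S c y)%R) <= 1%:E)%E -> nrm2 S c <= C.
  exists (A^-1 * (2 * e0 + 2 * 1)) => [|S c uS H].
    by rewrite mulr_ge0 ?invr_ge0 ?(ltW A0) // addr_ge0 // mulr_ge0.
  rewrite ler_pdivlMl // -lee_fin; apply: le_trans (lo S c uS) _.
  rewrite (@eq_energy _ _ _ (fun y => tphi y - (tphi y - fcomb phi S c y))); last first.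
    by move=> y; rewrite opprB addrC subrK.
  apply: energyB_fin => //; last by rewrite He0.
  by apply: cmeasB => //; exact: cmeas_fcomb.
have [C0 C00 HC0] := base.
elim: K => [|K [CK CK0 IH]].
  exists C0 => // M M1; exists 1 => // S c uS H.
  rewrite (_ : nrm2 _ _ = nrm2 S c); first exact: HC0.
  by apply: eq_bigr => p _; rewrite /wmul expr0 mul1r.
have [D0 D00 HD] := gram_decay mphi rphi (K.+1 + 2 * n)%N.
have [W W0 schur] := @schur_bound R n N.
pose D := K.+1%:R * D0; have D_ge0 : 0 <= D by rewrite mulr_ge0.
(* Chosen so that [D * W * t <= A / 2]: the part of the commutator in [X2] is then absorbed on the
   left. *)
pose t := A / (2 * (D * W + 1)).
have DW0 : 0 <= D * W by rewrite mulr_ge0.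
have t0 : 0 < t by rewrite divr_gt0 // mulr_gt0 // ltr_wpDl.
exists (2 / A * (3 + C0 + D * W * t^-1 * CK)).
  by rewrite mulr_ge0 ?divr_ge0 ?(ltW A0) // addr_ge0 ?addr_ge0 // mulr_ge0 // mulr_ge0 // invr_ge0 ltW.
move=> M M1; have [eK eK0 HK] := IH M M1.
(* Parameter of Young's inequality for the residual against [fcomb phi S c2], whose energy may grow
   with [M]. It influences the admissible residual, but not the bound on the coefficients. *)
pose t' := B * (M ^+ (4 * K.+1) * C0) + 1.
have M0 : 0 <= M by lra.
have Bc0 : 0 <= B * (M ^+ (4 * K.+1) * C0).
  by rewrite mulr_ge0 ?(ltW B0) // mulr_ge0 // exprn_ge0.
have t'0 : 0 < t' by rewrite ltr_wpDl.
exists (Num.min (Num.min 1 eK) t'^-1); first by rewrite !lt_min ltr01 eK0 invr_gt0.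
move=> S c uS He.
have He1 : (energy (fun y => (tphi y - fcomb phi S c y)%R) <= 1%:E)%E.
  by apply: le_trans He _; rewrite lee_fin !ge_min lexx.
have HeK : (energy (fun y => (tphi y - fcomb phi S c y)%R) <= eK%:E)%E.
  by apply: le_trans He _; rewrite lee_fin !ge_min lexx orbT.
have Het : (energy (fun y => (tphi y - fcomb phi S c y)%R) <= t'^-1%:E)%E.
  by apply: le_trans He _; rewrite lee_fin !ge_min lexx orbT.
have Y2 := HK S c uS HeK; have Z2 := HC0 S c uS He1.
set w := fun nu => trunc_wt M nu ^+ K.+1.
have w0 nu : 0 <= w nu by rewrite exprn_ge0 // trunc_wt_ge0.
set c1 := wmul w c; set c2 := wmul w c1.
set X2 := nrm2 S c1.
have mf a : cmeas (fcomb phi S a) by exact: cmeas_fcomb.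
(* Both weights are moved to the second factor; what remains is the commutator of the weight with
   the Gram matrix. *)
have id1 : ip (fcomb phi S c1) (fcomb phi S c1) = ip (fcomb phi S c) (fcomb phi S c2) +
    \sum_(q <- pairs N S) \sum_(p <- pairs N S)
      conjc (c1 q) * ((w p.2 - w q.2)%:C)%C * c p * ip (atom phi p) (atom phi q).
  rewrite !ip_fcomb // -big_split; apply: eq_bigr => q _ /=.
  rewrite -big_split; apply: eq_bigr => p _ /=.
  rewrite /c2 /c1 /wmul !conjcM !conjc_real rmorphB /=; ring.
have err : cmod (\sum_(q <- pairs N S) \sum_(p <- pairs N S)
      conjc (c1 q) * ((w p.2 - w q.2)%:C)%C * c p * ip (atom phi p) (atom phi q)) <=
    D * W * (t * X2 + t^-1 * CK).
  apply: (@le_trans _ _ (D * W * (t * X2 + t^-1 * nrm2 S (wmul (fun nu => trunc_wt M nu ^+ K) c)))); last first.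
    by rewrite ler_wpM2l // lerD2l ler_wpM2l // invr_ge0 ltW.
  apply: le_trans (schur S (fun=> 0) _ _ t D uS t0 D_ge0
    (fun p => cmod_ge0 (c1 p)) (fun p => cmod_ge0 (wmul (fun nu => trunc_wt M nu ^+ K) c p))).
  apply: le_trans (cmod_sum _ _ _) _; apply: ler_sum => q _.
  apply: le_trans (cmod_sum _ _ _) _; apply: ler_sum => p _.
  have -> : cmod (wmul (fun nu => trunc_wt M nu ^+ K) c p) = trunc_wt M p.2 ^+ K * cmod (c p).
    by rewrite cmodM cmod_real ger0_norm // exprn_ge0 // trunc_wt_ge0.
  move: (c1 q) => b; rewrite !cmodM cmodJ cmod_real.
  set z := zvec R p.2 - zvec R q.2.
  have h1 : `|w p.2 - w q.2| * cmod (ip (atom phi p) (atom phi q)) <=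
      (K.+1%:R * wt z ^+ K.+1 * trunc_wt M p.2 ^+ K) * (D0 * (wt z)^-1 ^+ (K.+1 + 2 * n)).
    by apply: ler_pM; rewrite ?cmod_ge0 //; [exact: trunc_wtX_lip|exact: (HD p q).2].
  have -> : D * (wt z)^-1 ^+ (2 * n) * (cmod b * (trunc_wt M p.2 ^+ K * cmod (c p))) =
      cmod b * cmod (c p) * ((K.+1%:R * wt z ^+ K.+1 * trunc_wt M p.2 ^+ K) * (D0 * (wt z)^-1 ^+ (K.+1 + 2 * n))).
    rewrite exprD; have := wtVXK z K.+1; rewrite /D.
    move: ((wt z)^-1 ^+ K.+1) (wt z ^+ K.+1) ((wt z)^-1 ^+ (2 * n)) => a a' h aa'.
    transitivity ((a * a') * (K.+1%:R * D0 * h * (cmod b * (trunc_wt M p.2 ^+ K * cmod (c p))))).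
      by rewrite aa' mul1r.
    ring.
  rewrite (_ : _ * _ * _ * _ = cmod b * cmod (c p) * (`|w p.2 - w q.2| * cmod (ip (atom phi p) (atom phi q)))); last by ring.
  by rewrite ler_wpM2l // mulr_ge0 ?cmod_ge0.
have nrm_c2 : nrm2 S c2 <= M ^+ (4 * K.+1) * C0.
  apply: (@le_trans _ _ (M ^+ (4 * K.+1) * nrm2 S c)); last by rewrite ler_wpM2l ?exprn_ge0.
  rewrite mulr_sumr; apply: ler_sum => p _; rewrite /c2 /c1 /wmul !cmodM !cmod_real.
  rewrite ger0_norm // mulrA exprMn ler_wpM2r ?sqr_ge0 //.
  rewrite -expr2 -exprM /w -exprM (_ : (K.+1 * _)%N = (4 * K.+1)%N); last by rewrite mulnC.
  by apply: lerX_ge0; [exact: trunc_wt_ge0|exact: trunc_wt_le].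
(* The combination is [tphi] minus the residual. Of the pairing with [tphi], biorthogonality keeps
   only the coefficient at [(j0, 0)], where the weight is 1, hence at most [1 + C0]; the residual
   contributes at most 2. *)
have main1 : cmod (ip (fcomb phi S c) (fcomb phi S c2)) <= 3 + C0.
  have K2 : (energy (fcomb phi S c2) <= (B * (M ^+ (4 * K.+1) * C0))%:E)%E.
    by apply: le_trans (up S c2 uS) _; rewrite lee_fin ler_wpM2l // ltW.
  have [i1 H1] := ip_young (cmeasB mtphi (mf c)) (mf c2) t'0 Het K2.
  have H2 : cmod (ip (fun y => tphi y - fcomb phi S c y) (fcomb phi S c2)) <= 2.
    apply: le_trans H1 _; rewrite mulfV ?gt_eqF // -[leRHS]/(1 + 1) lerD2l.
    by rewrite mulrC ler_pdivrMr // mul1r /t' lerDl.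
  have E3 : ip tphi (fcomb phi S c2) = \sum_(q <- pairs N S) conjc (c2 q) * (q == (j0, 0))%:R.
    rewrite /ip (@eq_cint _ _ _ mu _ (fun y => \sum_(q <- pairs N S) conjc (c2 q) * (tphi y * conjc (atom phi q y)))).
      rewrite cint_sum; last by move=> q _; apply: cintegrableZ; exact: (ip_tphi_atom q).1.
      apply: eq_bigr => q _; rewrite cintZ; last exact: (ip_tphi_atom q).1.
      by congr (_ * _); exact: (ip_tphi_atom q).2.
    move=> y; rewrite /fcomb rmorph_sum /= mulr_sumr; apply: eq_bigr => q _.
    by rewrite conjcM; ring.
  have i3 : cintegrable mu (fun y => tphi y * conjc (fcomb phi S c2 y)).
    have K1 : (energy tphi <= e0%:E)%E by rewrite He0.
    exact: (ip_young mtphi (mf c2) ltr01 K1 K2).1.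
  have H3 : cmod (ip tphi (fcomb phi S c2)) <= 1 + C0.
    rewrite E3; apply: (@le_trans _ _ (1 + nrm2 S c)); last by rewrite lerD2l.
    apply: le_trans (cmod_sum _ _ _) _.
    have [q0S|q0S] := boolP ((j0, 0) \in pairs N S); last first.
      rewrite big_seq big1 ?addr_ge0 ?nrm2_ge0 // => q qS.
      by case: eqP => [E|_]; [rewrite -E qS in q0S|rewrite mulr0 cmod0].
    rewrite /nrm2 !(bigD1_seq (j0, 0)) ?uniq_pairs //= eqxx mulr1.
    rewrite big1 => [|q /negPf ->]; last by rewrite mulr0 cmod0.
    rewrite addr0 cmodJ /c2 /c1 /wmul /= /w trunc_wt0 // expr1n !mul1r.
    rewrite addrA; apply: ler_wpDr; first by apply: sumr_ge0 => q _; rewrite sqr_ge0.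
    by have := cmod_ge0 (c (j0, 0)); nra.
  have E4 : ip (fcomb phi S c) (fcomb phi S c2) = ip tphi (fcomb phi S c2) -
      ip (fun y => tphi y - fcomb phi S c y) (fcomb phi S c2).
    rewrite /ip -cintB //; apply: eq_cint => y; ring.
  rewrite E4; apply: le_trans (cmodB _ _) _; lra.
have AX : A * X2 <= 3 + C0 + D * W * (t * X2 + t^-1 * CK).
  rewrite -lee_fin; apply: le_trans (lo S c1 uS) _.
  apply: le_trans (energy_le_ip _) _.
    by split; [exact: mf|exact: energy_fcomb].
  rewrite lee_fin id1; apply: le_trans (cmodD _ _) _.
  exact: lerD.
have Dt : D * W * t <= A / 2.
  rewrite /t (_ : _ * _ * _ = (A / 2) * (D * W / (D * W + 1))); last first.
    by field; rewrite gt_eqF // ltr_wpDl.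
  by rewrite ler_piMr ?divr_ge0 ?(ltW A0) // ler_pdivrMr ?ltr_wpDl // mul1r lerDl.
have X20 : 0 <= X2 := nrm2_ge0 _ _.
have : A / 2 * X2 <= 3 + C0 + D * W * t^-1 * CK.
  have := ler_wpM2r X20 Dt; move: AX; rewrite mulrDr !mulrA; lra.
by move=> H; rewrite -ler_pdivrMl ?divr_gt0 // invf_div.
Qed.

End dual.
End weighted_estimate.

Lemma real_cauchy (R : realType) (u : nat -> R) :
  (forall e : R, 0 < e -> exists M : nat, forall m m', (M <= m)%N -> (M <= m')%N -> `|u m - u m'| <= e) ->
  exists l : R, forall e : R, 0 < e -> exists M : nat, forall m, (M <= m)%N -> `|u m - l| <= e.
Proof.
move=> H; have : cvg (u @ \oo).
  apply/cauchy_cvgP/cauchy_exP => e e0.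
  have [M HM] := H (e / 2) (divr_gt0 e0 (ltr0Sn _ 1)).
  exists (u M); exists M => // m /= Mm; rewrite /ball /=.
  by apply: le_lt_trans (HM M m (leqnn _) Mm) _; rewrite ltr_pdivrMr // mulr2n mulrDr mulr1 ltrDr.
move=> /cvgrPdist_le cu; exists (limn u) => e e0.
have [M _ HM] := cu e e0.
by exists M => m Mm; rewrite distrC; exact: HM.
Qed.

Lemma complex_cauchy (R : realType) (u : nat -> complex R) :
  (forall e : R, 0 < e -> exists M : nat, forall m m', (M <= m)%N -> (M <= m')%N -> cmod (u m - u m') <= e) ->
  exists l : complex R, forall e : R, 0 < e -> exists M : nat, forall m, (M <= m)%N -> cmod (u m - l) <= e.
Proof.
move=> H.
have [a Ha] : exists l : R, forall e : R, 0 < e -> exists M : nat, forall m, (M <= m)%N -> `|Re (u m) - l| <= e.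
  apply: real_cauchy => e /H[M HM]; exists M => m m' h h'.
  by apply: le_trans (HM m m' h h'); rewrite -ReN -ReD Re_le_cmod.
have [b Hb] : exists l : R, forall e : R, 0 < e -> exists M : nat, forall m, (M <= m)%N -> `|Im (u m) - l| <= e.
  apply: real_cauchy => e /H[M HM]; exists M => m m' h h'.
  by apply: le_trans (HM m m' h h'); rewrite -ImN -ImD Im_le_cmod.
exists (Complex a b) => e e0; have e20 : 0 < e / 2 by rewrite divr_gt0.
have [M1 H1] := Ha _ e20; have [M2 H2] := Hb _ e20.
exists (maxn M1 M2) => m; rewrite geq_max => /andP[/H1 h1 /H2 h2].
apply: le_trans (cmod_le_ReIm _) _; rewrite ReD ReN ImD ImN /=; lra.
Qed.

Section dual_decay.
Context (R : realType) (n N : nat).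
Hypothesis n_gt0 : (0 < n)%N.
Local Notation lattice := 'rV[int]_n.
Local Notation vec := 'rV[R]_n.
Local Notation mu := (lebesgue_rV R n).
Local Notation index := ('I_N * lattice)%type.
Variable phi : 'I_N -> vec -> complex R.
Hypothesis mphi : forall j, cmeas (phi j).
Hypothesis rphi : forall j, rapid (phi j).
Hypothesis sphi : L2_stable_shifts phi.
Implicit Types (S : seq lattice) (c : index -> complex R).

Lemma fcomb_csum S c x : uniq S -> (forall p, p.2 \notin S -> c p = 0) ->
  fcomb phi S c x = \sum_(k < N) csum (fun nu => c (k, nu) * phi k (x - zvec R nu)).
Proof.
move=> uS cS; rewrite /fcomb big_pairs; apply: eq_bigr => k _.
by rewrite (csum_supp n_gt0 (S := S)) // => nu Sn; rewrite cS // mul0r.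
Qed.

Lemma nrm2_mem S c p : uniq S -> p.2 \in S -> cmod (c p) ^+ 2 <= nrm2 S c.
Proof.
case: p => k nu uS /= Sn; rewrite /nrm2 (bigD1_seq (k, nu)) ?uniq_pairs //=.
  by rewrite lerDl sumr_ge0 // => q _; rewrite sqr_ge0.
by apply/allpairsP; exists (k, nu); rewrite /= mem_enum.
Qed.

(** Several terms of [s] may share an index; [c] adds their coefficients, so that the index set is
    free of duplicates, as the stability estimates require. *)
Lemma fcomb_of_seq (s : seq (complex R * 'I_N * lattice)) :
  exists S c, [/\ uniq S, forall p, p.2 \notin S -> c p = 0 &
    forall x, fcomb phi S c x = \sum_(p <- s) p.1.1 * phi p.1.2 (x - zvec R p.2)].
Proof.
pose S := undup [seq p.2 | p <- s].
pose c (q : index) : complex R := \sum_(p <- s | (p.1.2, p.2) == q) p.1.1.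
have uS : uniq S by exact: undup_uniq.
exists S, c; split => // [[k nu] /= Sn|x].
  rewrite /c big_seq_cond big1 // => p /andP[ps /eqP[_ E]].
  by move: Sn; rewrite mem_undup -E => /negP[]; exact: map_f.
rewrite /fcomb /c; under eq_bigr do rewrite mulr_suml.
rewrite (exchange_big_dep xpredT) //= big_seq [RHS]big_seq; apply: eq_bigr => p ps.
rewrite (eq_bigl (fun q => q == (p.1.2, p.2))) => [|q]; last by rewrite eq_sym.
rewrite -big_filter filter_pred1_uniq ?uniq_pairs ?big_seq1 //.
apply/allpairsP; exists (p.1.2, p.2); rewrite /= mem_enum mem_undup; split => //.
exact: map_f.
Qed.

(** Stability makes the coefficients of the approximating combinations Cauchy. The weighted bounds,
    uniform along the sequence, pass to the limits [d], and [psi] is the series with coefficients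
    [d]. *)
Lemma dual_decay (j0 : 'I_N) (tphi : vec -> complex R) :
  in_closed_span phi tphi ->
  (forall (k : 'I_N) eta, inner (fun x => phi k (x - zvec R eta)) tphi = ((eta == 0) && (k == j0))%:R) ->
  exists psi, [/\ cmeas psi, rapid psi & {ae mu, forall x, tphi x = psi x}].
Proof.
move=> [[[h1 mh1 E1] [h2 mh2 E2]] tL2 approx] dual.
pose t x := Complex (h1 x) (h2 x).
have mt : cmeas t by split.
have tE : {ae mu, forall x, tphi x = t x}.
  move: E1 E2; apply: filterS2 => x e1 e2; exact: complex_ext.
have et : (energy t < +oo)%E.
  rewrite -(ae_eq_energy mt tE); move: tL2; rewrite L2normE.
  by case: (energy tphi) => //= r _; rewrite ltry.
have dt k eta : ip (atom phi (k, eta)) t = ((eta == 0) && (k == j0))%:R.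
  rewrite -dual /inner /ip; apply/esym/ae_eq_cint.
    by apply: cmeasM; [exact: cmeas_subr|exact: cmeasJ].
  by apply: filterS tE => x ->.
have [A [B [A0 B0 lo _ up]]] := stable_energy n_gt0 sphi.
pose e (m : nat) : R := m.+1%:R^-1.
have e0 m : 0 < e m by rewrite invr_gt0.
have e_small (d : R) : 0 < d -> exists M : nat, forall m, (M <= m)%N -> e m <= d.
  move=> d0; exists (Num.truncn d^-1) => m Mm; rewrite /e invf_ple ?posrE //.
  apply: ltW; apply: lt_le_trans (truncnS_gt _) _.
  by rewrite ler_nat ltnS.
have /choice[Sc HSc] : forall m, exists Sc : seq lattice * (index -> complex R),
    [/\ uniq Sc.1, forall p, p.2 \notin Sc.1 -> Sc.2 p = 0 &
      (energy (fun x => (t x - fcomb phi Sc.1 Sc.2 x)%R) <= (e m)%:E)%E].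
  move=> m; have se0 : 0 < Num.sqrt (e m) by rewrite sqrtr_gt0.
  have [s Hs] := approx _ se0; have [S [c [uS cS fS]]] := fcomb_of_seq s.
  exists (S, c); split => //=.
  have mf : cmeas (fun x => t x - fcomb phi S c x).
    by apply: cmeasB => //; exact: cmeas_fcomb.
  move: Hs; rewrite L2norm_ltE // sqr_sqrtr ?(ltW (e0 m)) // => /ltW.
  rewrite (ae_eq_energy mf) //; apply: filterS tE => x ->.
  by rewrite fS.
pose S m := (Sc m).1; pose c m := (Sc m).2.
have uS m : uniq (S m) by have [] := HSc m.
have cS m p : p.2 \notin S m -> c m p = 0 by have [_ H _] := HSc m; exact: H.
have eS m : (energy (fun x => (t x - fcomb phi (S m) (c m) x)%R) <= (e m)%:E)%E by have [] := HSc m.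
have mf m : cmeas (fcomb phi (S m) (c m)) by exact: cmeas_fcomb.
have csm m k x : csummable (fun nu => c m (k, nu) * phi k (x - zvec R nu)).
  apply: (@csummable_le _ _ _ (\sum_(nu <- S m) cmod (c m (k, nu) * phi k (x - zvec R nu)))).
  rewrite (esum_supp (S := S m)) //.
  - by rewrite sumEFin.
  - by move=> nu; rewrite lee_fin cmod_ge0.
  - by move=> nu Sn; rewrite cS // mul0r cmod0.
(* Stability is applied on a set [V] that contains both supports; restricting to [U] only drops
   nonnegative terms. *)
have diff m m' U : uniq U -> nrm2 U (fun p => c m p - c m' p) <= A^-1 * (2 * e m + 2 * e m').
  move=> uU; pose V := undup (U ++ S m ++ S m').
  have uV : uniq V by exact: undup_uniq.
  have cV p : p.2 \notin V -> c m p - c m' p = 0.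
    rewrite mem_undup !mem_cat !negb_or => /and3P[_ a b].
    by rewrite !cS // subrr.
  apply: (@le_trans _ _ (nrm2 V (fun p => c m p - c m' p))).
    rewrite /nrm2 !big_pairs; apply: ler_sum => k _.
    rewrite [leRHS](bigID (fun nu => nu \in U)) /= ler_wpDr //.
      by apply: sumr_ge0 => nu _; rewrite sqr_ge0.
    rewrite -[leRHS]big_filter le_eqVlt; apply/orP; left; apply/eqP; apply: perm_big.
    apply: uniq_perm => // [|nu]; first exact: filter_uniq.
    by rewrite mem_filter mem_undup !mem_cat; case: (nu \in U).
  rewrite ler_pdivlMl // -lee_fin; apply: le_trans (lo V _ uV) _.
  rewrite (@eq_energy _ _ _ (fun x => fcomb phi (S m) (c m) x - fcomb phi (S m') (c m') x)); last first.
    move=> x; rewrite !fcomb_csum // -?sumrB; [|exact: cS..].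
    by apply: eq_bigr => k _; rewrite -csumB //; apply: eq_csum => nu; rewrite mulrBl.
  apply: (energyB_triangle (w := t)) => //.
    by rewrite energyC.
  by rewrite energyC.
have /choice[d Hd] : forall p : index, exists l : complex R, forall eps : R, 0 < eps ->
    exists M : nat, forall m, (M <= m)%N -> cmod (c m p - l) <= eps.
  move=> p; apply: (@complex_cauchy R (fun m => c m p)) => eps eps0.
  have [|M HM] := e_small (A * eps ^+ 2 / 4).
    by rewrite divr_gt0 // mulr_gt0 // exprn_gt0.
  exists M => m m' Mm Mm'; rewrite -(@ler_pXn2r _ 2) ?nnegrE ?cmod_ge0 ?(ltW eps0) //.
  apply: le_trans (@nrm2_mem [:: p.2] (fun p => c m p - c m' p) p _ _) _; rewrite ?inE //.
  apply: le_trans (diff m m' [:: p.2] _) _ => //.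
  rewrite ler_pdivrMl //; have := HM m Mm; have := HM m' Mm'; lra.
have d_decay K : exists2 C : R, 0 <= C & forall p, cmod (d p) <= C * (wt (zvec R p.2))^-1 ^+ K.
  have [C C0 HC] := weighted_coef_bound n_gt0 mphi rphi sphi mt et dt K.
  exists (Num.sqrt C) => [|p]; first exact: sqrtr_ge0.
  (* Truncation at the weight of [p] itself leaves the weight at [p] intact. The required residual
     depends on [p], but [m] may be taken as large as needed before passing to the limit. *)
  have [ep ep0 Hp] := HC (wt (zvec R p.2)) (wt_ge1 _).
  have [M1 HM1] := e_small ep ep0.
  apply/ler_addgt0Pr => eps eps0.
  have [M2 HM2] := Hd p eps eps0; pose m := maxn M1 M2.
  have b : cmod (c m p) <= Num.sqrt C * (wt (zvec R p.2))^-1 ^+ K.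
    have [Sp|Sp] := boolP (p.2 \in S m); last first.
      by rewrite cS // cmod0 mulr_ge0 ?sqrtr_ge0 ?wtVX_ge0.
    have := Hp (S m) (c m) (uS m) (le_trans (eS m) (_ : (_ <= _)%E)).
    rewrite lee_fin => /(_ (HM1 _ (leq_maxl _ _))) H.
    have := le_trans (nrm2_mem _ (uS m) Sp) H.
    rewrite cmodM cmod_real ger0_norm ?exprn_ge0 ?trunc_wt_ge0 ?wt_ge1 //.
    rewrite /trunc_wt minxx => L.
    have {}L : wt (zvec R p.2) ^+ K * cmod (c m p) <= Num.sqrt C.
      by rewrite -(@ler_pXn2r _ 2) ?nnegrE ?mulr_ge0 ?wtX_ge0 ?cmod_ge0 ?sqrtr_ge0 // sqr_sqrtr.
    have := ler_wpM2r (wtVX_ge0 (zvec R p.2) K) L.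
    by rewrite mulrAC mulrA wtVXK mul1r || rewrite mulrAC [X in X * _]mulrC wtVXK mul1r.
  rewrite (_ : d p = c m p - (c m p - d p)); last by rewrite opprB addrC subrK.
  apply: le_trans (cmodB _ _) _; apply: lerD b _.
  exact: HM2 (leq_maxr _ _).
(* As in Fatou's lemma, on the finite set [U] the coefficients [c m'] are replaced by their limits.
   [diff] gives [4 * A^-1 * e m] once [e m' <= e m], and splitting the square doubles it. *)
have lim m U : uniq U -> nrm2 U (fun p => c m p - d p) <= 8 * A^-1 * e m.
  move=> uU; apply/ler_addgt0Pr => eps eps0.
  pose L : R := (size (pairs N U))%:R + 1.
  have L0 : 0 < L by rewrite ltr_wpDl.
  pose eta : R := Num.sqrt (eps / (2 * L)).
  have eta0 : 0 < eta by rewrite sqrtr_gt0 divr_gt0 // mulr_gt0.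
  have /choice[Mp HMp] : forall p, exists M : nat, forall m, (M <= m)%N -> cmod (c m p - d p) <= eta.
    by move=> p; exact: Hd.
  have [Me HMe] := e_small (e m) (e0 m).
  pose m' := (\max_(p <- pairs N U) Mp p + Me)%N.
  have close p : p \in pairs N U -> cmod (c m' p - d p) ^+ 2 <= eps / (2 * L).
    move=> pU; rewrite -[leRHS]sqr_sqrtr; last by rewrite divr_ge0 ?(ltW eps0) // mulr_ge0 // ltW.
    apply: lerX_ge0; first exact: cmod_ge0.
    apply: HMp; apply: leq_trans (leq_addr _ _).
    exact: leq_bigmax_seq.
  apply: (@le_trans _ _ (2 * nrm2 U (fun p => c m p - c m' p) + 2 * \sum_(p <- pairs N U) cmod (c m' p - d p) ^+ 2)).
    rewrite /nrm2 !mulr_sumr -big_split /=; apply: ler_sum => p _.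
    have := cmodD (c m p - c m' p) (c m' p - d p); rewrite addrA subrK.
    move=> /(lerX_ge0 2 (cmod_ge0 _)) /le_trans; apply.
    by have := sqr_ge0 (cmod (c m p - c m' p) - cmod (c m' p - d p)); rewrite sqrrB sqrrD; lra.
  apply: (@lerD _ _ (8 * A^-1 * e m)).
    have := diff m m' U uU; have := HMe m' (leq_addl _ _).
    have Ai : 0 < A^-1 by rewrite invr_gt0.
    move=> le1 le2.
    apply: (@le_trans _ _ (2 * (A^-1 * (2 * e m + 2 * e m)))).
      rewrite ler_wpM2l //; apply: le_trans le2 _; rewrite ler_wpM2l ?(ltW Ai) //; lra.
    by rewrite le_eqVlt; apply/orP; left; apply/eqP; ring.
  apply: (@le_trans _ _ (2 * \sum_(p <- pairs N U) eps / (2 * L))).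
    rewrite ler_wpM2l // big_seq [leRHS]big_seq; apply: ler_sum => p pU.
    exact: close.
  rewrite big_const_seq count_predT iter_addr addr0 -[X in 2 * X]mulr_natl.
  rewrite (_ : 2 * _ = eps * ((size (pairs N U))%:R / L)); last by field; rewrite gt_eqF.
  by rewrite ler_piMr ?(ltW eps0) // ler_pdivrMr // mul1r lerDl.
pose psi x := \sum_(k < N) csum (fun nu => d (k, nu) * phi k (x - zvec R nu)).
have csd k K : exists2 C : R, 0 <= C & forall x,
    (\esum_(nu in setT) (cmod (d (k, nu) * phi k (x - zvec R nu)))%:E <= (C * (wt x)^-1 ^+ K)%:E)%E.
  have [C1 C10 H1] := d_decay (K + 2 * n)%N.
  have [C2 C20 H2] := esum_rapid_le K (rphi k).
  exists (C2 * C1) => [|x]; first exact: mulr_ge0.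
  by apply: H2 => // nu; exact: (H1 (k, nu)).
have csdm k x : csummable (fun nu => d (k, nu) * phi k (x - zvec R nu)).
  by have [C _ H] := csd k 0%N; exact: csummable_le (H x).
have mpsi : cmeas psi.
  apply: cmeas_sum => k _; apply: cmeas_csum => // nu.
  by apply: cmeasM; [exact: cmeas_cst|exact: cmeas_subr].
exists psi; split => //.
  move=> K; have /choice[C HC] : forall k, exists C : R, 0 <= C /\ forall x,
      (\esum_(nu in setT) (cmod (d (k, nu) * phi k (x - zvec R nu)))%:E <= (C * (wt x)^-1 ^+ K)%:E)%E.
    by move=> k; have [C C0 H] := csd k K; exists C.
  exists (\sum_k 2 * C k) => [|x].
    by apply: sumr_ge0 => k _; rewrite mulr_ge0 //; case: (HC k).
  rewrite mulr_suml; apply: le_trans (cmod_sum _ _ _) _; apply: ler_sum => k _.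
  by rewrite -mulrA; apply: cmod_csum_le => //; exact: (HC k).2.
(* [t] and [psi] are both close in energy to the combination of rank [m]; for [psi] this is the
   upper stability bound for the infinite family [c m - d]. *)
have E0 : energy (fun x => t x - psi x) = 0%E.
  apply/eqP; rewrite eq_le energy_ge0 andbT; apply/lee_addgt0Pr => eps eps0.
  pose D := 2 + 2 * (B * (8 * A^-1)).
  have D0 : 0 < D.
    by rewrite ltr_wpDr // mulr_ge0 // mulr_ge0 ?(ltW B0) // mulr_ge0 // invr_ge0 ltW.
  have [m Hm] := e_small (eps / D) (divr_gt0 eps0 D0).
  apply: (@le_trans _ _ (2 * e m + 2 * (B * (8 * A^-1 * e m)))%:E); last first.
    rewrite add0e lee_fin (_ : _ + _ = D * e m); last by rewrite /D; ring.
    by rewrite -ler_pdivlMl // mulrC Hm.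
  apply: (energyB_triangle (w := fcomb phi (S m) (c m))) => //.
  rewrite energyC (@eq_energy _ _ _ (fun x => \sum_(k < N) csum (fun nu => (c m (k, nu) - d (k, nu)) * phi k (x - zvec R nu)))); last first.
    move=> x; rewrite fcomb_csum //; last exact: cS.
    rewrite -sumrB; apply: eq_bigr => k _; rewrite -csumB //.
    by apply: eq_csum => nu; rewrite mulrBl.
  apply: (up (fun k nu => c m (k, nu) - d (k, nu))).
    by rewrite mulr_ge0 ?(ltW (e0 m)) // mulr_ge0 // invr_ge0 ltW.
  move=> k; apply: ge_ereal_sup => _ [U [Ufin _] <-].
  rewrite fsbig_finite //= sumEFin lee_fin.
  have uU : uniq (finmap.enum_fset (fset_set U)) by exact: finmap.fset_uniq.
  apply: le_trans (lim m _ uU); rewrite /nrm2 big_pairs (bigD1 k) //= lerDl.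
  by apply: sumr_ge0 => i _; apply: sumr_ge0 => nu _; rewrite sqr_ge0.
have := energy_eq0 (cmeasB mt mpsi) E0; move: tE; apply: filterS2 => x -> /eqP.
by rewrite subr_eq0 => /eqP.
Qed.

End dual_decay.

(** * The projections *)

Section change_of_variables.
Context (R : realType) (n : nat).
Local Notation vec := 'rV[R]_n.
Local Notation mu := (lebesgue_rV R n).

Lemma cmeas_affine (g : vec -> complex R) (a : R) (b : vec) : cmeas g ->
  cmeas (fun y : vec => g (a *: y + b)).
Proof.
move=> mg; have ma := measurable_scale_rV a b.
by split; [exact: (measurableT_comp mg.1 ma)|exact: (measurableT_comp mg.2 ma)].
Qed.

(** Integrability is not asked: the positive and negative parts scale separately, and infinite parts
    stay infinite, so that [fine] treats both sides alike. *)
Lemma Rintegral_affine (g : vec -> R) (a : R) (b : vec) : 0 < a ->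
  measurable_fun setT (g : vec -> measurableTypeR R) ->
  Rintegral mu setT (fun y : vec => g (a *: y + b)) = a^-1 ^+ n * Rintegral mu setT g.
Proof.
move=> a0 mg; have an0 : 0 < a^-1 ^+ n by rewrite exprn_gt0 // invr_gt0.
have mg' : measurable_fun setT (fun y => (g y)%:E) by apply/measurable_EFinP.
pose h (y : vec) := (g y)%:E.
have E : (\int[mu]_y (g (a *: y + b)%R)%:E = (a^-1 ^+ n)%:E * \int[mu]_y (g y)%:E)%E.
  rewrite (integralE _ _ (fun y : vec => (g (a *: y + b))%:E)) (integralE _ _ h).
  have -> : (\int[mu]_y ((fun y : vec => (g (a *: y + b)%R)%:E)^\+ y) =
             (a^-1 ^+ n)%:E * \int[mu]_y (h^\+ y))%E.
    rewrite -(integral_affine b a0 (measurable_funepos mg')) //.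
    by apply: eq_integral => y _; rewrite !funeposE.
  have -> : (\int[mu]_y ((fun y : vec => (g (a *: y + b)%R)%:E)^\- y) =
             (a^-1 ^+ n)%:E * \int[mu]_y (h^\- y))%E.
    rewrite -(integral_affine b a0 (measurable_funeneg mg')) //.
    by apply: eq_integral => y _; rewrite !funenegE.
  have : (0 <= \int[mu]_y (h^\+ y))%E by apply: integral_ge0.
  have : (0 <= \int[mu]_y (h^\- y))%E by apply: integral_ge0.
  move: (\int[mu]_y (h^\- y))%E (\int[mu]_y (h^\+ y))%E => [q| |] [p| |] //= _ _.
  - by congr EFin; ring.
  - by rewrite gt0_muley ?lte_fin // gt0_muley ?lte_fin.
  - by rewrite gt0_muley ?lte_fin //= gt0_muleNy ?lte_fin.
  - by rewrite gt0_muley ?lte_fin //= gt0_muleNy ?lte_fin.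
by rewrite /Rintegral E; case: (\int[mu]_y _)%E => [r| |] //=;
   rewrite ?gt0_muley ?gt0_muleNy ?lte_fin //= mulr0.
Qed.

Lemma cint_affine (g : vec -> complex R) (a : R) (b : vec) : 0 < a -> cmeas g ->
  cint mu (fun y : vec => g (a *: y + b)) = ((a^-1 ^+ n)%:C)%C * cint mu g.
Proof.
move=> a0 [mg1 mg2]; apply: complex_ext; rewrite ?ReM ?ImM /=.
  by rewrite (Rintegral_affine b a0 mg1) mul0r subr0.
by rewrite (Rintegral_affine b a0 mg2) mul0r addr0.
Qed.

Lemma ae_affine (P : vec -> Prop) (a : R) (b : vec) : 0 < a ->
  {ae mu, forall y, P y} -> {ae mu, forall y, P (a *: y + b)}.
Proof.
move=> a0 [Nn [mN N0 HN]].
have mpre : measurable ((fun y : vec => a *: y + b) @^-1` Nn).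
  by rewrite -[X in measurable X]setTI; exact: measurable_scale_rV.
exists ((fun y : vec => a *: y + b) @^-1` Nn); split => //; last first.
  by move=> y /= H; exact: HN.
have I0 : (\int[mu]_y (\1_Nn y)%:E = 0)%E by rewrite integral_indic // setIT; exact: N0.
have := @integral_affine R n a b (fun y => (\1_Nn y)%:E) a0.
rewrite I0 mule0 => K.
transitivity (\int[mu]_y (\1_Nn (a *: y + b)%R)%:E)%E; last first.
  apply: K; last by move=> y; rewrite lee_fin.
  by apply/measurable_EFinP; exact: measurable_indic.
transitivity (\int[mu]_y (\1_((fun y : vec => a *: y + b)%R @^-1` Nn) y)%:E)%E.
  by rewrite integral_indic // setIT.
by apply: eq_integral.
Qed.

End change_of_variables.

Section operator.
Context (R : realType) (n N : nat).
Hypothesis n_gt0 : (0 < n)%N.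
Local Notation lattice := 'rV[int]_n.
Local Notation vec := 'rV[R]_n.
Local Notation mu := (lebesgue_rV R n).
Variables (phi psi : 'I_N -> vec -> complex R).
Hypothesis mphi : forall j, cmeas (phi j).
Hypothesis rphi : forall j, rapid (phi j).
Hypothesis mpsi : forall j, cmeas (psi j).
Hypothesis rpsi : forall j, rapid (psi j).
Implicit Types (G H : vec -> complex R) (nu : lattice) (u x : vec).

(* [proj] is the operator P_0, with the dual functions [psi]. *)
Definition coef G j nu : complex R :=
  cint mu (fun y => G y * conjc (psi j (y - zvec R nu))).

Definition synth (a : 'I_N -> lattice -> complex R) x : complex R :=
  \sum_(j < N) csum (fun nu => a j nu * phi j (x - zvec R nu)).

Definition proj G : vec -> complex R := synth (coef G).

Definition bounded_growth G u E (Y : R) :=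
  cmeas G /\ {ae mu, forall y, cmod (G y) <= Y * wt (y - u) ^+ E}.

Lemma finite_uniform (Q : 'I_N -> R -> Prop) :
  (forall j C C', C <= C' -> Q j C -> Q j C') ->
  (forall j, exists2 C : R, 0 <= C & Q j C) -> exists2 C : R, 0 <= C & forall j, Q j C.
Proof.
move=> mono Hj; have /choice[C HC] : forall j, exists C : R, 0 <= C /\ Q j C.
  by move=> j; have [C C0 HQ] := Hj j; exists C.
exists (\sum_j C j) => [|j]; first by apply: sumr_ge0 => j _; case: (HC j).
apply: mono (HC j).2; rewrite (bigD1 j) //= lerDl sumr_ge0 // => i _; by case: (HC i).
Qed.

Lemma coef_growth E : exists2 C : R, 0 <= C & forall j G u (Y : R) nu, 0 <= Y ->
  bounded_growth G u E Y ->
  cintegrable mu (fun y => G y * conjc (psi j (y - zvec R nu))) /\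
  cmod (coef G j nu) <= C * Y * wt (zvec R nu - u) ^+ E.
Proof.
apply: (@finite_uniform (fun j C => forall G u (Y : R) nu, 0 <= Y ->
  bounded_growth G u E Y ->
  cintegrable mu (fun y => G y * conjc (psi j (y - zvec R nu))) /\
  cmod (coef G j nu) <= C * Y * wt (zvec R nu - u) ^+ E)).
  move=> j C C' CC' HC G u Y nu Y0 HG; have [h1 h2] := HC G u Y nu Y0 HG; split => //.
  by apply: le_trans h2 _; rewrite ler_wpM2r ?wtX_ge0 // ler_wpM2r.
move=> j; have [C C0 HC] := cint_growth E (rpsi j) (mpsi j).
by exists C => // G u Y nu Y0 [mG HG]; exact: HC.
Qed.

Lemma synth_growth E : exists2 C : R, 0 <= C & forall a u (Y : R) x, 0 <= Y ->
  (forall j nu, cmod (a j nu) <= Y * wt (zvec R nu - u) ^+ E) ->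
  (forall j, csummable (fun nu => a j nu * phi j (x - zvec R nu))) /\
  cmod (synth a x) <= C * Y * wt (x - u) ^+ E.
Proof.
pose Q j C := forall a u (Y : R) x, 0 <= Y ->
  (forall nu, cmod (a nu) <= Y * wt (zvec R nu - u) ^+ E) ->
  (\esum_(nu in setT) (cmod (a nu * phi j (x - zvec R nu)))%:E <=
    (C * Y * wt (x - u) ^+ E)%:E)%E.
have [C C0 HC] : exists2 C : R, 0 <= C & forall j, Q j C.
  apply: finite_uniform => j; last exact: esum_growth_le.
  move=> C C' CC' HC a u Y x Y0 Ha; apply: le_trans (HC a u Y x Y0 Ha) _.
  by rewrite lee_fin ler_wpM2r ?wtX_ge0 // ler_wpM2r.
exists (2 * C * N%:R) => [|a u Y x Y0 Ha]; first by rewrite !mulr_ge0.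
split; first by move=> j; exact: csummable_le (HC j _ u Y x Y0 (Ha j)).
apply: le_trans (cmod_sum _ _ _) _.
rewrite (_ : _ * _ * _ = \sum_(j < N) 2 * (C * Y * wt (x - u) ^+ E)); last first.
  by rewrite sumr_const card_ord -mulr_natl; ring.
apply: ler_sum => j _; apply: cmod_csum_le => //; exact: HC.
Qed.

Lemma cmeas_synth a : cmeas (synth a).
Proof.
apply: cmeas_sum => j _; apply: cmeas_csum => // nu.
by apply: cmeasM; [exact: cmeas_cst|exact: cmeas_subr].
Qed.

(** The constant does not depend on the centre [u]. With [u] taken at the evaluation point the
    weight equals 1, and this gives the pointwise bounds at all scales. *)
Lemma proj_growth E : exists2 C : R, 0 <= C & forall G u (Y : R) x, 0 <= Y ->
  bounded_growth G u E Y -> cmod (proj G x) <= C * Y * wt (x - u) ^+ E.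
Proof.
have [C1 C10 H1] := coef_growth E; have [C2 C20 H2] := synth_growth E.
exists (C2 * C1) => [|G u Y x Y0 HG]; first exact: mulr_ge0.
rewrite -(mulrA C2); apply: (H2 _ u (C1 * Y) x _ _).2; first exact: mulr_ge0.
by move=> j nu; exact: (H1 j G u Y nu Y0 HG).2.
Qed.

(** Polynomials and most functions of [V] are unbounded; polynomial growth is the class on which the
    rapid decay of [phi] and [psi] makes [proj] absolutely convergent and linear. *)
Definition tempered G := cmeas G /\ exists E (Y : R), 0 <= Y /\
  {ae mu, forall y, cmod (G y) <= Y * wt y ^+ E}.

Lemma temperedE G : tempered G -> exists E, exists2 Y : R, 0 <= Y & bounded_growth G 0 E Y.
Proof.
move=> [mG [E [Y [Y0 HG]]]]; exists E, Y => //; split => //.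
by apply: filterS HG => y; rewrite subr0.
Qed.

Lemma tempered_coef G j nu : tempered G ->
  cintegrable mu (fun y => G y * conjc (psi j (y - zvec R nu))).
Proof.
move=> /temperedE[E [Y Y0 HG]]; have [C _ H] := coef_growth E.
exact: (H j G 0 Y nu Y0 HG).1.
Qed.

Lemma tempered_csummable G j x : tempered G ->
  csummable (fun nu => coef G j nu * phi j (x - zvec R nu)).
Proof.
move=> /temperedE[E [Y Y0 HG]]; have [C C0 H] := coef_growth E.
have [C' _ H'] := synth_growth E.
apply: (H' (coef G) 0 (C * Y) x _ _).1; first exact: mulr_ge0.
by move=> i nu; exact: (H i G 0 Y nu Y0 HG).2.
Qed.

Lemma temperedD G H : tempered G -> tempered H -> tempered (fun y => G y + H y).
Proof.
move=> [mG [E [Y [Y0 HG]]]] [mH [F [Z [Z0 HH]]]]; split; first exact: cmeasD.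
exists (E + F)%N, (Y + Z); split; first exact: addr_ge0.
move: HG HH; apply: filterS2 => y h1 h2; apply: le_trans (cmodD _ _) _.
rewrite mulrDl exprD; apply: lerD.
  by apply: le_trans h1 _; rewrite ler_wpM2l // ler_peMr ?wtX_ge0 // exprn_ege1 // wt_ge1.
by apply: le_trans h2 _; rewrite ler_wpM2l // ler_peMl ?wtX_ge0 // exprn_ege1 // wt_ge1.
Qed.

Lemma temperedZ c G : tempered G -> tempered (fun y => c * G y).
Proof.
move=> [mG [E [Y [Y0 HG]]]]; split; first by apply: cmeasM => //; exact: cmeas_cst.
exists E, (cmod c * Y); split; first by rewrite mulr_ge0 // cmod_ge0.
by apply: filterS HG => y h; rewrite cmodM -mulrA ler_wpM2l // cmod_ge0.
Qed.

Lemma tempered0 : tempered (fun=> 0).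
Proof.
split; first exact: cmeas_cst.
by exists 0%N, 0; split => //; apply/nearW => y; rewrite cmod0 mul0r.
Qed.

Lemma tempered_sum I (r : seq I) (P : pred I) (F : I -> vec -> complex R) :
  (forall i, P i -> tempered (F i)) -> tempered (fun y => \sum_(i <- r | P i) F i y).
Proof.
move=> HF; elim: r => [|i r IH].
  by under eq_fun do rewrite big_nil; exact: tempered0.
under eq_fun do rewrite big_cons.
by case Pi: (P i) => //; apply: temperedD => //; exact: HF.
Qed.

Lemma temperedB G H : tempered G -> tempered H -> tempered (fun y => G y - H y).
Proof.
move=> tG tH; have -> : (fun y => G y - H y) = (fun y => G y + (-1) * H y).
  by apply/funext => y; rewrite mulN1r.
by apply: temperedD => //; exact: temperedZ.
Qed.

Lemma projD G H x : tempered G -> tempered H ->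
  proj (fun y => G y + H y) x = proj G x + proj H x.
Proof.
move=> tG tH; rewrite /proj /synth -big_split; apply: eq_bigr => j _ /=.
rewrite -csumD //; [|exact: tempered_csummable..].
apply: eq_csum => nu; rewrite -mulrDl; congr (_ * _).
rewrite /coef -cintD; [|exact: tempered_coef..].
by apply: eq_cint => y; rewrite mulrDl.
Qed.

Lemma projZ c G x : tempered G -> proj (fun y => c * G y) x = c * proj G x.
Proof.
move=> tG; rewrite /proj /synth mulr_sumr; apply: eq_bigr => j _ /=.
rewrite -csumZ //; last exact: tempered_csummable.
apply: eq_csum => nu; rewrite mulrA; congr (_ * _).
rewrite /coef -cintZ; last exact: tempered_coef.
by apply: eq_cint => y; rewrite mulrA.
Qed.

Lemma projB G H x : tempered G -> tempered H ->
  proj (fun y => G y - H y) x = proj G x - proj H x.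
Proof.
move=> tG tH; rewrite (_ : (fun y => G y - H y) = (fun y => G y + (-1) * H y)).
  by rewrite (projD x tG (temperedZ _ tH)) (projZ _ x tH) mulN1r.
by apply/funext => y; rewrite mulN1r.
Qed.

Lemma proj_sum I (r : seq I) (F : I -> vec -> complex R) x :
  (forall i, tempered (F i)) ->
  proj (fun y => \sum_(i <- r) F i y) x = \sum_(i <- r) proj (F i) x.
Proof.
move=> tF; elim: r => [|i r IH].
  under eq_fun do rewrite big_nil; rewrite big_nil.
  rewrite (_ : (fun=> 0) = (fun y : vec => 0 * (fun _ : vec => 0 : complex R) y)).
    by rewrite projZ ?mul0r //; exact: tempered0.
  by apply/funext => y; rewrite mul0r.
under eq_fun do rewrite big_cons; rewrite big_cons projD ?IH //.
exact: tempered_sum.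
Qed.

Lemma eq_proj G H x : (forall y, G y = H y) -> proj G x = proj H x.
Proof. by move=> GH; have -> : G = H by apply/funext. Qed.

(** The substitution in the integral and the reindexing of the lattice sum match. Together with the
    reproduction of lower degrees, this gives the periodicity used in [proj_hom]. *)
Lemma proj_shift G (m : lattice) x : tempered G ->
  proj (fun y => G (y + zvec R m)) x = proj G (x + zvec R m).
Proof.
move=> tG; apply: eq_bigr => j _.
apply: etrans (csum_shift (fun nu => coef G j nu * phi j (x + zvec R m - zvec R nu)) m).
apply: eq_csum => nu; congr (_ * phi j _); last first.
  by rewrite zvecD opprD addrACA subrr addr0.
have mg : cmeas (fun y => G y * conjc (psi j (y - zvec R (nu + m)))).
  by apply: cmeasM; [exact: tG.1|apply: cmeasJ; exact: cmeas_subr].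
rewrite /coef -[RHS](mul1r) -[1]/((1 : R)%:C)%C.
have := cint_affine (zvec R m) ltr01 mg; rewrite invr1 expr1n => <-.
apply: eq_cint => y; rewrite scale1r; congr (_ * conjc (psi j _)).
by rewrite zvecD opprD addrACA subrr addr0.
Qed.

Lemma coef_csum E : exists2 C : R, 0 <= C & forall (h : lattice -> vec -> complex R) (Y : R) j nu,
  0 <= Y -> (forall m, cmeas (h m)) ->
  (forall y, (\esum_(m in setT) (cmod (h m y))%:E <= (Y * wt y ^+ E)%:E)%E) ->
  (\esum_(m in setT) (cmod (coef (h m) j nu))%:E <= (C * Y * wt (zvec R nu) ^+ E)%:E)%E /\
  coef (fun y => csum (fun m => h m y)) j nu = csum (fun m => coef (h m) j nu).
Proof.
have [C C0 HC] := rapid_family rpsi (E + 2 * n)%N.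
exists (2 * (C * pi ^+ n)) => [|h Y j nu Y0 mh Hh].
  by rewrite mulr_ge0 // mulr_ge0 // exprn_ge0 // pi_ge0.
pose F m y := h m y * conjc (psi j (y - zvec R nu)).
have mF m : cmeas (F m) by apply: cmeasM => //; apply: cmeasJ; exact: cmeas_subr.
pose Z := C * Y * wt (zvec R nu) ^+ E.
have Z0 : 0 <= Z by rewrite !mulr_ge0 // wtX_ge0.
pose H y := Z * (wt (y - zvec R nu))^-1 ^+ (2 * n).
have mH : measurable_fun setT (H : vec -> measurableTypeR R).
  by apply: measurable_funM => //; exact: measurable_wtX.
have FH y : (\esum_(m in setT) (cmod (F m y))%:E <= (H y)%:E)%E.
  have psiy := HC j (y - zvec R nu).
  apply: (@le_trans _ _ ((cmod (psi j (y - zvec R nu)))%:E * (Y * wt y ^+ E)%:E)%E).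
    apply: ge_ereal_sup => _ [A Afin <-].
    rewrite (eq_fsbigr (fun m => (cmod (psi j (y - zvec R nu)))%:E * (cmod (h m y))%:E)%E); last first.
      by move=> m _; rewrite /F cmodM cmodJ EFinM muleC.
    rewrite -ge0_mule_fsumr; last by move=> m; rewrite lee_fin cmod_ge0.
    apply: lee_wpmul2l; first by rewrite lee_fin cmod_ge0.
    by apply: le_trans (Hh y); apply: ereal_sup_ubound; exists A.
  rewrite -EFinM lee_fin; apply: le_trans (ler_wpM2r _ psiy) _.
    by rewrite mulr_ge0 // wtX_ge0.
  rewrite exprD /H /Z [leLHS](_ : _ = C * Y * (wt (y - zvec R nu))^-1 ^+ (2 * n) * (wt y ^+ E * (wt (y - zvec R nu))^-1 ^+ E)); last by ring.
  rewrite [leRHS]mulrAC ler_wpM2l //; first by rewrite !mulr_ge0 // wtVX_ge0.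
  by have := wtX_wtVX_le E y (zvec R nu) 0; rewrite !subr0.
have iH : (\int[mu]_y (H y)%:E <= (Z * pi ^+ n)%:E)%E.
  under eq_integral do rewrite EFinM.
  rewrite ge0_integralZl_EFin //.
  - by rewrite [leRHS]EFinM; apply: lee_wpmul2l; [rewrite lee_fin|exact: integral_wt].
  - by move=> y _; rewrite lee_fin wtVX_ge0.
  - by apply/measurable_EFinP; exact: measurable_wtX.
have [h1 h2 h3] := cint_csum n_gt0 mF mH (le_lt_trans iH (ltry _)) FH.
split.
  rewrite (_ : 2 * _ * Y * _ = 2 * (Z * pi ^+ n)); last by rewrite /Z; ring.
  exact: (esum_cint_le n_gt0 mF mH iH FH).
rewrite /coef -h3; apply: eq_cint => y; rewrite mulrC -csumZ //.
  by apply: eq_csum => m; rewrite mulrC.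
exact: csummable_le (Hh y).
Qed.

(** The sum over [m] passes under the integral by [coef_csum], then through the synthesis by
    [csum_csum]; the majorant [T] grows polynomially in [nu] apart from the decay of [phi], hence is
    summable. *)
Lemma proj_csum E (h : lattice -> vec -> complex R) (Y : R) x : 0 <= Y ->
  (forall m, cmeas (h m)) ->
  (forall y, (\esum_(m in setT) (cmod (h m y))%:E <= (Y * wt y ^+ E)%:E)%E) ->
  proj (fun y => csum (fun m => h m y)) x = csum (fun m => proj (h m) x).
Proof.
move=> Y0 mh Hh; have [C C0 HC] := coef_csum E.
pose T j nu := C * Y * wt (zvec R nu) ^+ E * cmod (phi j (x - zvec R nu)).
have T1 j nu : (\esum_(m in setT) (cmod (coef (h m) j nu * phi j (x - zvec R nu)))%:E <= (T j nu)%:E)%E.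
  apply: ge_ereal_sup => _ [A Afin <-].
  rewrite (eq_fsbigr (fun m => (cmod (phi j (x - zvec R nu)))%:E * (cmod (coef (h m) j nu))%:E)%E); last first.
    by move=> m _; rewrite cmodM EFinM muleC.
  rewrite -ge0_mule_fsumr; last by move=> m; rewrite lee_fin cmod_ge0.
  rewrite /T mulrC EFinM; apply: lee_wpmul2l; first by rewrite lee_fin cmod_ge0.
  by apply: le_trans (HC h Y j nu Y0 mh Hh).1; apply: ereal_sup_ubound; exists A.
have T2 j : (\esum_(nu in setT) (T j nu)%:E < +oo)%E.
  have [C' C'0 H'] := esum_growth_le E (rphi j).
  apply: le_lt_trans (_ : (_ <= (C' * (C * Y) * wt (x - 0) ^+ E)%:E)%E) _; last exact: ltry.
  apply: le_trans (H' (fun nu => ((C * Y * wt (zvec R nu) ^+ E)%:C)%C) 0 (C * Y) x _ _).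
  - apply: le_esum => nu _; rewrite cmodM cmod_real ger0_norm //.
    by rewrite !mulr_ge0 // wtX_ge0.
  - exact: mulr_ge0.
  - by move=> nu; rewrite cmod_real ger0_norm ?subr0 // !mulr_ge0 // wtX_ge0.
rewrite /proj /synth csum_sum //; last first.
  by move=> j _; have [] := csum_csum n_gt0 (T2 j) (T1 j).
apply: eq_bigr => j _.
have [_ _ _ <-] := csum_csum n_gt0 (T2 j) (T1 j).
apply: eq_csum => nu; rewrite (HC h Y j nu Y0 mh Hh).2 mulrC -csumZ //.
  by apply: eq_csum => m; rewrite mulrC.
by have [h1 _] := HC h Y j nu Y0 mh Hh; exact: csummable_le h1.
Qed.

End operator.

(** * The space V and refinability *)

Section refinement.
Context (R : realType) (n N : nat).
Hypothesis n_gt0 : (0 < n)%N.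
Local Notation lattice := 'rV[int]_n.
Local Notation vec := 'rV[R]_n.
Local Notation mu := (lebesgue_rV R n).
Variables (phi psi : 'I_N -> vec -> complex R).
Hypothesis mphi : forall j, cmeas (phi j).
Hypothesis rphi : forall j, rapid (phi j).
Hypothesis mpsi : forall j, cmeas (psi j).
Hypothesis rpsi : forall j, rapid (psi j).
Hypothesis biorth : forall j k (eta nu : lattice),
  cint mu (fun y => phi j (y - zvec R eta) * conjc (psi k (y - zvec R nu))) =
  ((eta == nu) && (j == k))%:R.
Implicit Types (F G H : vec -> complex R) (nu : lattice) (u x : vec).
Local Notation synth := (synth phi).
Local Notation coef := (coef psi).
Local Notation proj := (proj phi psi).

Definition spanV F := exists a, exists E, exists2 Y : R, 0 <= Y &
  (forall j nu, cmod (a j nu) <= Y * wt (zvec R nu) ^+ E) /\ F = synth a.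

Lemma spanV_tempered F : spanV F -> tempered F.
Proof.
move=> [a [E [Y Y0 [Ha ->]]]]; have [C C0 HC] := synth_growth n_gt0 rphi E.
split; first exact: cmeas_synth.
exists E, (C * Y); split; first exact: mulr_ge0.
apply/nearW => x; have := (HC a 0 Y x Y0 _).2; rewrite subr0; apply => j nu.
by rewrite subr0.
Qed.

Lemma spanV_proj G : tempered G -> spanV (proj G).
Proof.
move=> /temperedE[E [Y Y0 HG]]; have [C C0 HC] := coef_growth mpsi rpsi E.
exists (coef G), E, (C * Y); first exact: mulr_ge0.
by split => // j nu; have [_] := HC j G 0 Y nu Y0 HG; rewrite subr0.
Qed.

Lemma esum_synth a E (Y : R) : 0 <= Y ->
  (forall j nu, cmod (a j nu) <= Y * wt (zvec R nu) ^+ E) ->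
  exists2 C : R, 0 <= C & forall j y,
   (\esum_(m in setT) (cmod (a j m * phi j (y - zvec R m)))%:E <= (C * wt y ^+ E)%:E)%E.
Proof.
move=> Y0 Ha; apply: (@finite_uniform R N (fun j C => forall y : vec,
   (\esum_(m in setT) (cmod (a j m * phi j (y - zvec R m)))%:E <= (C * wt y ^+ E)%:E)%E)).
  move=> j C C' CC' HC y; apply: le_trans (HC y) _.
  by rewrite lee_fin ler_wpM2r ?wtX_ge0.
move=> j; have [C C0 HC] := esum_growth_le E (rphi j).
exists (C * Y) => [|y]; first exact: mulr_ge0.
have := HC (a j) 0 Y y Y0; rewrite subr0; apply => nu; by rewrite subr0.
Qed.

Lemma tempered_shift_rapid (g : vec -> complex R) u : cmeas g -> rapid g ->
  tempered (fun y => g (y - u)).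
Proof.
move=> mg /rapid_bounded[C C0 HC]; split; first exact: cmeas_subr.
by exists 0%N, C; split => //; apply/nearW => y; rewrite expr0 mulr1.
Qed.

Lemma coef_sum (F : 'I_N -> vec -> complex R) k nu : (forall j, tempered (F j)) ->
  coef (fun y => \sum_j F j y) k nu = \sum_j coef (F j) k nu.
Proof.
move=> tF; rewrite /coef -cint_sum => [|j _]; last exact: tempered_coef.
by apply: eq_cint => y; rewrite mulr_suml.
Qed.

Lemma tempered_csum E (h : lattice -> vec -> complex R) (Y : R) : 0 <= Y ->
  (forall m, cmeas (h m)) ->
  (forall y, (\esum_(m in setT) (cmod (h m y))%:E <= (Y * wt y ^+ E)%:E)%E) ->
  tempered (fun y => csum (fun m => h m y)).
Proof.
move=> Y0 mh Hh; split; first exact: cmeas_csum.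
exists E, (2 * Y); split; first exact: mulr_ge0.
by apply/nearW => y; rewrite -mulrA; exact: cmod_csum_le.
Qed.

(** Biorthogonality applied term by term. With [spanV_proj] it identifies [V] with the tempered
    functions fixed by [proj], so that membership in [V] can be proved by computing [proj]. *)
Lemma proj_spanV F : spanV F -> proj F = F.
Proof.
move=> [a [E [Y Y0 [Ha ->]]]]; have [C C0 HC] := esum_synth Y0 Ha.
have mh j m : cmeas (fun y : vec => a j m * phi j (y - zvec R m)).
  by apply: cmeasM; [exact: cmeas_cst|exact: cmeas_subr].
apply/funext => x; apply: eq_bigr => k _; apply: eq_csum => nu; congr (_ * _).
rewrite coef_sum => [|j]; last exact: tempered_csum (HC j).
have cE j : coef (fun y => csum (fun m => a j m * phi j (y - zvec R m))) k nu =
            (j == k)%:R * a j nu.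
  have [C' _ H'] := coef_csum n_gt0 mpsi rpsi E.
  have [_ ->] := H' _ C k nu C0 (mh j) (HC j).
  rewrite -(csum_delta nu ((j == k)%:R * a j nu)).
  apply: eq_csum => m; transitivity (a j m * ((m == nu) && (j == k))%:R).
    rewrite -biorth -cintZ; first by apply: eq_cint => y; rewrite mulrA.
    by apply: tempered_coef => //; exact: tempered_shift_rapid.
  by case: eqVneq => [->|_]; case: eqVneq => [->|_]; rewrite ?mulr0 ?mul0r ?mul1r ?mulr1.
under eq_bigr do rewrite cE.
rewrite (bigD1 k) //= eqxx mul1r big1 ?addr0 // => j jk.
by rewrite (negPf jk) mul0r.
Qed.

Variable lam : nat.
Hypothesis lam_gt1 : (1 < lam)%N.
Hypothesis refi : refinable lam phi.
Let lamV_gt0 : 0 < (lam%:R : R)^-1.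
Proof. by rewrite invr_gt0 ltr0n ltnW. Qed.

Lemma tempered_scale (a : R) u G : 0 < a -> a <= 1 -> tempered G -> tempered (fun y => G (a *: y + u)).
Proof.
move=> a0 a1 [mG [E [Y [Y0 HG]]]]; split; first exact: cmeas_affine.
exists E, (Y * wt u ^+ E); split; first by rewrite mulr_ge0 // wtX_ge0.
apply: filterS (ae_affine u a0 HG) => y Hy; apply: le_trans Hy _.
rewrite -mulrA ler_wpM2l // -exprMn lerXn2r ?nnegrE ?wt_ge0 // ?mulr_ge0 ?wt_ge0 //.
rewrite mulrC; apply: le_trans (wtD _ _) _; rewrite ler_wpM2r ?wt_ge0 //.
by rewrite /wt lerD2l normrZ ger0_norm ?ler_piMl // ltW.
Qed.

(** The refinement coefficients are summable, hence bounded: they have growth of order 0. *)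
Lemma spanV_refine j : spanV (fun y => phi j ((lam%:R)^-1 *: y)).
Proof.
have [c [cl1 Hc]] := refi.
pose Y := \sum_(k < N) fine (\esum_(nu in setT) (cmod (c j k nu))%:E)%E.
have Y0 k : 0 <= fine (\esum_(nu in setT) (cmod (c j k nu))%:E)%E.
  by apply: fine_ge0; apply: esum_ge0 => nu _; rewrite lee_fin cmod_ge0.
exists (c j), 0%N, Y; first by apply: sumr_ge0.
split.
  move=> k nu; rewrite expr0 mulr1 /Y (bigD1 k) //=.
  apply: le_trans (_ : _ <= fine (\esum_(nu in setT) (cmod (c j k nu))%:E)%E) _; last first.
    by rewrite lerDl sumr_ge0.
  rewrite -lee_fin fineK; last first.
    rewrite ge0_fin_numE; first exact: cl1.
    by apply: esum_ge0 => eta _; rewrite lee_fin cmod_ge0.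
  apply: ereal_sup_ubound; exists [set nu]; first by split.
  by rewrite fsbig_set1.
apply/funext => y; rewrite Hc; apply: eq_bigr => k _; apply: eq_csum => nu.
by rewrite scalerA divff ?scale1r // pnatr_eq0 -lt0n ltnW.
Qed.

(** After dilation, the shift of a generator by [m] becomes the shift by [lam * m] of the dilated
    generator [D j]. The latter is fixed by [proj] through refinability, and [proj] commutes with
    integer shifts and with the lattice sum; no convolution of coefficient sequences appears. *)
Lemma spanV_dilate F : spanV F -> spanV (fun y => F ((lam%:R)^-1 *: y)).
Proof.
move=> sF; have a1 : (lam%:R : R)^-1 <= 1 by rewrite invf_le1 ?ltr0n ?ler1n ltnW.
have tF : tempered (fun y => F ((lam%:R)^-1 *: y)).
  have := tempered_scale 0 lamV_gt0 a1 (spanV_tempered sF).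
  by under eq_fun do rewrite addr0.
suff <- : proj (fun y => F ((lam%:R)^-1 *: y)) = (fun y => F ((lam%:R)^-1 *: y)).
  exact: spanV_proj.
have [a [E [Y Y0 [Ha FE]]]] := sF; have [C C0 HC] := esum_synth Y0 Ha.
pose D j y := phi j ((lam%:R)^-1 *: y).
pose h j m y := a j m * D j (y - zvec R (m *+ lam)).
have DE j m y : D j (y - zvec R (m *+ lam)) = phi j ((lam%:R)^-1 *: y - zvec R m).
  rewrite /D scalerBr; congr (phi j (_ - _)); apply/rowP => i; rewrite !mxE.
  by rewrite mulmxnE rmorphMn /= -[_%:~R *+ lam]mulr_natl mulrA mulVf ?mul1r // pnatr_eq0 -lt0n ltnW.
have FhE y : F ((lam%:R)^-1 *: y) = \sum_j csum (fun m => h j m y).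
  by rewrite FE; apply: eq_bigr => j _; apply: eq_csum => m; rewrite /h DE.
have tD j : tempered (D j) by exact: spanV_tempered (spanV_refine j).
have mh j m : cmeas (h j m).
  by apply: cmeasM; [exact: cmeas_cst|apply: cmeas_subr; exact: (tD j).1].
have Hh j y : (\esum_(m in setT) (cmod (h j m y))%:E <= (C * wt y ^+ E)%:E)%E.
  apply: (@le_trans _ _ (C * wt ((lam%:R)^-1 *: y) ^+ E)%:E).
    by under eq_esum do rewrite /h DE; exact: HC.
  rewrite lee_fin ler_wpM2l // lerXn2r ?nnegrE ?wt_ge0 //.
  by rewrite /wt lerD2l normrZ ger0_norm ?ler_piMl // ltW.
have HhT j : tempered (fun y => csum (fun m => h j m y)) by exact: tempered_csum (Hh j).
apply/funext => x; rewrite (_ : (fun y => _) = (fun y => \sum_j csum (fun m => h j m y))); last first.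
  by apply/funext.
rewrite proj_sum // FhE; apply: eq_bigr => j _.
rewrite (proj_csum n_gt0 rphi mpsi rpsi x C0 (mh j) (Hh j)); apply: eq_csum => m.
have tDm : tempered (fun y => D j (y + zvec R (- (m *+ lam)))).
  have := tempered_scale (zvec R (- (m *+ lam))) ltr01 (lexx _) (tD j).
  by under eq_fun do rewrite scale1r.
rewrite /h (eq_proj phi psi (H := fun y => a j m * D j (y + zvec R (- (m *+ lam))))); last first.
  by move=> y; rewrite zvecN.
rewrite projZ // proj_shift //.
by rewrite (proj_spanV (spanV_refine j)) zvecN.
Qed.

Lemma spanV_dilateX F l : spanV F -> spanV (fun y => F ((lam%:R ^- l) *: y)).
Proof.
move=> sF; elim: l => [|l IH].
  by rewrite (_ : (fun y => _) = F) //; apply/funext => y; rewrite expr0 invr1 scale1r.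
rewrite (_ : (fun y => _) = (fun y => (fun z => F (lam%:R ^- l *: z)) ((lam%:R)^-1 *: y))).
  exact: (spanV_dilate IH).
by apply/funext => y; rewrite scalerA -invfM -exprSr.
Qed.

Lemma spanV_shift F m : spanV F -> spanV (fun y => F (y + zvec R m)).
Proof.
move=> sF.
have tF : tempered (fun y => F (y + zvec R m)).
  have := tempered_scale (zvec R m) ltr01 (lexx _) (spanV_tempered sF).
  by under eq_fun do rewrite scale1r.
suff <- : proj (fun y => F (y + zvec R m)) = (fun y => F (y + zvec R m)).
  exact: spanV_proj.
apply/funext => x; rewrite proj_shift ?proj_spanV //; exact: spanV_tempered.
Qed.

End refinement.

(** * Polynomials and Taylor expansions *)

Section polynomials.
Context (R : realType) (n : nat).
Local Notation vec := 'rV[R]_n.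
Local Notation cR := (fun t : R => (t%:C)%C).
Implicit Types (p q r P Q : vec -> complex R) (y u x : vec).

Inductive hom : nat -> (vec -> complex R) -> Prop :=
| hom_zero m : hom m (fun=> 0)
| hom_cst c : hom 0 (fun=> c)
| hom_add m p q : hom m p -> hom m q -> hom m (fun y => p y + q y)
| hom_coord m i p : hom m p -> hom m.+1 (fun y => cR (y 0 i) * p y).

(* Polynomials of degree less than [d]; [hom m] are the forms of degree [m]. *)
Definition pol d P := exists p : nat -> vec -> complex R,
  (forall m, hom m (p m)) /\ P = (fun y => \sum_(m < d) p m y).

Lemma homZ m c p : hom m p -> hom m (fun y => c * p y).
Proof.
elim=> {m p} [m|c'|m p q _ IHp _ IHq|m i p _ IH].
- by under eq_fun do rewrite mulr0; exact: hom_zero.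
- exact: hom_cst.
- by under eq_fun do rewrite mulrDr; exact: hom_add.
- by under eq_fun do rewrite mulrCA; exact: hom_coord.
Qed.

Lemma hom_sum m I (s : seq I) (F : I -> vec -> complex R) :
  (forall i, hom m (F i)) -> hom m (fun y => \sum_(i <- s) F i y).
Proof.
move=> H; elim: s => [|i s IH].
  by under eq_fun do rewrite big_nil; exact: hom_zero.
by under eq_fun do rewrite big_cons; exact: hom_add.
Qed.

Lemma hom_scale m p (t : R) y : hom m p -> p (t *: y) = cR (t ^+ m) * p y.
Proof.
elim=> {m p} [m|c|m p q _ IHp _ IHq|m i p _ IH].
- by rewrite mulr0.
- by rewrite mul1r.
- by rewrite IHp IHq mulrDr.
- by rewrite IH mxE exprS !rmorphM /=; ring.
Qed.

Lemma hom_cmeas m p : hom m p -> cmeas p.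
Proof.
elim=> {m p} [m|c|m p q _ IHp _ IHq|m i p _ IH].
- exact: cmeas_cst.
- exact: cmeas_cst.
- exact: cmeasD.
- apply: cmeasM => //; split; first exact: measurable_coord.
  exact: measurable_cst.
Qed.

Lemma hom_bound m p : hom m p -> exists2 C : R, 0 <= C & forall y, cmod (p y) <= C * `|y| ^+ m.
Proof.
elim=> {m p} [m|c|m p q _ [C C0 IHp] _ [D D0 IHq]|m i p _ [C C0 IH]].
- by exists 0 => // y; rewrite cmod0 mul0r.
- by exists (cmod c) => [|y]; rewrite ?mulr1 // cmod_ge0.
- exists (C + D) => [|y]; first exact: addr_ge0.
  by rewrite mulrDl; apply: le_trans (cmodD _ _) _; exact: lerD.
- exists C => // y; rewrite cmodM cmod_real exprS mulrCA.
  by apply: ler_pM; rewrite ?normr_ge0 ?cmod_ge0 //; exact: rV_coord_le.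
Qed.

Lemma hom_at0 m p : hom m.+1 p -> p 0 = 0.
Proof. by move=> hp; rewrite -(scale0r 0) (hom_scale 0 0 hp) exprS !mul0r. Qed.

Lemma pol_hom m d p : hom m p -> (m < d)%N -> pol d p.
Proof.
move=> hp md; exists (fun i => if i == m then p else (fun=> 0)); split.
  by move=> i; case: eqVneq => [->|_] //; exact: hom_zero.
apply/funext => y; rewrite (bigD1 (Ordinal md)) //= eqxx big1 ?addr0 // => i.
by rewrite -val_eqE /= => /negPf ->.
Qed.

Lemma pol_le d d' P : (d <= d')%N -> pol d P -> pol d' P.
Proof.
move=> dd' [p [hp ->]]; exists (fun i => if (i < d)%N then p i else (fun=> 0)); split.
  by move=> i; case: ifP => // _; exact: hom_zero.
apply/funext => y; rewrite (big_ord_widen d' (fun i => p i y) dd') big_mkcond /=.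
by apply: eq_bigr => i _; case: ifP.
Qed.

Lemma polD d P Q : pol d P -> pol d Q -> pol d (fun y => P y + Q y).
Proof.
move=> [p [hp ->]] [q [hq ->]]; exists (fun m y => p m y + q m y); split.
  by move=> m; exact: hom_add.
by apply/funext => y; rewrite big_split.
Qed.

Lemma polZ d c P : pol d P -> pol d (fun y => c * P y).
Proof.
move=> [p [hp ->]]; exists (fun m y => c * p m y); split.
  by move=> m; exact: homZ.
by apply/funext => y; rewrite mulr_sumr.
Qed.

Lemma polB d P Q : pol d P -> pol d Q -> pol d (fun y => P y - Q y).
Proof.
move=> hP hQ; under eq_fun do rewrite -mulN1r.
by apply: polD => //; exact: polZ.
Qed.

Lemma pol0 d : pol d (fun=> 0).
Proof.
exists (fun _ _ => 0); split; first by move=> m; exact: hom_zero.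
by apply/funext => y; rewrite big1.
Qed.

Lemma pol_sum d I (s : seq I) (F : I -> vec -> complex R) :
  (forall i, pol d (F i)) -> pol d (fun y => \sum_(i <- s) F i y).
Proof.
move=> H; elim: s => [|i s IH].
  by under eq_fun do rewrite big_nil; exact: pol0.
by under eq_fun do rewrite big_cons; exact: polD.
Qed.

Lemma pol_coord d i P : pol d P -> pol d.+1 (fun y => cR (y 0 i) * P y).
Proof.
move=> [p [hp ->]]; under eq_fun do rewrite mulr_sumr.
by apply: pol_sum => m; apply: pol_hom (hom_coord i (hp m)) _; rewrite ltnS.
Qed.

(** The leading form is invariant under translation; only lower degrees change, and these are
    covered by induction when polynomials are reproduced. *)
Lemma hom_shift m p x : hom m p ->
  exists2 r, pol m r & forall u, p (x + u) = p u + r u.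
Proof.
elim=> {m p} [m|c|m p q _ [r hr IHp] _ [r' hr' IHq]|m i p hp [r hr IH]].
- by exists (fun=> 0); [exact: pol0|move=> u; rewrite addr0].
- by exists (fun=> 0); [exact: pol0|move=> u; rewrite addr0].
- exists (fun u => r u + r' u); first exact: polD.
  by move=> u; rewrite IHp IHq addrACA.
- exists (fun u => cR (x 0 i) * (p u + r u) + cR (u 0 i) * r u).
    apply: polD; last exact: pol_coord.
    apply: polZ; apply: polD; first exact: pol_hom hp _.
    exact: pol_le hr.
  by move=> u; rewrite IH mxE rmorphD /=; ring.
Qed.

Lemma pol_shift d P x : pol d P -> pol d (fun u => P (x + u)).
Proof.
move=> [p [hp ->]]; apply: pol_sum => m.
have [r hr E] := hom_shift x (hp m); under eq_fun do rewrite E.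
apply: polD; first exact: pol_hom (hp m) _.
by apply: pol_le hr; exact: ltnW.
Qed.

Lemma pol_scale d P (t : R) : pol d P -> pol d (fun u => P (t *: u)).
Proof.
move=> [p [hp ->]]; apply: pol_sum => m; under eq_fun do rewrite (hom_scale _ _ (hp m)).
by apply: pol_hom (homZ _ (hp m)) _.
Qed.

Lemma pol_cmeas d P : pol d P -> cmeas P.
Proof. by move=> [p [hp ->]]; apply: cmeas_sum => m _; exact: hom_cmeas (hp m). Qed.

Lemma pol_bound d P : pol d P -> exists2 C : R, 0 <= C & forall y, cmod (P y) <= C * wt y ^+ d.
Proof.
move=> [p [hp ->]].
have /choice[C HC] : forall m, exists C : R, 0 <= C /\ forall y, cmod (p m y) <= C * `|y| ^+ m.
  by move=> m; have [C C0 H] := hom_bound (hp m); exists C.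
exists (\sum_(m < d) C m) => [|y]; first by apply: sumr_ge0 => m _; case: (HC m).
apply: le_trans (cmod_sum _ _ _) _; rewrite mulr_suml; apply: ler_sum => m _.
apply: le_trans ((HC m).2 y) _; apply: ler_wpM2l; first by case: (HC m).
apply: (@le_trans _ _ (wt y ^+ m)).
  by rewrite lerXn2r ?nnegrE ?wt_ge0 ?normr_ge0 // /wt lerDr.
by rewrite ler_weXn2l ?wt_ge1 // ltnW.
Qed.

(* Eliminate the top coefficient by comparing Q(t) with 2^d Q(t/2). *)
Lemma coef_bound d : exists2 C : R, 0 <= C & forall (a : nat -> complex R) (e : R),
  (forall t : R, 0 <= t <= 1 -> cmod (\sum_(m < d) cR (t ^+ m) * a m) <= e) ->
  forall m, (m < d)%N -> cmod (a m) <= C * e.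
Proof.
elim: d => [|d [C C0 IH]]; first by exists 0.
have two0 : (0 : R) <= 2 ^+ d by rewrite exprn_ge0.
exists (1 + d%:R * (C * (1 + 2 ^+ d)) + C * (1 + 2 ^+ d)) => [|a e Ha].
  by rewrite !addr_ge0 // mulr_ge0 // ?mulr_ge0 // addr_ge0.
have e0 : 0 <= e by apply: le_trans (cmod_ge0 _) (Ha 0 _); rewrite lexx ler01.
have low m : (m < d)%N -> cmod (a m) <= C * (1 + 2 ^+ d) * e.
  move=> md; pose b m : complex R := cR (1 - 2 ^+ (d - m)) * a m.
  have Hb (t : R) : 0 <= t <= 1 -> cmod (\sum_(m < d) cR (t ^+ m) * b m) <= (1 + 2 ^+ d) * e.
    move=> /andP[t0 t1].
    have -> : \sum_(m < d) cR (t ^+ m) * b m = \sum_(m < d.+1) cR (t ^+ m) * a m -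
                 cR (2 ^+ d) * \sum_(m < d.+1) cR ((t / 2) ^+ m) * a m.
      rewrite mulr_sumr -sumrB big_ord_recr /=.
      rewrite [X in _ = _ + X](_ : _ = 0) ?addr0; last first.
        by rewrite mulrA -rmorphM /= -exprMn (_ : 2 * (t / 2) = t) ?subrr //; field.
      apply: eq_bigr => i _; rewrite /b.
      have K : (2 : R) ^+ d * (t / 2) ^+ i = 2 ^+ (d - i) * t ^+ i.
        rewrite -{1}(subnK (ltnW (ltn_ord i))) exprD -mulrA -exprMn; congr (_ * _ ^+ _).
        by field.
      rewrite [X in _ = _ - X]mulrA -[X in _ = _ - X * _]rmorphM /= K.
      by rewrite !rmorphM !rmorphB /= rmorph1; ring.
    apply: le_trans (cmodB _ _) _; rewrite mulrDl mul1r; apply: lerD.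
      by apply: Ha; rewrite t0 t1.
    rewrite cmodM cmod_real ger0_norm // ler_wpM2l //; apply: Ha.
    by rewrite divr_ge0 //= ler_pdivrMr // mul1r; apply: le_trans t1 _; rewrite ler1n.
  have := IH b _ Hb m md; rewrite mulrA; apply: le_trans.
  (* The multiplier [1 - 2 ^+ (d - m)] has absolute value at least 1 for [m < d], so a bound on
     [b m] is a bound on [a m]. *)
  rewrite cmodM cmod_real ler_peMl ?cmod_ge0 //.
  rewrite -normrN opprB ler_normr; apply/orP; left.
  have : (2 : R) ^+ 1 <= 2 ^+ (d - m) by rewrite ler_weXn2l ?ler1n // subn_gt0.
  by rewrite expr1; lra.
move=> m; rewrite ltnS leq_eqVlt => /orP[/eqP ->|md].
  have H1 := Ha 1; rewrite ler01 lexx in H1; have {}H1 := H1 isT.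
  rewrite big_ord_recr /= expr1n mul1r in H1.
  have -> : a d = (\sum_(i < d) cR (1 ^+ i) * a i + a d) - \sum_(i < d) cR (1 ^+ i) * a i by ring.
  apply: le_trans (cmodB _ _) _; rewrite 2!mulrDl mul1r -addrA; apply: lerD => //.
  rewrite -[leLHS]addr0; apply: lerD; last by rewrite !mulr_ge0 // addr_ge0.
  apply: le_trans (cmod_sum _ _ _) _.
  rewrite (_ : _ * e = \sum_(i < d) C * (1 + 2 ^+ d) * e); last first.
    by rewrite sumr_const card_ord -[RHS]mulr_natl !mulrA.
  by apply: ler_sum => i _; rewrite expr1n mul1r; exact: low.
apply: le_trans (low m md) _; rewrite ler_wpM2r // lerDr addr_ge0 // mulr_ge0 // mulr_ge0 // addr_ge0 //.
Qed.

(** On the segment from 0 to [z] the sum is a polynomial in one variable with coefficients [p m z],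
    to which [coef_bound] applies. The hypothesis concerns the open ball, so [z] is taken of norm
    [rho / 2]; hence the factor 2. *)
Lemma hom_part_bound d : exists2 C : R, 0 <= C & forall (p : nat -> vec -> complex R) (e rho : R),
  (forall m, hom m (p m)) -> 0 < rho ->
  (forall y, `|y| < rho -> cmod (\sum_(m < d) p m y) <= e) ->
  forall m y, (m < d)%N -> cmod (p m y) <= C * e * (2 * rho^-1 * `|y|) ^+ m.
Proof.
have [C C0 HC] := coef_bound d; exists C => // p e rho hp rho0 Hp m y md.
have [->|y0] := eqVneq y 0.
  case: m md => [|m] md; last by rewrite (hom_at0 (hp m.+1)) cmod0 normr0 mulr0 expr0n mulr0.
  rewrite expr0 mulr1; apply: (HC (fun m => p m 0) e _ 0%N md) => t _.
  under eq_bigr => i _ do rewrite -hom_scale // scaler0.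
  by apply: Hp; rewrite normr0.
have ny0 : 0 < `|y| by rewrite normr_gt0.
pose z := (rho / 2 / `|y|) *: y.
have nz : `|z| = rho / 2 by rewrite normrZ ger0_norm ?divfK ?gt_eqF // !divr_ge0 ?ltW.
have -> : y = (2 * rho^-1 * `|y|) *: z.
  rewrite /z scalerA [X in X *: _](_ : _ = 1) ?scale1r //.
  by field; rewrite !gt_eqF.
rewrite (hom_scale _ _ (hp m)) cmodM cmod_real ger0_norm; last first.
  by rewrite exprn_ge0 // !mulr_ge0 // invr_ge0 ltW.
rewrite normrZ nz ger0_norm; last by rewrite !mulr_ge0 // invr_ge0 ltW.
rewrite [X in _ * X ^+ m](_ : _ = 2 * rho^-1 * `|y|); last by field; rewrite gt_eqF.
rewrite mulrC ler_wpM2r //; first by rewrite exprn_ge0 // !mulr_ge0 // invr_ge0 ltW.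
apply: (HC (fun m => p m z) e _ m md) => t /andP[t0 t1].
under eq_bigr => i _ do rewrite -hom_scale //.
apply: Hp; rewrite normrZ nz ger0_norm //.
apply: le_lt_trans (_ : _ <= rho / 2) _; last by rewrite ltr_pdivrMr // ltr_pMr // ltr1n.
by rewrite ler_piMl // divr_ge0 // ltW.
Qed.

(** Links the inductive forms to the monomials that define the oscillation. The degree bounds differ
    by one: [pol] counts degrees strictly below its index. *)
Lemma pol_is_polynomial k' P : is_polynomial k' P <-> pol k'.+1 P.
Proof.
have hmon (alpha : 'I_n -> nat) : hom (\sum_(i < n) alpha i) (fun y => cR (\prod_(i < n) y 0 i ^+ alpha i)).
  suff H (s : seq 'I_n) : hom (\sum_(i <- s) alpha i) (fun y => cR (\prod_(i <- s) y 0 i ^+ alpha i)) by exact: H.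
  elim: s => [|i s IH].
    rewrite big_nil (_ : (fun y => _) = fun=> 1); first exact: hom_cst.
    by apply/funext => y; rewrite big_nil.
  rewrite big_cons (_ : (fun y => _) = (fun y : vec => cR (y 0 i ^+ alpha i) * cR (\prod_(j <- s) y 0 j ^+ alpha j))); last first.
    by apply/funext => y; rewrite big_cons rmorphM.
  elim: (alpha i) => [|a IHa].
    rewrite (_ : (fun y => _) = (fun y : vec => cR (\prod_(j <- s) y 0 j ^+ alpha j))) //.
    by apply/funext => y; rewrite expr0 mul1r.
  rewrite addSn (_ : (fun y => _) = (fun y : vec => cR (y 0 i) * (cR (y 0 i ^+ a) * cR (\prod_(j <- s) y 0 j ^+ alpha j)))).
    exact: hom_coord.
  by apply/funext => y; rewrite exprS rmorphM /= mulrA.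
split=> [[c Hc]|[p [hp ->]]].
  rewrite (_ : P = fun y => \sum_(alpha : {ffun 'I_n -> 'I_k'.+1}) if (\sum_(i < n) alpha i <= k')%N
     then c alpha * cR (\prod_(i < n) y 0 i ^+ alpha i) else 0); last first.
    by apply/funext => y; rewrite Hc big_mkcond.
  apply: pol_sum => alpha; have [ak|ak] := leqP (\sum_(i < n) alpha i) k'; last exact: pol0.
  by apply: pol_hom (homZ _ (hmon _)) _; rewrite ltnS.
have ipD P1 P2 : is_polynomial k' P1 -> is_polynomial k' P2 -> is_polynomial k' (fun y => P1 y + P2 y).
  move=> [c1 H1] [c2 H2]; exists (fun a => c1 a + c2 a) => y.
  by rewrite H1 H2 -big_split; apply: eq_bigr => a _; rewrite mulrDl.
have ip0 : is_polynomial k' (fun _ : vec => 0).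
  by exists (fun=> 0) => y; rewrite big1 // => a _; rewrite mul0r.
(* The monomial with exponents [beta] collects the coordinates that the induction peels off the
   form. *)
suff ipm m q : hom m q -> forall beta : 'I_n -> nat, (m + \sum_(i < n) beta i <= k')%N ->
    is_polynomial k' (fun y => q y * cR (\prod_(i < n) y 0 i ^+ beta i)).
  have : forall m : 'I_k'.+1, is_polynomial k' (p m).
    move=> m; have := ipm m _ (hp m) (fun=> 0%N).
    rewrite sum_nat_const muln0 addn0 -ltnS ltn_ord => /(_ isT).
    by under eq_fun do rewrite big1 ?mulr1 //.
  elim: (index_enum _) => [|m s IH] Hm; first by under eq_fun do rewrite big_nil.
  by under eq_fun do rewrite big_cons; apply: ipD => //; exact: IH.
elim=> {m q} [m|c|m q1 q2 _ IH1 _ IH2|m i q _ IH] beta bk.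
- by under eq_fun do rewrite mul0r.
- have bk' i : (beta i < k'.+1)%N.
    by rewrite ltnS; apply: leq_trans bk; rewrite add0n (bigD1 i) //= leq_addr.
  pose b : {ffun 'I_n -> 'I_k'.+1} := [ffun i => Ordinal (bk' i)].
  have bE i : b i = beta i :> nat by rewrite ffunE.
  exists (fun a => if a == b then c else 0) => y; rewrite (bigD1 b) /=; last first.
    by under eq_bigr do rewrite bE.
  rewrite eqxx [X in _ + X]big1 ?addr0; last by move=> a /andP[_ /negPf ->]; rewrite mul0r.
  by under [in RHS]eq_bigr do rewrite bE.
- by under eq_fun do rewrite mulrDl; apply: ipD; [exact: IH1|exact: IH2].
- have := IH (fun j => (i == j) + beta j)%N.
  have s1 : (\sum_(j < n) (i == j) = 1)%N.
    by rewrite (bigD1 i) //= eqxx big1 // => j; rewrite eq_sym => /negPf ->.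
  rewrite big_split /= s1 addnA addn1 => /(_ bk); congr is_polynomial; apply/funext => y.
  have -> : \prod_j y 0 j ^+ ((i == j) + beta j) = y 0 i * \prod_j y 0 j ^+ beta j.
    under eq_bigr do rewrite exprD; rewrite big_split /=; congr (_ * _).
    rewrite (bigD1 i) //= eqxx big1 ?mulr1 // => j; rewrite eq_sym => /negPf ->.
    by rewrite expr0.
  by rewrite rmorphM /=; ring.
Qed.

End polynomials.

(** The derivative of the remainder is the remainder of one order less for [g 1], and the mean value
    theorem converts this into one more factor [|t|]. A constant without factorial is enough. *)
Lemma taylor1 (R : realType) (kappa : nat) (g : nat -> R -> R) (M rho : R) :
  (forall a, (a < kappa)%N -> forall x : R, is_derive x 1 (g a) (g a.+1 x)) ->
  (forall xi, `|xi| <= rho -> `|g kappa xi| <= M) ->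
  forall t, `|t| <= rho ->
  `|g 0%N t - \sum_(a < kappa) g a 0 * (t ^+ a / a`!%:R)| <= M * `|t| ^+ kappa.
Proof.
elim: kappa g => [|kappa IH] g dg gM t tr.
  by rewrite big_ord0 subr0 mulr1; exact: gM.
(* The term of degree [a + 1] in the expansion of [g 0]; its derivative is the term of degree [a] in
   the expansion of [g 1]. *)
pose m (a : nat) : R -> R := (g a.+1 0 / a.+1`!%:R) \*: (id ^+ a.+1 : R -> R).
pose r : R -> R := g 0%N - \sum_(a < kappa) m a.
pose r' xi := g 1%N xi - \sum_(a < kappa) g a.+1 0 * (xi ^+ a / a`!%:R).
have dr (x : R) : is_derive x (1 : R) r (r' x).
  apply: is_deriveB; first exact: dg.
  apply: is_derive_sum => a; apply: is_derive_eq.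
  rewrite /GRing.scale /= /m factS natrM.
  have : (a.+1%:R : R) != 0 by rewrite pnatr_eq0.
  have : (a`!%:R : R) != 0 by rewrite pnatr_eq0 -lt0n fact_gt0.
  by move=> ? ?; field; apply/andP.
have rE x : g 0%N x - \sum_(a < kappa.+1) g a 0 * (x ^+ a / a`!%:R) = r x - r 0.
  have mE a y : m a y = g a.+1 0 / a.+1`!%:R * y ^+ a.+1.
    by rewrite /m /= /GRing.scale /=; congr (_ * _); rewrite exprfctE.
  have rv y : r y = g 0%N y - \sum_(a < kappa) m a y.
    by rewrite /r /=; congr (_ - _); rewrite fct_sumE.
  rewrite !rv big_ord_recl expr0 fact0 divr1 mulr1 (_ : \sum_(a < kappa) m a 0 = 0); last first.
    by rewrite big1 // => a _; rewrite mE expr0n mulr0.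
  have -> : \sum_(a < kappa) m a x = \sum_(i < kappa) g (lift ord0 i) 0 * (x ^+ lift ord0 i / (lift ord0 i)`!%:R).
    by apply: eq_bigr => a _; rewrite mE /= mulrAC mulrA.
  by ring.
have Hr' xi : `|xi| <= rho -> `|r' xi| <= M * `|xi| ^+ kappa.
  by apply: (IH (fun a => g a.+1)) => // a ak x; exact: dg.
have cr : continuous r.
  by move=> x; apply: differentiable_continuous; apply/derivable1_diffP; have [] := dr x.
have cw a b : {within `[a, b], continuous r} by apply: continuous_subspaceT.
rewrite rE.
have M0 (xi : R) : `|xi| <= rho -> 0 <= M by move=> xr; exact: le_trans (normr_ge0 _) (gM _ xr).
have fin (xi : R) : `|xi| <= `|t| -> `|r' xi| * `|t| <= M * `|t| ^+ kappa.+1.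
  move=> xt; rewrite exprSr mulrA ler_wpM2r // (le_trans (Hr' _ (le_trans xt tr))) //.
  by rewrite ler_wpM2l ?(M0 t) // lerX_ge0.
have [t0|t0] := leP 0 t.
  have [c + ->] := MVT_segment t0 (fun x _ => dr x) (cw _ _).
  rewrite in_itv /= => /andP[c0 ct]; rewrite subr0 normrM; apply: fin.
  by rewrite !ger0_norm.
have [c + E] := MVT_segment (ltW t0) (fun x _ => dr x) (cw _ _).
rewrite in_itv /= => /andP[ct c0]; rewrite distrC E sub0r normrM normrN; apply: fin.
by rewrite !ler0_norm ?lerN2 // ltW.
Qed.

(** * Taylor expansions with rapidly decreasing coefficients *)

Section taylor.
Context (R : realType) (n : nat).
Local Notation vec := 'rV[R]_n.
Local Notation cR := (fun t : R => (t%:C)%C).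
Implicit Types (u h : vec) (T : vec -> vec -> complex R).

(* Taylor polynomials [T u] in [h] of degree less than [m], with coefficients rapidly decreasing
   in the base point [u]. *)
Inductive tay : nat -> (vec -> vec -> complex R) -> Prop :=
| tay_zero m : tay m (fun _ _ => 0)
| tay_cst m t : rapid t -> tay m.+1 (fun u _ => t u)
| tay_add m T1 T2 : tay m T1 -> tay m T2 -> tay m (fun u h => T1 u h + T2 u h)
| tay_coord m i T : tay m T -> tay m.+1 (fun u h => cR (h 0 i) * T u h).

Lemma rapidZ c (t : vec -> complex R) : rapid t -> rapid (fun u => c * t u).
Proof.
move=> rt K; have [C C0 HC] := rt K; exists (cmod c * C) => [|y].
  by rewrite mulr_ge0 // cmod_ge0.
by rewrite cmodM -mulrA ler_wpM2l // cmod_ge0.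
Qed.

Lemma tayZ m c T : tay m T -> tay m (fun u h => c * T u h).
Proof.
elim=> {m T} [m|m t rt|m T1 T2 _ IH1 _ IH2|m i T _ IH].
- rewrite (_ : (fun _ _ => _) = (fun _ _ => 0)); first exact: tay_zero.
  by apply/funext => u; apply/funext => h; rewrite mulr0.
- exact: (tay_cst m (rapidZ c rt)).
- rewrite (_ : (fun _ _ => _) = (fun u h => c * T1 u h + c * T2 u h)); first exact: tay_add.
  by apply/funext => u; apply/funext => h; rewrite mulrDr.
- rewrite (_ : (fun _ _ => _) = (fun u h => cR (h 0 i) * (c * T u h))); first exact: tay_coord.
  by apply/funext => u; apply/funext => h; rewrite mulrCA.
Qed.

Lemma tay_sum m I (s : seq I) (F : I -> vec -> vec -> complex R) :
  (forall i, tay m (F i)) -> tay m (fun u h => \sum_(i <- s) F i u h).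
Proof.
move=> H; elim: s => [|i s IH].
  rewrite (_ : (fun _ _ => _) = (fun _ _ => 0)); first exact: tay_zero.
  by apply/funext => u; apply/funext => h; rewrite big_nil.
rewrite (_ : (fun _ _ => _) = (fun u h => F i u h + \sum_(j <- s) F j u h)); first exact: tay_add.
by apply/funext => u; apply/funext => h; rewrite big_cons.
Qed.

Lemma tay_coordX m i a T : tay m T -> tay (a + m) (fun u h => cR (h 0 i ^+ a) * T u h).
Proof.
move=> hT; elim: a => [|a IH].
  rewrite (_ : (fun _ _ => _) = T) //.
  by apply/funext => u; apply/funext => h; rewrite expr0 mul1r.
rewrite addSn (_ : (fun _ _ => _) = (fun u h => cR (h 0 i) * (cR (h 0 i ^+ a) * T u h))).
  exact: tay_coord.
by apply/funext => u; apply/funext => h; rewrite exprS rmorphM mulrA.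
Qed.

Lemma rapid_near (t : vec -> complex R) (rho : R) K : rapid t -> 0 <= rho ->
  exists2 C : R, 0 <= C & forall u h, `|h| <= rho -> cmod (t (u + h)) <= C * (wt u)^-1 ^+ K.
Proof.
move=> /(_ K)[C C0 HC] rho0; exists (C * (1 + rho) ^+ K) => [|u h hr].
  by rewrite mulr_ge0 // exprn_ge0 // addr_ge0.
apply: le_trans (HC _) _; rewrite -mulrA ler_wpM2l // -exprMn lerX_ge0 //.
  by rewrite invr_ge0 wt_ge0.
rewrite ler_pdivlMr ?wt_gt0 // mulrC ler_pdivrMr ?wt_gt0 // mulrC.
rewrite -{1}(addrK h u); apply: le_trans (wtD _ _) _.
by rewrite wtN ler_wpM2l ?wt_ge0 // lerD2l.
Qed.

Definition restrict_dir (s : seq 'I_n) h : vec := \row_i (if i \in s then h 0 i else 0).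

Definition rapid_derivs (s : seq 'I_n) kappa (f : vec -> R) :=
  forall alpha : 'I_n -> nat, (\sum_(i <- s) alpha i <= kappa)%N ->
    rapid (fun x => cR (foldr (fun i g => iter (alpha i) (partial i) g) f s x)).

Lemma class_C_le k k' (f : vec -> R) : (k' <= k)%N -> class_C k f -> class_C k' f.
Proof.
elim: k k' f => [|k IH] [|k'] f //=; first by move=> _ [].
move=> kk' [cf Hf]; split => // i.
by have [df cdf] := Hf i; split => //; exact: IH cdf.
Qed.

Lemma class_C_iter a b i (f : vec -> R) : class_C (a + b) f -> class_C b (iter a (partial i) f).
Proof.
elim: a f => [|a IH] f // [_ Hf]; rewrite iterSr.
by have [_ /IH] := Hf i.
Qed.

Lemma eq_foldr_partial (s : seq 'I_n) (alpha beta : 'I_n -> nat) (f : vec -> R) :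
  {in s, alpha =1 beta} -> foldr (fun i g => iter (alpha i) (partial i) g) f s =
                           foldr (fun i g => iter (beta i) (partial i) g) f s.
Proof.
elim: s => //= i s IH H; rewrite H ?mem_head // IH // => j js.
by apply: H; rewrite in_cons js orbT.
Qed.

Lemma is_derive_line (f : vec -> R) i v (t : R) :
  derivable f (v + t *: delta_mx 0 i) (delta_mx 0 i) ->
  is_derive t 1 (fun t : R => f (v + t *: delta_mx 0 i)) (partial i f (v + t *: delta_mx 0 i)).
Proof.
have E : (fun h : R => h^-1 *: (f (v + (h *: (1 : R) + t) *: delta_mx 0 i) - f (v + t *: delta_mx 0 i))) =
         (fun h : R => h^-1 *: (f (h *: delta_mx 0 i + (v + t *: delta_mx 0 i)) - f (v + t *: delta_mx 0 i))).
  apply/funext => h; congr (_ *: (f _ - _)).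
  have -> : h *: (1 : R) = h by rewrite /GRing.scale /= mulr1.
  by rewrite scalerDl addrCA.
move=> df; split; first by move: df; rewrite /derivable /= -E.
by rewrite /partial /derive /= -E.
Qed.

Lemma restrict_dir_norm s h : `|restrict_dir s h| <= `|h|.
Proof.
apply/rV_norm_leP => // i; rewrite mxE; case: ifP => _; last by rewrite normr0.
exact: rV_coord_le.
Qed.

End taylor.

Section taylor_regular.
Context (R : realType) (n : nat).
Local Notation vec := 'rV[R]_n.
Local Notation cR := (fun t : R => (t%:C)%C).
Implicit Types (u h : vec) (T : vec -> vec -> complex R).
Variables (rho : R) (rho0 : 0 <= rho).

(* [mpartial] differentiates in the last coordinate first, so the directions are expanded
   from the last one to the first one. *)
Lemma taylor_dir (s : seq 'I_n) kappa (f : vec -> R) :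
  uniq s -> class_C kappa f -> rapid_derivs s kappa f ->
  exists2 T, tay kappa T & forall K, exists2 C : R, 0 <= C & forall u h, `|h| <= rho ->
    cmod (cR (f (u + restrict_dir s h)) - T u h) <= C * (wt u)^-1 ^+ K * `|h| ^+ kappa.
Proof.
elim/last_ind: s kappa f => [|s i IH] kappa f us cf df.
  have rf : rapid (fun x => cR (f x)).
    by have := df (fun=> 0%N); rewrite big_nil; exact.
  have r0 u h : u + restrict_dir [::] h = u.
    by apply/rowP => j; rewrite !mxE addr0.
  case: kappa cf df => [|kappa] cf df.
    exists (fun _ _ => 0); first exact: tay_zero.
    move=> K; have [C C0 HC] := rf K; exists C => // u h _.
    by rewrite r0 subr0 mulr1.
  exists (fun u _ => cR (f u)); first exact: tay_cst.
  by move=> K; exists 0 => // u h _; rewrite r0 subrr cmod0 !mul0r.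
move: us; rewrite rcons_uniq => /andP[si us].
pose fa a := iter a (partial i) f.
have cfa a : (a <= kappa)%N -> class_C (kappa - a) (fa a).
  by move=> ak; apply: class_C_iter; rewrite subnKC.
have foldE (alpha : 'I_n -> nat) a :
    foldr (fun j g => iter (if j == i then a else alpha j) (partial j) g) f (rcons s i) =
    foldr (fun j g => iter (alpha j) (partial j) g) (fa a) s.
  rewrite foldr_rcons eqxx; apply: eq_foldr_partial => j js.
  by case: eqVneq => // ji; move: si; rewrite -ji js.
have sumE (alpha : 'I_n -> nat) a :
    (\sum_(j <- rcons s i) (if j == i then a else alpha j) = \sum_(j <- s) alpha j + a)%N.
  rewrite -cats1 big_cat big_seq1 /= eqxx; congr (_ + _)%N.
  rewrite big_seq [RHS]big_seq; apply: eq_bigr => j js.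
  by case: eqVneq => // ji; move: si; rewrite -ji js.
have dfa a : (a <= kappa)%N -> rapid_derivs s (kappa - a) (fa a).
  move=> ak alpha Ha; rewrite -(foldE alpha a).
  by apply: (df (fun j => if j == i then a else alpha j)); rewrite sumE addnC -leq_subRL.
(* The coefficient of order [a] in direction [i] is a derivative with [kappa - a] orders of
   regularity left; it is expanded to that order in the remaining directions. *)
have /choice[T HT] : forall a : nat, exists T, (a < kappa)%N ->
    tay (kappa - a) T /\ forall K, exists2 C : R, 0 <= C & forall u h, `|h| <= rho ->
    cmod (cR (fa a (u + restrict_dir s h)) - T u h) <= C * (wt u)^-1 ^+ K * `|h| ^+ (kappa - a).
  move=> a; have [ka|ak] := leqP kappa a; first by exists (fun _ _ => 0).
  have [T hT H] := IH _ _ us (cfa a (ltnW ak)) (dfa a (ltnW ak)).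
  by exists T.
exists (fun u h => \sum_(a < kappa) cR (a`!%:R^-1) * (cR (h 0 i ^+ a) * T a u h)).
  apply: tay_sum => a; apply: tayZ; have [hT _] := HT a (ltn_ord a).
  by have := tay_coordX i a hT; rewrite subnKC // ltnW.
move=> K.
have /choice[Ca HCa] : forall a : nat, exists C : R, 0 <= C /\ ((a < kappa)%N -> forall u h, `|h| <= rho ->
    cmod (cR (fa a (u + restrict_dir s h)) - T a u h) <= C * (wt u)^-1 ^+ K * `|h| ^+ (kappa - a)).
  move=> a; have [ka|ak] := leqP kappa a; first by exists 0.
  by have [_ /(_ K)[C C0 HC]] := HT a ak; exists C.
have rfk : rapid (fun x => cR (fa kappa x)).
  have := df (fun j => if j == i then kappa else 0%N).
  rewrite (sumE (fun=> 0%N)) big1 // add0n leqnn => /(_ isT).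
  rewrite (foldE (fun=> 0%N)); congr (rapid _); apply/funext => x; congr (cR (_ x)).
  by elim: (s) => // j s' IHs /=.
have [C C0 HC] := rapid_near K rfk (addr_ge0 rho0 rho0).
exists (C + \sum_(a < kappa) Ca a) => [|u h hr].
  by rewrite addr_ge0 // sumr_ge0 // => a _; case: (HCa a).
pose v := u + restrict_dir s h.
pose g (a : nat) (xi : R) := fa a (v + xi *: delta_mx 0 i).
have hi : `|h 0 i| <= rho by apply: le_trans (rV_coord_le _ _) hr.
have dg a : (a < kappa)%N -> forall x : R, is_derive x (1 : R) (g a) (g a.+1 x).
  move=> ak x; apply: is_derive_line.
  by have := cfa a (ltnW ak); rewrite -(subnSK ak) => -[_ /(_ i)[]].
have gM (xi : R) : `|xi| <= rho -> `|g kappa xi| <= C * (wt u)^-1 ^+ K.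
  move=> xr; have := HC u (restrict_dir s h + xi *: delta_mx 0 i).
  rewrite cmod_real /g /v addrA; apply; apply: le_trans (ler_normD _ _) _.
  apply: lerD; first exact: le_trans (restrict_dir_norm _ _) hr.
  rewrite normrZ -[leRHS]mulr1; apply: ler_pM => //.
  apply/rV_norm_leP => // j; rewrite mxE eqxx /=.
  by case: eqP => _; rewrite ?normr1 ?normr0.
have H1 := taylor1 dg gM hi.
have hE : u + restrict_dir (rcons s i) h = v + h 0 i *: delta_mx 0 i.
  apply/rowP => j; rewrite !mxE eqxx mem_rcons in_cons -addrA; congr (_ + _).
  by case: eqVneq => [->|_] /=; rewrite ?(negPf si) ?mulr1 ?add0r // mulr0 addr0.
have g0 a : g a 0 = fa a v by rewrite /g scale0r addr0.
(* The remainder in the direction [i], plus the remainders of its coefficients in the other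
   directions. *)
have -> : cR (f (u + restrict_dir (rcons s i) h)) -
          \sum_(a < kappa) cR (a`!%:R^-1) * (cR (h 0 i ^+ a) * T a u h) =
   cR (g 0%N (h 0 i) - \sum_(a < kappa) g a 0 * (h 0 i ^+ a / a`!%:R)) +
   \sum_(a < kappa) cR (h 0 i ^+ a / a`!%:R) * (cR (fa a v) - T a u h).
  rewrite rmorphB rmorph_sum /= hE -[RHS]addrA; congr (_ + _).
  rewrite -sumrN -sumrN -big_split; apply: eq_bigr => a _ /=.
  by rewrite g0 !rmorphM /=; ring.
apply: le_trans (cmodD _ _) _; rewrite -mulrA mulrDl; apply: lerD.
  rewrite cmod_real; apply: le_trans H1 _; rewrite -mulrA ler_wpM2l // ler_wpM2l ?wtVX_ge0 //.
  by rewrite lerX_ge0 // rV_coord_le.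
apply: le_trans (cmod_sum _ _ _) _; rewrite mulr_suml; apply: ler_sum => a _.
have [Ca0 /(_ (ltn_ord a) u h hr) Ha] := HCa a.
rewrite cmodM cmod_real normrM.
have -> : Ca a * ((wt u)^-1 ^+ K * `|h| ^+ kappa) =
          `|h| ^+ a * (Ca a * (wt u)^-1 ^+ K * `|h| ^+ (kappa - a)).
  have -> : `|h| ^+ kappa = `|h| ^+ a * `|h| ^+ (kappa - a).
    by rewrite -exprD subnKC // ltnW.
  by ring.
apply: ler_pM => //; first exact: cmod_ge0.
rewrite -[leRHS]mulr1; apply: ler_pM => //.
  by rewrite normrX lerX_ge0 // rV_coord_le.
rewrite ger0_norm ?invr_ge0 // invf_le1 ?ler1n ?ltr0n ?fact_gt0 //.
Qed.

Lemma tay_complex kappa (phi : vec -> complex R) : k_regular kappa phi ->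
  exists2 T, tay kappa T & forall K, exists2 C : R, 0 <= C & forall u h, `|h| <= rho ->
    cmod (phi (u + h) - T u h) <= C * (wt u)^-1 ^+ K * `|h| ^+ kappa.
Proof.
move=> [cRe cIm decay].
have enorm_ge (x : vec) : wt x <= 1 + enorm x.
  rewrite lerD2l; apply/rV_norm_leP => [|i]; first exact: sqrtr_ge0.
  rewrite -sqrtr_sqr ler_sqrt; last by apply: sumr_ge0 => j _; exact: sqr_ge0.
  by rewrite (bigD1 i) //= lerDl sumr_ge0 // => j _; exact: sqr_ge0.
have rap alpha : (\sum_(i < n) alpha i <= kappa)%N -> rapid (cmpartial alpha phi).
  move=> Ha K; have [CK HK] := decay K; exists `|CK| => // y.
  apply: le_trans (HK y alpha Ha) _.
  apply: (@le_trans _ _ (`|CK| * (1 + enorm y) ^- K)).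
    by rewrite ler_wpM2r ?ler_norm // invr_ge0 exprn_ge0 // addr_ge0 // sqrtr_ge0.
  rewrite ler_wpM2l // -exprVn lerX_ge0 //.
    by rewrite invr_ge0 addr_ge0 // sqrtr_ge0.
  by rewrite lef_pV2 ?posrE ?wt_gt0 // ltr_pwDl // sqrtr_ge0.
have rapR (P : complex R -> R) : (forall z, `|P z| <= cmod z) -> class_C kappa (fun y => P (phi y)) ->
    (forall alpha y, P (cmpartial alpha phi y) = mpartial alpha (fun y => P (phi y)) y) ->
    exists2 T, tay kappa T & forall K, exists2 C : R, 0 <= C & forall u h, `|h| <= rho ->
    cmod (cR (P (phi (u + h))) - T u h) <= C * (wt u)^-1 ^+ K * `|h| ^+ kappa.
  move=> Pn cP PE; have := taylor_dir (enum_uniq 'I_n) cP _.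
  case=> [alpha|T hT H].
    rewrite big_enum /= => /rap ra K; have [C C0 HC] := ra K; exists C => // y.
    apply: le_trans (HC y); rewrite cmod_real.
    by have := Pn (cmpartial alpha phi y); rewrite PE.
  exists T => // K; have [C C0 HC] := H K; exists C => // u h /(HC u h).
  rewrite (_ : restrict_dir _ _ = h) //.
  by apply/rowP => i; rewrite mxE mem_enum.
have [T1 hT1 H1] := rapR _ (@Re_le_cmod R) cRe (fun alpha y => erefl).
have [T2 hT2 H2] := rapR _ (@Im_le_cmod R) cIm (fun alpha y => erefl).
exists (fun u h => T1 u h + 'i%C * T2 u h); first by apply: tay_add => //; exact: tayZ.
move=> K; have [C1 C10 {}H1] := H1 K; have [C2 C20 {}H2] := H2 K.
exists (C1 + C2) => [|u h hr]; first exact: addr_ge0.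
have -> : phi (u + h) - (T1 u h + 'i%C * T2 u h) =
  (cR (Re (phi (u + h))) - T1 u h) + 'i%C * (cR (Im (phi (u + h))) - T2 u h).
  rewrite {1}[phi (u + h)]complexE; ring.
apply: le_trans (cmodD _ _) _; rewrite !mulrDl; apply: lerD; first exact: H1.
by rewrite cmodM cmodE /= expr0n expr1n add0r sqrtr1 mul1r; exact: H2.
Qed.

End taylor_regular.

Section regular_functions.
Context (R : realType) (n : nat).
Local Notation vec := 'rV[R]_n.
Local Notation cR := (fun t : R => (t%:C)%C).
Implicit Types (u h : vec) (phi : vec -> complex R).

Lemma k_regular_le k k' phi : (k' <= k)%N -> k_regular k phi -> k_regular k' phi.
Proof.
move=> kk' [c1 c2 H]; split; [exact: class_C_le c1|exact: class_C_le c2|].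
move=> K; have [CK HK] := H K; exists CK => x alpha ak; apply: HK; exact: leq_trans kk'.
Qed.

Lemma k_regular_cmeas k phi : k_regular k phi -> cmeas phi.
Proof.
move=> /(k_regular_le (leq0n k))[c1 c2 _].
by split; exact: continuous_measurable_rV.
Qed.

Lemma enorm_ge (x : vec) : `|x| <= enorm x.
Proof.
apply/rV_norm_leP => [|i]; first exact: sqrtr_ge0.
rewrite -sqrtr_sqr ler_sqrt; last by apply: sumr_ge0 => j _; exact: sqr_ge0.
by rewrite (bigD1 i) //= lerDl sumr_ge0 // => j _; exact: sqr_ge0.
Qed.

Lemma enorm_le (x : vec) : enorm x <= n%:R * `|x|.
Proof.
rewrite -[leRHS]ger0_norm ?mulr_ge0 // -sqrtr_sqr ler_sqrt ?sqr_ge0 //.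
apply: (@le_trans _ _ (\sum_(i < n) `|x| ^+ 2)).
  by apply: ler_sum => i _; rewrite -real_normK ?num_real // lerX_ge0 // rV_coord_le.
rewrite sumr_const card_ord -[leLHS]mulr_natl exprMn ler_wpM2r ?sqr_ge0 //.
by rewrite -natrX ler_nat; case: n => // m; rewrite expnS leq_pmulr ?expn_gt0.
Qed.

Lemma k_regular_rapid k phi : k_regular k phi -> rapid phi.
Proof.
move=> /(k_regular_le (leq0n k))[_ _ H] K; have [CK HK] := H K; exists `|CK| => // y.
have := HK y (fun=> 0%N); rewrite big1 // => /(_ isT).
have -> : cmpartial (fun=> 0%N) phi y = phi y.
  have E (f : vec -> R) : mpartial (fun=> 0%N) f = f by rewrite /mpartial; elim: (enum _).
  by rewrite /cmpartial !E; case: (phi y).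
move/le_trans; apply; apply: (@le_trans _ _ (`|CK| * (1 + enorm y) ^- K)).
  by rewrite ler_wpM2r ?ler_norm // invr_ge0 exprn_ge0 // addr_ge0 // sqrtr_ge0.
rewrite ler_wpM2l // -exprVn lerX_ge0 //.
  by rewrite invr_ge0 addr_ge0 // sqrtr_ge0.
by rewrite lef_pV2 ?posrE ?wt_gt0 ?lerD2l ?enorm_ge // ltr_pwDl // sqrtr_ge0.
Qed.

End regular_functions.

Section synth_taylor.
Context (R : realType) (n N : nat).
Hypothesis n_gt0 : (0 < n)%N.
Local Notation lattice := 'rV[int]_n.
Local Notation vec := 'rV[R]_n.
Local Notation cR := (fun t : R => (t%:C)%C).
Implicit Types (u h : vec) (T : vec -> vec -> complex R).

(** The coordinates of [h] factor out of the lattice sum, which leaves series of rapidly decreasing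
    functions of [u - nu] against coefficients of polynomial growth. *)
Lemma tay_csum kappa T (a : lattice -> complex R) E (Y : R) u : tay kappa T -> 0 <= Y ->
  (forall nu, cmod (a nu) <= Y * wt (zvec R nu - u) ^+ E) ->
  (forall h, csummable (fun nu => a nu * T (u - zvec R nu) h)) /\
  pol kappa (fun h => csum (fun nu => a nu * T (u - zvec R nu) h)).
Proof.
move=> hT Y0 Ha; elim: hT => {kappa T} [m|m t rt|m T1 T2 _ [s1 p1] _ [s2 p2]|m i T _ [s p]].
- have E0 h : (fun nu : lattice => a nu * (0 : complex R)) = (fun=> 0).
    by apply/funext => nu; rewrite mulr0.
  split=> [h|]; first by rewrite E0 //; apply: (@csummable_le _ _ _ 0); rewrite esum1 // => nu _; rewrite cmod0.
  under eq_fun do rewrite E0 // csum0 //; exact: pol0.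
- have [C C0 HC] := esum_growth_le E rt; split=> [h|]; first exact: csummable_le (HC a u Y u Y0 Ha).
  by apply: (pol_hom (m := 0)) => //; exact: hom_cst.
- have E0 h : (fun nu => a nu * (T1 (u - zvec R nu) h + T2 (u - zvec R nu) h)) =
             (fun nu => a nu * T1 (u - zvec R nu) h + a nu * T2 (u - zvec R nu) h).
    by apply/funext => nu; rewrite mulrDr.
  split=> [h|]; first by rewrite E0; exact: csummableD.
  rewrite (_ : (fun h => _) = (fun h => csum (fun nu => a nu * T1 (u - zvec R nu) h) +
                                        csum (fun nu => a nu * T2 (u - zvec R nu) h))).
    exact: polD.
  by apply/funext => h; rewrite E0 csumD.
- have E0 h : (fun nu => a nu * (cR (h 0 i) * T (u - zvec R nu) h)) =
             (fun nu => cR (h 0 i) * (a nu * T (u - zvec R nu) h)).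
    by apply/funext => nu; rewrite mulrCA.
  split=> [h|]; first by rewrite E0; exact: csummableZ.
  rewrite (_ : (fun h => _) = (fun h => cR (h 0 i) * csum (fun nu => a nu * T (u - zvec R nu) h))).
    exact: pol_coord.
  by apply/funext => h; rewrite E0 csumZ.
Qed.

Variables (phi : 'I_N -> vec -> complex R) (kappa : nat) (rho : R).
Hypothesis rho0 : 0 <= rho.
Hypothesis reg : forall j, k_regular kappa (phi j).

(** The growth of the coefficients is measured from the base point [u], where the decay of the
    Taylor remainders in [u - nu] cancels it. Hence one constant serves all base points, including
    those that go to infinity under dilation. *)
Lemma synth_taylor E : exists2 C : R, 0 <= C & forall a u (Y : R), 0 <= Y ->
  (forall j nu, cmod (a j nu) <= Y * wt (zvec R nu - u) ^+ E) ->
  exists2 P, pol kappa P & forall h, `|h| <= rho ->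
    cmod (synth phi a (u + h) - P h) <= C * Y * `|h| ^+ kappa.
Proof.
have /choice[T HT] : forall j, exists T, tay kappa T /\ forall K, exists2 C : R, 0 <= C &
    forall u h, `|h| <= rho ->
    cmod (phi j (u + h) - T u h) <= C * (wt u)^-1 ^+ K * `|h| ^+ kappa.
  by move=> j; have [T h1 h2] := tay_complex rho0 (reg j); exists T.
have [C C0 HC] : exists2 C : R, 0 <= C & forall j u h, `|h| <= rho ->
    cmod (phi j (u + h) - T j u h) <= C * (wt u)^-1 ^+ (E + 2 * n) * `|h| ^+ kappa.
  apply: (@finite_uniform R N (fun j C => forall u h, `|h| <= rho ->
    cmod (phi j (u + h) - T j u h) <= C * (wt u)^-1 ^+ (E + 2 * n) * `|h| ^+ kappa)).
    move=> j C C' CC' HC u h hr; apply: le_trans (HC u h hr) _.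
    by rewrite ler_wpM2r ?exprn_ge0 // ler_wpM2r // wtVX_ge0.
  by move=> j; have [_ H] := HT j; exact: H.
exists (2 * C * wt_sum R n * N%:R) => [|a u Y Y0 Ha].
  apply: mulr_ge0 => //; apply: mulr_ge0; last exact: wt_sum_ge0.
  exact: mulr_ge0.
exists (fun h => \sum_j csum (fun nu => a j nu * T j (u - zvec R nu) h)).
  by apply: pol_sum => j; have [hT _] := HT j; exact: (tay_csum hT Y0 (Ha j)).2.
move=> h hr; rewrite /synth -sumrB; apply: le_trans (cmod_sum _ _ _) _.
rewrite (_ : _ * `|h| ^+ kappa = \sum_(j < N) 2 * (C * Y * `|h| ^+ kappa * wt_sum R n)); last first.
  by rewrite sumr_const card_ord -[RHS]mulr_natl; ring.
apply: ler_sum => j _.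
have [hT _] := HT j.
have sT := (tay_csum hT Y0 (Ha j)).1 h.
have [D _ HD] := esum_growth_le E (k_regular_rapid (reg j)).
pose Z := Y * wt h ^+ E.
have Z0 : 0 <= Z by rewrite mulr_ge0 // wtX_ge0.
have sphi : csummable (fun nu => a j nu * phi j (u + h - zvec R nu)).
  apply: csummable_le (HD (a j) u Y (u + h) Y0 (Ha j)).
rewrite -csumB //; apply: cmod_csum_le => //.
apply: (esum_wt_le (u := u)) => [|nu]; first by rewrite !mulr_ge0 // exprn_ge0.
rewrite -mulrBr cmodM addrAC.
apply: le_trans (ler_pM _ _ (Ha j nu) (HC j (u - zvec R nu) h hr)) _; rewrite ?cmod_ge0 //.
rewrite exprD [leLHS](_ : _ = C * Y * `|h| ^+ kappa * (wt (u - zvec R nu))^-1 ^+ (2 * n) *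
  ((wt (u - zvec R nu))^-1 ^+ E * wt (zvec R nu - u) ^+ E)); last by ring.
by rewrite (wtBC (zvec R nu)) wtVXK mulr1.
Qed.

End synth_taylor.

(** * Polynomial reproduction *)

Section top_part.
Context (R : realType) (n : nat).
Local Notation vec := 'rV[R]_n.
Implicit Types (u h v x : vec).

Lemma pol_top d (P : vec -> complex R) : pol d.+1 P ->
  exists p B, [/\ hom d p, pol d B & forall y, P y = p y + B y].
Proof.
move=> [p [hp ->]]; exists (p d), (fun y => \sum_(m < d) p m y); split => //.
  by exists p.
by move=> y; rewrite big_ord_recr addrC.
Qed.

Lemma top_bound d : exists2 C : R, 0 <= C & forall (p B : vec -> complex R) (e rho : R),
  hom d p -> pol d B -> 0 < rho -> (forall h, `|h| < rho -> cmod (p h + B h) <= e) ->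
  forall v, cmod (p v) <= C * e * (2 * rho^-1 * `|v|) ^+ d.
Proof.
have [C C0 HC] := @hom_part_bound R n d.+1; exists C => // p B e rho hp [b [hb ->]] rho0 H v.
pose w m := if m == d then p else b m.
have := HC w e rho _ rho0 _ d v (ltnSn d); rewrite {3}/w eqxx; apply.
  by move=> m; rewrite /w; case: eqVneq => [->|].
move=> h hr; rewrite big_ord_recr /= {2}/w eqxx addrC (eq_bigr (fun m : 'I_d => b m h)); first exact: H.
by move=> m _; rewrite /w ltn_eqF.
Qed.

Lemma hom0_cst (p : vec -> complex R) : hom 0 p -> forall y, p y = p 0.
Proof. by move=> hp y; rewrite -(scale0r y) (hom_scale 0 y hp) expr0 mul1r. Qed.

Lemma pol_tempered d (P : vec -> complex R) : pol d P -> tempered P.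
Proof.
move=> hP; split; first exact: pol_cmeas hP.
by have [C C0 HC] := pol_bound hP; exists d, C; split => //; exact: nearW.
Qed.

Lemma geometric_eq0 (a K : R) (lam r : nat) : (1 < lam)%N -> 0 <= a ->
  (forall l, (r <= l)%N -> a <= K * lam%:R ^- l) -> a = 0.
Proof.
move=> lam1 a0 H; apply/eqP; rewrite eq_le a0 andbT leNgt; apply/negP => ap.
pose l := maxn r (Num.bound (`|K| / a)).
have : a * lam%:R ^+ l <= `|K|.
  rewrite -ler_pdivlMr ?exprn_gt0 ?ltr0n ?(ltn_trans _ lam1) //.
  by apply: le_trans (H l (leq_maxl _ _)) _; rewrite ler_wpM2r ?ler_norm // invr_ge0 exprn_ge0.
apply/negP; rewrite -ltNge mulrC -ltr_pdivrMr //.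
apply: lt_le_trans (archi_boundP _) _; first by rewrite divr_ge0.
rewrite -natrX ler_nat; apply: leq_trans (leq_maxr r _) _.
by rewrite ltnW // ltn_expl.
Qed.

End top_part.

Section reproduction.
Context (R : realType) (n N : nat).
Hypothesis n_gt0 : (0 < n)%N.
Hypothesis N_gt0 : (0 < N)%N.
Local Notation lattice := 'rV[int]_n.
Local Notation vec := 'rV[R]_n.
Local Notation mu := (lebesgue_rV R n).
Variables (phi psi : 'I_N -> vec -> complex R) (k lam : nat).
Hypothesis reg : forall j, k_regular k (phi j).
Hypothesis mpsi : forall j, cmeas (psi j).
Hypothesis rpsi : forall j, rapid (psi j).
Hypothesis biorth : forall j k (eta nu : lattice),
  cint mu (fun y => phi j (y - zvec R eta) * conjc (psi k (y - zvec R nu))) =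
  ((eta == nu) && (j == k))%:R.
Hypothesis lam_gt1 : (1 < lam)%N.
Hypothesis refi : refinable lam phi.
Implicit Types (F G H : vec -> complex R) (nu : lattice) (u h x : vec).
Local Notation proj := (proj phi psi).
Local Notation spanV := (spanV phi).
Let mphi j := k_regular_cmeas (reg j).
Let rphi j := k_regular_rapid (reg j).

Let lam_gt0 : 0 < (lam%:R : R). Proof. by rewrite ltr0n ltnW. Qed.
Let lamV_gt0 l : 0 < (lam%:R : R) ^- l. Proof. by rewrite invr_gt0 exprn_gt0. Qed.
Let lamV_le1 l : (lam%:R : R) ^- l <= 1.
Proof. by rewrite invf_le1 ?exprn_gt0 // exprn_ege1 // ler1n ltnW. Qed.

Lemma spanV_growth F : spanV F -> exists E, exists2 Y : R, 0 <= Y &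
  forall x, cmod (F x) <= Y * wt x ^+ E.
Proof.
move=> [a [E [Y Y0 [Ha ->]]]]; have [C C0 HC] := synth_growth n_gt0 rphi E.
exists E, (C * Y) => [|x]; first exact: mulr_ge0.
by have := (HC a 0 Y x Y0 _).2; rewrite subr0; apply => j nu; rewrite subr0.
Qed.

Lemma spanV_taylor d F (rho : R) : (d <= k)%N -> 0 <= rho -> spanV F ->
  exists2 C : R, 0 <= C & forall u, `|u| <= rho ->
  exists2 P, pol d P & forall h, `|h| <= 1 -> cmod (F (u + h) - P h) <= C * `|h| ^+ d.
Proof.
move=> dk rho0 [a [E [Y Y0 [Ha ->]]]].
have [C C0 HC] := synth_taylor n_gt0 (@ler01 R) (fun j => k_regular_le dk (reg j)) E.
exists (C * (Y * (1 + rho) ^+ E)) => [|u ur]; first by rewrite !mulr_ge0 // exprn_ge0 // addr_ge0.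
apply: HC => [|j nu]; first by rewrite mulr_ge0 // exprn_ge0 // addr_ge0.
apply: le_trans (Ha j nu) _; rewrite -mulrA ler_wpM2l //.
have := wtX_triangle E (zvec R nu) u 0; rewrite !subr0 => /le_trans; apply.
by rewrite mulrC ler_wpM2r ?wtX_ge0 // lerX_ge0 ?wt_ge0 // /wt lerD2l.
Qed.

Lemma spanV_lipschitz F (rho : R) : (0 < k)%N -> 0 <= rho -> spanV F ->
  exists2 C : R, 0 <= C & forall u h, `|u| <= rho -> `|h| <= 1 ->
  cmod (F (u + h) - F u) <= C * `|h|.
Proof.
move=> k0 rho0 sF; have [C C0 HC] := spanV_taylor k0 rho0 sF.
exists C => // u h ur h1; have [P hP H] := HC u ur.
have P0 : F u = P 0.
  have := H 0; rewrite normr0 ler01 expr1 mulr0 addr0 => /(_ isT).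
  by move=> le0; apply/subr0_eq/cmod_eq0/eqP; rewrite eq_le le0 cmod_ge0.
have [p [B [hp [b [hb ->]] PE]]] := pol_top hP.
have := H h h1; rewrite P0 !PE expr1 (hom0_cst hp h) !big_ord0 //.
Qed.

Lemma lattice_scale r l (p : lattice) : (r <= l)%N ->
  (lam%:R ^+ l : R) *: (lam%:R ^- r *: zvec R p) = zvec R (p *+ lam ^ (l - r)).
Proof.
move=> rl; rewrite scalerA; apply/rowP => i; rewrite !mxE mulmxnE rmorphMn /= -[RHS]mulr_natl.
congr (_ * _); rewrite -{1}(subnK rl) exprD mulfK ?natrX //.
by rewrite expf_neq0 // gt_eqF.
Qed.

(** With [t = lam^-l], the rescaled remainder [Rl] is [O(t^(d+1))] with a polynomial weight. Since
    [Rl] is [Fl], fixed by [proj], minus [t^d p] and lower degrees, [t^d (p - proj p)] is of the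
    same order; dividing by [t^d] and letting [l] grow gives equality. *)
Lemma proj_top d F (x : vec) r (p0 : lattice) (p B : vec -> complex R) (C : R) :
  (forall Q, pol d Q -> proj Q = Q) -> spanV F -> x = lam%:R ^- r *: zvec R p0 -> 0 <= C ->
  hom d p -> pol d B ->
  (forall h, `|h| <= 1 -> cmod (F (x + h) - (p h + B h)) <= C * `|h| ^+ d.+1) ->
  proj p = p.
Proof.
move=> IH sF xE C0 hp hB HC.
have hPB : pol d.+1 (fun h => p h + B h).
  by apply: polD; [exact: pol_hom hp _|exact: pol_le hB].
have [E [Y Y0 HY]] := spanV_growth sF; have [CT CT0 HT] := pol_bound hPB.
pose D := C + Y * wt x ^+ E + CT; pose E1 := (E + d.+1)%N.
have D0 : 0 <= D by rewrite !addr_ge0 // mulr_ge0 // wtX_ge0.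
(* The Taylor estimate covers the unit ball; outside it, the polynomial growth of [F] and of its
   expansion suffices because [|h| > 1]. *)
have glob h : cmod (F (x + h) - (p h + B h)) <= D * (`|h| ^+ d.+1 * wt h ^+ E1).
  have wE a b : (a <= b)%N -> wt h ^+ a <= wt h ^+ b by move=> ab; rewrite ler_weXn2l ?wt_ge1.
  have [h1|h1] := leP `|h| 1.
    apply: le_trans (HC h h1) _; apply: ler_pM => //.
      by rewrite /D -addrA lerDl addr_ge0 // mulr_ge0 // wtX_ge0.
    by rewrite ler_peMr ?exprn_ge0 // (wE 0%N).
  apply: le_trans (cmodB _ _) _; apply: (@le_trans _ _ (D * wt h ^+ E1)); last first.
    by rewrite ler_wpM2l // ler_peMl ?wtX_ge0 // exprn_ege1 // ltW.
  rewrite /D -addrA !mulrDl -[leLHS]add0r; apply: lerD; first by rewrite mulr_ge0 // wtX_ge0.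
  apply: lerD; last by apply: le_trans (HT h) _; rewrite ler_wpM2l // wE // leq_addl.
  apply: le_trans (HY _) _; rewrite -mulrA ler_wpM2l //.
  apply: (@le_trans _ _ (wt x ^+ E * wt h ^+ E)); first by rewrite -exprMn lerX_ge0 ?wt_ge0 // wtD.
  by rewrite ler_wpM2l ?wtX_ge0 // wE // leq_addr.
have [C' C'0 HC'] := proj_growth n_gt0 rphi mpsi rpsi (d.+1 + E1).
apply/funext => u; apply/esym/subr0_eq/cmod_eq0.
apply: (@geometric_eq0 _ _ ((C' + 1) * D * wt u ^+ (d.+1 + E1)) lam r) => // [|l rl].
  exact: cmod_ge0.
pose t : R := lam%:R ^- l; have t0 : 0 < t := lamV_gt0 l; have t1 : t <= 1 := lamV_le1 l.
pose Fl u := F (x + t *: u); pose Ql u := B (t *: u).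
pose Rl u := Fl u - (((t ^+ d)%:C)%C * p u + Ql u).
(* For [l >= r] the vector [lam^l x] is in the lattice, so [Fl] is an integer translate of a dilate
   of [F]. *)
have sFl : spanV Fl.
  have := spanV_shift n_gt0 mphi rphi mpsi rpsi biorth (p0 *+ lam ^ (l - r))
    (spanV_dilateX n_gt0 mphi rphi mpsi rpsi biorth lam_gt1 refi l sF).
  congr (spanV _); apply/funext => y; rewrite /Fl -lattice_scale // xE scalerDr addrC; congr (F (_ + _)).
  by rewrite !scalerA mulVf ?mul1r // gt_eqF // exprn_gt0.
have hQl : pol d Ql by exact: pol_scale.
have tp : tempered p by exact: (pol_tempered (pol_hom hp (ltnSn d))).
have tFl : tempered Fl by exact: spanV_tempered sFl.
have tT : tempered (fun u => ((t ^+ d)%:C)%C * p u + Ql u).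
  by apply: temperedD; [exact: temperedZ|exact: pol_tempered hQl].
have E0 : proj Rl u - Rl u = ((t ^+ d)%:C)%C * (p u - proj p u).
  rewrite /Rl projB // projD //; [|exact: temperedZ|exact: pol_tempered hQl].
  rewrite projZ // (IH _ hQl) (proj_spanV n_gt0 mphi rphi mpsi rpsi biorth sFl).
  by ring.
have Rlb y : cmod (Rl y) <= D * t ^+ d.+1 * wt y ^+ (d.+1 + E1).
  rewrite /Rl -(hom_scale t y hp) /Fl; apply: le_trans (glob (t *: y)) _.
  rewrite -mulrA ler_wpM2l // normrZ (ger0_norm (ltW t0)) exprMn -mulrA.
  rewrite ler_wpM2l ?exprn_ge0 ?(ltW t0) // exprD; apply: ler_pM; rewrite ?exprn_ge0 ?wt_ge0 //.
    by rewrite lerX_ge0 // /wt lerDr.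
  by rewrite lerX_ge0 ?wt_ge0 // /wt lerD2l normrZ ger0_norm ?(ltW t0) // ler_piMl.
have Y1 : 0 <= D * t ^+ d.+1 by rewrite mulr_ge0 // exprn_ge0 // ltW.
have := HC' Rl 0 (D * t ^+ d.+1) u Y1.
rewrite subr0 => H1; have {}H1 : cmod (proj Rl u) <= C' * (D * t ^+ d.+1) * wt u ^+ (d.+1 + E1).
  by apply: H1; split; [exact: (temperedB tFl tT).1|apply/nearW => y; rewrite subr0].
have : t ^+ d * cmod (p u - proj p u) <= t ^+ d * ((C' + 1) * D * wt u ^+ (d.+1 + E1) * t).
  rewrite -[X in X * cmod _](ger0_norm (exprn_ge0 d (ltW t0))) -cmod_real -cmodM -E0.
  apply: le_trans (cmodB _ _) _; apply: le_trans (lerD H1 (Rlb u)) _.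
  by rewrite exprS le_eqVlt; apply/orP; left; apply/eqP; ring.
by rewrite ler_pM2l // exprn_gt0.
Qed.

End reproduction.

(** * Averaging over a grid of the torus *)

Section grid.
Context (R : realType) (n : nat).
Local Notation lattice := 'rV[int]_n.
Local Notation vec := 'rV[R]_n.
Implicit Types (u h x y : vec) (nu p : lattice).

Lemma lattice_round (M : R) y : 0 < M ->
  exists p : lattice, exists2 h, y = M^-1 *: zvec R p + h & `|h| <= M^-1.
Proof.
move=> M0; pose p : lattice := \row_i Num.floor (M * y 0 i).
exists p, (y - M^-1 *: zvec R p); first by rewrite addrC subrK.
apply/rV_norm_leP => [|i]; first by rewrite invr_ge0 ltW.
rewrite !mxE -{1}[y 0 i](mulKf (lt0r_neq0 M0)) -mulrBr normrM gtr0_norm ?invr_gt0 //.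
rewrite -[leRHS]mulr1 ler_wpM2l ?invr_ge0 ?(ltW M0) // ger0_norm ?subr_ge0 ?ge_floor //.
by rewrite lerBlDl ltW // addrC -intr1D addrC floorD1_gt.
Qed.

Variable m : nat.
Definition grid_point (g : 'rV['I_m.+1]_n) : vec := \row_i ((g 0 i)%:R / m.+1%:R).

Lemma grid_point_le g : `|grid_point g| <= 1.
Proof.
apply/rV_norm_leP => // i; rewrite mxE ger0_norm ?divr_ge0 // ler_pdivrMr ?ltr0n // mul1r.
by rewrite ler_nat ltnW.
Qed.

(** Translation by a vector of the grid permutes its points modulo the lattice, and [e] is
    periodic. *)
Lemma sum_grid_shift (e : vec -> complex R) p h :
  (forall x nu, e (x + zvec R nu) = e x) ->
  \sum_g e (grid_point g + (m.+1%:R^-1 *: zvec R p + h)) = \sum_g e (grid_point g + h).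
Proof.
move=> per; pose M : int := m.+1.
have M0 : M != 0 by [].
have pM (i : 'I_n) : (`|(p ord0 i %% M)%Z| < m.+1)%N.
  by rewrite -ltz_nat gez0_abs ?modz_ge0 // ltz_pmod.
(* Euclidean division by [m.+1]: the residue [b] of [p] permutes the indices, while the quotients
   and the carries form the lattice vector [eta]. *)
pose b : 'rV['I_m.+1]_n := \row_i Ordinal (pM i).
rewrite [RHS](reindex_inj (addIr b)); apply: eq_bigr => g _.
pose eta : lattice := \row_i ((((g ord0 i + b ord0 i) %/ m.+1)%N : int) + (p ord0 i %/ M)%Z).
rewrite -[RHS](per _ eta); congr (e _); rewrite addrA [RHS]addrAC; congr (_ + _).
apply/rowP => i; rewrite !mxE /=.
have HM : (m.+1%:R : R) != 0 by rewrite pnatr_eq0.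
apply: (mulIf HM); rewrite !mulrDl !divfK // mulrAC mulVf // mul1r.
have Eb : (p 0 i)%:~R = (`|(p ord0 i %% M)%Z|)%:R + (p ord0 i %/ M)%Z%:~R * (m.+1%:R : R).
  rewrite [in LHS](divz_eq (p 0 i) M) intrD intrM addrC; congr (_ + _).
  by rewrite -[in LHS](gez0_abs (modz_ge0 (p 0 i) M0)).
rewrite Eb addrA -natrD intrD mulrDl.
rewrite [in LHS](divn_eq (g ord0 i + `|(p ord0 i %% M)%Z|) m.+1) natrD natrM.
by rewrite [X in X + _]addrC addrA.
Qed.

End grid.

Lemma hom_lipschitz (R : realType) (n : nat) d (q : 'rV[R]_n -> complex R) : hom d q ->
  exists2 C : R, 0 <= C & forall x h, `|x| <= 1 -> `|h| <= 1 -> cmod (q (x + h) - q x) <= C * `|h|.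
Proof.
elim=> {d q} [m|c|m p q _ [C C0 IHp] _ [D D0 IHq]|m i p hp [C C0 IH]].
- by exists 0 => // x h _ _; rewrite subrr cmod0 mul0r.
- by exists 0 => // x h _ _; rewrite subrr cmod0 mul0r.
- exists (C + D) => [|x h x1 h1]; first exact: addr_ge0.
  rewrite opprD addrACA mulrDl; apply: le_trans (cmodD _ _) _.
  by apply: lerD; [exact: IHp|exact: IHq].
have [D D0 HD] := hom_bound hp.
exists (C + D * 2 ^+ m) => [|x h x1 h1]; first by rewrite addr_ge0 // mulr_ge0 // exprn_ge0.
rewrite mxE rmorphD /=.
have -> : ((x 0 i)%:C + (h 0 i)%:C)%C * p (x + h) - ((x 0 i)%:C)%C * p x =
          ((x 0 i)%:C)%C * (p (x + h) - p x) + ((h 0 i)%:C)%C * p (x + h) by ring.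
apply: le_trans (cmodD _ _) _; rewrite mulrDl; apply: lerD; rewrite cmodM cmod_real.
  rewrite -[leRHS]mul1r; apply: ler_pM; rewrite ?cmod_ge0 //; last exact: IH.
  by apply: le_trans x1; exact: rV_coord_le.
rewrite mulrC; apply: ler_pM; rewrite ?cmod_ge0 //; last exact: rV_coord_le.
apply: le_trans (HD _) _; rewrite ler_wpM2l // lerX_ge0 //.
by apply: le_trans (ler_normD _ _) _; rewrite -[2]/(1 + 1); exact: lerD.
Qed.

Section reproduction_induction.
Context (R : realType) (n N : nat).
Hypothesis n_gt0 : (0 < n)%N.
Hypothesis N_gt0 : (0 < N)%N.
Local Notation lattice := 'rV[int]_n.
Local Notation vec := 'rV[R]_n.
Local Notation mu := (lebesgue_rV R n).
Variables (phi psi : 'I_N -> vec -> complex R) (k lam : nat).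
Hypothesis reg : forall j, k_regular k (phi j).
Hypothesis mpsi : forall j, cmeas (psi j).
Hypothesis rpsi : forall j, rapid (psi j).
Hypothesis biorth : forall j k (eta nu : lattice),
  cint mu (fun y => phi j (y - zvec R eta) * conjc (psi k (y - zvec R nu))) =
  ((eta == nu) && (j == k))%:R.
Hypothesis lam_gt1 : (1 < lam)%N.
Hypothesis refi : refinable lam phi.
Implicit Types (F G H : vec -> complex R) (nu : lattice) (u h x : vec).
Local Notation proj := (proj phi psi).
Local Notation spanV := (spanV phi).
Let mphi j := k_regular_cmeas (reg j).
Let rphi j := k_regular_rapid (reg j).

Let lam_gt0 : 0 < (lam%:R : R). Proof. by rewrite ltr0n ltnW. Qed.
Let lamV_gt0 l : 0 < (lam%:R : R) ^- l. Proof. by rewrite invr_gt0 exprn_gt0. Qed.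
Let lamV_le1 l : (lam%:R : R) ^- l <= 1.
Proof. by rewrite invf_le1 ?exprn_gt0 // exprn_ege1 // ler1n ltnW. Qed.

(** Otherwise the dilated generator would vanish at all lambda-adic points, hence everywhere by
    density and Lipschitz continuity, and a zero generator contradicts biorthogonality. *)
Lemma spanV_neq0 : (0 < k)%N -> exists F, exists2 x, spanV F /\ F x != 0 &
  exists r p, x = lam%:R ^- r *: zvec R p.
Proof.
move=> k0; pose j0 := Ordinal N_gt0.
pose D y := phi j0 ((lam%:R)^-1 *: y).
have sD : spanV D := spanV_refine lam_gt1 refi j0.
apply: contrapT => H.
have D0 r p : D (lam%:R ^- r *: zvec R p) = 0.
  apply: contrapT => Dn; apply: H; exists D, (lam%:R ^- r *: zvec R p); last by exists r, p.
  by split => //; apply/eqP.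
have Dz y : D y = 0.
  have rho0 : 0 <= `|y| + 1 by rewrite addr_ge0.
  have [C C0 HC] := spanV_lipschitz n_gt0 reg k0 rho0 sD.
  apply: cmod_eq0; apply: (@geometric_eq0 _ _ C lam 0) => // [|r _]; first exact: cmod_ge0.
  have Mr : 0 < (lam%:R : R) ^+ r by rewrite exprn_gt0.
  have [p [h yE hr]] := lattice_round y Mr.
  have h1 : `|h| <= 1 by apply: le_trans hr (lamV_le1 r).
  have := HC (lam%:R ^- r *: zvec R p) h; rewrite D0 subr0 -yE => H1.
  apply: le_trans (H1 _ h1) _; last by rewrite ler_wpM2l.
  have -> : lam%:R ^- r *: zvec R p = y - h by rewrite yE addrK.
  by apply: le_trans (ler_normB _ _) _; rewrite lerD2l.
have phi0 y : phi j0 y = 0.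
  by rewrite -(Dz (lam%:R *: y)) /D scalerA mulVf ?scale1r // gt_eqF.
have := biorth j0 j0 0 0; rewrite !eqxx /=.
rewrite (@eq_cint _ _ _ _ _ (fun=> 0)) ?cint0 => [|y]; last by rewrite phi0 mul0r.
by move/esym/eqP; rewrite oner_eq0.
Qed.

Lemma proj_pol0 Q : pol 0 Q -> proj Q = Q.
Proof.
move=> [b' [_ ->]]; apply: (proj_spanV n_gt0 mphi rphi mpsi rpsi biorth).
exists (fun _ _ => 0), 0%N, 0 => //; split; first by move=> j nu; rewrite cmod0 mul0r.
apply/funext => y; rewrite big_ord0 /synth big1 // => j _.
by rewrite (@eq_csum _ _ _ (fun=> 0)) ?csum0 // => nu; rewrite mul0r.
Qed.

(** [proj_top] in degree 0, at a lambda-adic point with [F x != 0], gives a nonzero constant fixed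
    by [proj]; the others follow by linearity. Degree 0 stands apart because [proj_hom] counts a
    constant among the terms of lower degree. *)
Lemma proj_cst (c : complex R) : (0 < k)%N -> proj (fun=> c) = (fun=> c).
Proof.
move=> k0; have [F [x [sF Fx] [r [p xE]]]] := spanV_neq0 k0.
have [C C0 HC] := spanV_taylor n_gt0 reg k0 (normr_ge0 x) sF.
have [P hP HP] := HC x (lexx _).
have [q [B [hq [b [hb BE]] PE]]] := pol_top hP.
have B0 y : B y = 0 by rewrite BE big_ord0.
have q0 : q 0 = F x.
  have := HP 0; rewrite normr0 ler01 expr1 mulr0 addr0 PE B0 addr0 => /(_ isT) le0.
  by apply/esym/subr0_eq/cmod_eq0/eqP; rewrite eq_le le0 cmod_ge0.
have hq0 : pol 0 (fun _ : vec => 0 : complex R) := @pol0 R n 0.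
have E := @proj_top R n N n_gt0 phi psi k lam reg mpsi rpsi biorth lam_gt1 refi 0 F x r p
   q (fun=> 0) C proj_pol0 sF xE C0 hq hq0.
have {}E : proj q = q.
  by apply: E => h h1; rewrite addr0; have := HP h h1; rewrite PE B0 addr0.
have qE y : q y = F x by rewrite (hom0_cst hq y).
apply/funext => y; have tq : tempered q by exact: pol_tempered (pol_hom hq (ltnSn 0)).
rewrite (eq_proj phi psi (H := fun y => c / F x * q y)); last by move=> z; rewrite qE divfK.
by rewrite projZ // E qE divfK.
Qed.

(** The sum [W] of the forms [q - p g] over the grid is [O(nG * t)]. As [proj] fixes every [p g],
    [W - proj W] is [nG] times [q - proj q], so the number of grid points cancels and [q - proj q]
    is [O(t)]. *)
Lemma proj_hom d q : (0 < d < k)%N -> (forall Q, pol d Q -> proj Q = Q) -> hom d q -> proj q = q.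
Proof.
move=> /andP[d0 dk] IH hq; have k0 : (0 < k)%N by apply: leq_trans dk.
have tq : tempered q by exact: pol_tempered (pol_hom hq (ltnSn d)).
pose F := proj q; have sF : spanV F by exact: spanV_proj.
pose e y := q y - F y.
(* Translation changes [q] by terms of lower degree, which [proj] reproduces. *)
have per x nu : e (x + zvec R nu) = e x.
  have [r hr rE] := hom_shift (zvec R nu) hq.
  have tr : tempered r := pol_tempered hr.
  rewrite /e /F -(proj_shift phi mpsi nu x tq).
  rewrite (eq_proj phi psi (H := fun y => q y + r y)); last by move=> y; rewrite addrC rE.
  by rewrite projD // (IH _ hr) (addrC x) rE; ring.
have [L L0 HL] := spanV_lipschitz n_gt0 reg k0 ler01 sF.
have [C C0 HC] := spanV_taylor n_gt0 reg dk ler01 sF.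
have [Ct Ct0 HCt] := @top_bound R n d.
have [Lq Lq0 HLq] := hom_lipschitz hq.
have [C' C'0 HC'] := proj_growth n_gt0 rphi mpsi rpsi d.
have Le x h : `|x| <= 1 -> `|h| <= 1 -> cmod (e (x + h) - e x) <= (Lq + L) * `|h|.
  move=> x1 h1; rewrite /e mulrDl.
  have -> : q (x + h) - F (x + h) - (q x - F x) = (q (x + h) - q x) - (F (x + h) - F x) by ring.
  by apply: le_trans (cmodB _ _) _; apply: lerD; [exact: HLq|exact: HL].
pose K := Ct * (Lq + L + C) * 2 ^+ d.
have K0 : 0 <= K by rewrite !mulr_ge0 ?exprn_ge0 // !addr_ge0.
apply/funext => u; apply/esym/subr0_eq/cmod_eq0.
apply: (@geometric_eq0 _ _ ((1 + C') * K * wt u ^+ d) lam 0) => // [|l _]; first exact: cmod_ge0.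
pose t : R := lam%:R ^- l; have t0 : 0 < t := lamV_gt0 l; have t1 : t <= 1 := lamV_le1 l.
(* The number of points per side is a power of [lam], so that grid points are lambda-adic, and the
   mesh is [t^(d+1)]. *)
pose m := (lam ^ (l * d.+1)).-1.
have mE : m.+1 = (lam ^ (l * d.+1))%N by rewrite prednK // expn_gt0 ltnW.
have MV : (m.+1%:R : R)^-1 = t ^+ d.+1 by rewrite mE natrX exprM -exprVn.
have mER : (m.+1%:R : R) = lam%:R ^+ (l * d.+1) by rewrite mE natrX.
have M0 : 0 < (m.+1%:R : R) by rewrite ltr0n.
pose gp := @grid_point R n m.
have gpE g : gp g = lam%:R ^- (l * d.+1) *: zvec R (\row_i (g 0 i : int)).
  by apply/rowP => i; rewrite !mxE mER mulrC.
pose V := vec -> complex R.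
have /choice[f Hf] : forall g, exists f : V * V * V, let: (p, B, r) := f in
    [/\ hom d p, pol d B, pol d r, forall u, q (gp g + u) = q u + r u &
        forall h, `|h| <= 1 -> cmod (F (gp g + h) - (p h + B h)) <= C * `|h| ^+ d.+1].
  move=> g; have [P hP HP] := HC (gp g) (grid_point_le _ g).
  have [p [B [hp hB PE]]] := pol_top hP; have [r hr rE] := hom_shift (gp g) hq.
  by exists (p, B, r); split => // h h1; rewrite -PE; exact: HP.
pose p g := (f g).1.1; pose B g := (f g).1.2; pose r g := (f g).2.
have {}Hf g : [/\ hom d (p g), pol d (B g), pol d (r g), forall u, q (gp g + u) = q u + r g u &
        forall h, `|h| <= 1 -> cmod (F (gp g + h) - (p g h + B g h)) <= C * `|h| ^+ d.+1].
  by have := Hf g; rewrite /p /B /r; case: (f g) => [[? ?] ?].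
pose W h := \sum_g (q h - p g h).
pose S0 := \sum_g e (gp g).
pose Bt h := \sum_g (r g h - B g h) - S0.
have hW : hom d W.
  apply: hom_sum => g; have [hp _ _ _ _] := Hf g.
  by under eq_fun do rewrite -mulN1r; apply: hom_add => //; exact: homZ.
have hBt : pol d Bt.
  have hS : pol d (fun _ : vec => S0) := pol_hom (@hom_cst R n S0) d0.
  apply: polB hS.
  by apply: pol_sum => g; have [_ hB hr _ _] := Hf g; exact: polB.
pose nG : R := #|{: 'rV['I_m.+1]_n}|%:R.
have nG0 : 0 < nG by rewrite ltr0n; apply/card_gt0P; exists 0.
have sumc (z : complex R) : \sum_(g : 'rV['I_m.+1]_n) z = (nG%:C)%C * z.
  by rewrite sumr_const rmorph_nat mulr_natl.
have sumR (z : R) : \sum_(g : 'rV['I_m.+1]_n) z = nG * z.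
  by rewrite sumr_const mulr_natl.
have HWB h : `|h| < t -> cmod (W h + Bt h) <= nG * ((Lq + L + C) * t ^+ d.+1).
  move=> ht; have [nu [h' hE hh']] := lattice_round h M0.
  have h'1 : `|h'| <= 1 by apply: le_trans hh' _; rewrite MV exprn_ile1 // ltW.
  have h1 : `|h| <= 1 by rewrite ltW // (lt_le_trans ht).
  (* Expanding [q] and [F] at the grid points produces the sum of [e (gp g + h)]; by periodicity [h]
     may be replaced there by its rounding error [h'], of norm at most the mesh. *)
  have -> : W h + Bt h = \sum_g ((e (gp g + h') - e (gp g)) + (F (gp g + h) - (p g h + B g h))).
    rewrite big_split /= sumrB -/S0 -(sum_grid_shift m nu h' per) -hE /Bt addrA -big_split /=.
    rewrite [RHS]addrAC -big_split /=; congr (_ - _); apply: eq_bigr => g _.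
    by have [_ _ _ rE _] := Hf g; rewrite /e rE; ring.
  apply: le_trans (cmod_sum _ _ _) _; rewrite -sumR; apply: ler_sum => g _.
  have [_ _ _ _ Hg] := Hf g; apply: le_trans (cmodD _ _) _; rewrite mulrDl; apply: lerD.
    apply: le_trans (Le _ _ (grid_point_le _ g) h'1) _.
    by rewrite ler_wpM2l ?addr_ge0 // -MV.
  by apply: le_trans (Hg h h1) _; rewrite ler_wpM2l // lerX_ge0 // ltW.
(* On a ball of radius [t], [top_bound] loses [t^-d]; of [t^(d+1)] one factor [t] is left. *)
have HW v : cmod (W v) <= nG * K * t * wt v ^+ d.
  apply: le_trans (HCt W Bt _ t hW hBt t0 HWB v) _.
  rewrite [leLHS](_ : _ = nG * K * t * `|v| ^+ d); last first.
    have tt : t^-1 ^+ d * t ^+ d = 1 by rewrite -exprMn mulVf ?expr1n // gt_eqF.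
    transitivity (nG * K * t * `|v| ^+ d * (t^-1 ^+ d * t ^+ d)); last by rewrite tt mulr1.
    rewrite /K !exprMn (exprS t); ring.
  apply: ler_wpM2l; first exact: (mulr_ge0 (mulr_ge0 (ltW nG0) K0) (ltW t0)).
  by rewrite lerX_ge0 // /wt lerDr.
have pW : proj W u = \sum_g (proj q u - p g u).
  rewrite /W proj_sum // => [|g]; last first.
    by apply: temperedB => //; have [hp _ _ _ _] := Hf g; exact: pol_tempered (pol_hom hp (ltnSn d)).
  apply: eq_bigr => g _; have [hp _ _ _ _] := Hf g; rewrite projB //; last first.
    exact: pol_tempered (pol_hom hp (ltnSn d)).
  congr (_ - _); have [_ hB _ _ Hg] := Hf g.
  by rewrite (proj_top n_gt0 reg mpsi rpsi biorth lam_gt1 refi IH sF (gpE g) C0 hp hB Hg).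
have EW : W u - proj W u = (nG%:C)%C * (q u - proj q u).
  by rewrite pW -sumrB -sumc; apply: eq_bigr => g _; ring.
have Z0 : 0 <= nG * K * t := mulr_ge0 (mulr_ge0 (ltW nG0) K0) (ltW t0).
have HpW : cmod (proj W u) <= C' * (nG * K * t) * wt u ^+ d.
  have := HC' W 0 (nG * K * t) u Z0; rewrite subr0; apply; split; first exact: hom_cmeas hW.
  by apply/nearW => y; rewrite subr0.
have : nG * cmod (q u - proj q u) <= nG * ((1 + C') * K * wt u ^+ d * t).
  rewrite -[X in X * cmod _](ger0_norm (ltW nG0)) -cmod_real -cmodM -EW.
  apply: le_trans (cmodB _ _) _; apply: le_trans (lerD (HW u) HpW) _.
  by rewrite le_eqVlt; apply/orP; left; apply/eqP; ring.
by rewrite ler_pM2l.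
Qed.

Lemma proj_pol P : pol k P -> proj P = P.
Proof.
suff H d Q : (d <= k)%N -> pol d Q -> proj Q = Q by exact: H.
elim: d Q => [|d IH] Q dk hQ; first exact: proj_pol0.
have [q [B [hq hB QE]]] := pol_top hQ.
have IHd Q' : pol d Q' -> proj Q' = Q' by move=> /IH; apply; exact: ltnW.
have projq : proj q = q.
  have [d0|d0] := posnP d; last by apply: proj_hom IHd hq; rewrite d0.
  rewrite d0 in hq dk; rewrite (_ : q = fun=> q 0); first exact: proj_cst.
  by apply/funext => y; exact: hom0_cst.
have tq : tempered q := pol_tempered (pol_hom hq (ltnSn d)).
rewrite (_ : Q = fun y => q y + B y); last exact/funext.
by apply/funext => y; rewrite projD ?projq ?(IHd _ hB) //; exact: pol_tempered hB.
Qed.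

End reproduction_induction.

(** * Pointwise smoothness *)

Section real_continuity.
Context (R : realType) (T : topologicalType).
Implicit Types f g : T -> R.

Lemma continuous_add f g : continuous f -> continuous g -> continuous (fun x => f x + g x).
Proof. by move=> cf cg x; apply: cvgD; [exact: cf|exact: cg]. Qed.

Lemma continuous_mul f g : continuous f -> continuous g -> continuous (fun x => f x * g x).
Proof. by move=> cf cg x; apply: cvgM; [exact: cf|exact: cg]. Qed.

Lemma continuous_sum (d : nat) (g : nat -> T -> R) : (forall m, continuous (g m)) ->
  continuous (fun x => \sum_(m < d) g m x).
Proof.
move=> cg; elim: d => [|d IH].
  rewrite (_ : (fun x => _) = fun=> 0); first exact: cst_continuous.
  by apply/funext => x; rewrite big_ord0.
rewrite (_ : (fun x => _) = fun x => \sum_(m < d) g m x + g d x); last first.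
  by apply/funext => x; rewrite big_ord_recr.
exact: continuous_add.
Qed.

Lemma continuous_sqrt f : continuous f -> continuous (fun x => Num.sqrt (f x)).
Proof.
by move=> cf x; apply: (@continuous_comp _ _ _ f Num.sqrt); [exact: cf|exact: sqrt_continuous].
Qed.

End real_continuity.

(** * Approximation on balls and change of degree *)

Section local_approximation.
Context (R : realType) (n : nat).
Local Notation vec := 'rV[R]_n.
Local Notation mu := (lebesgue_rV R n).
Implicit Types (y h v : vec) (p : nat -> nat -> vec -> complex R).
Variables (lam : nat) (q : R) (x : vec) (f : vec -> complex R) (Bf : R).
Hypothesis lam_gt1 : (1 < lam)%N.
Hypothesis q_gt1 : 1 < q.
Hypothesis fB : forall y, cmod (f y) <= Bf.

Let lam_gt0 : 0 < (lam%:R : R). Proof. by rewrite ltr0n ltnW. Qed.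
Let lam_ge1 : 1 <= (lam%:R : R). Proof. by rewrite ler1n ltnW. Qed.
Let lamX_gt0 l : 0 < (lam%:R : R) ^+ l. Proof. by rewrite exprn_gt0. Qed.
Let lamV_gt0 l : 0 < (lam%:R : R) ^- l. Proof. by rewrite invr_gt0. Qed.
Let q_gt0 : 0 < q. Proof. exact: lt_trans ltr01 q_gt1. Qed.
Let qV_gt0 l : 0 < q ^- l. Proof. by rewrite invr_gt0 exprn_gt0. Qed.

Lemma hom_continuous m (p : vec -> complex R) : hom m p ->
  continuous (fun y => Re (p y)) /\ continuous (fun y => Im (p y)).
Proof.
have cc (c : R) : continuous (fun _ : vec => c) by move=> y; exact: cst_continuous.
elim=> {m p} [m|c|m p r _ [p1 p2] _ [r1 r2]|m i p _ [p1 p2]].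
- by split; exact: cc.
- by split; exact: cc.
- split.
    rewrite (_ : (fun y => _) = (fun y => Re (p y) + Re (r y))); last by apply/funext => y; rewrite ReD.
    exact: continuous_add.
  rewrite (_ : (fun y => _) = (fun y => Im (p y) + Im (r y))); last by apply/funext => y; rewrite ImD.
  exact: continuous_add.
- have ci : continuous (fun y : vec => y 0 i) by exact: coord_continuous.
  split.
    rewrite (_ : (fun y => _) = (fun y : vec => y 0 i * Re (p y))); last first.
      by apply/funext => y; rewrite ReM /= mul0r subr0.
    exact: continuous_mul.
  rewrite (_ : (fun y => _) = (fun y : vec => y 0 i * Im (p y))); last first.
    by apply/funext => y; rewrite ImM /= mul0r addr0.
  exact: continuous_mul.
Qed.

Lemma pol_cmod_continuous d (P : vec -> complex R) : pol d P ->
  continuous (fun y => cmod (P y)).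
Proof.
move=> [p [hp ->]].
have c1 := @continuous_sum R _ d (fun m y => Re (p m y)) (fun m => (hom_continuous (hp m)).1).
have c2 := @continuous_sum R _ d (fun m y => Im (p m y)) (fun m => (hom_continuous (hp m)).2).
have := continuous_sqrt (continuous_add (continuous_mul c1 c1) (continuous_mul c2 c2)).
rewrite (_ : (fun y => _) = (fun y => cmod (\sum_(m < d) p m y))) //; apply/funext => y.
by rewrite cmodE Re_sum Im_sum !expr2.
Qed.

Lemma geometric_sum (r : R) l : 1 < r -> \sum_(i < l) r ^+ i <= r ^+ l / (r - 1).
Proof.
move=> r1; rewrite ler_pdivlMr ?subr_gt0 // mulrC -subrX1 gerBl //.
Qed.

(* With [q = lam `^ s], this is the condition C^s(x) for polynomials of degree less than [K], on
   balls instead of the sets Q_l(x). *)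
Definition approx K := exists2 C : R, 0 <= C & forall i, exists2 P, pol K P &
  {ae mu, forall y, `|y - x| < lam%:R ^- i -> cmod (f y - P y) <= C * q ^- i}.

Definition expansion K p (C : R) := (forall i m, hom m (p i m)) /\
  forall i, {ae mu, forall y, `|y - x| < lam%:R ^- i ->
    cmod (f y - \sum_(m < K) p i m (y - x)) <= C * q ^- i}.

Lemma approx_expansion K : approx K -> exists2 C : R, 0 <= C & exists p, expansion K p C.
Proof.
move=> [C C0 H]; exists C => //.
have /choice[p Hp] : forall i, exists p : nat -> vec -> complex R, (forall m, hom m (p m)) /\
   {ae mu, forall y, `|y - x| < lam%:R ^- i -> cmod (f y - \sum_(m < K) p m (y - x)) <= C * q ^- i}.
  move=> i; have [P hP HP] := H i; have [p [hp pE]] := pol_shift x hP.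
  exists p; split => //; apply: filterS HP => y Hy /Hy.
  by have := congr1 (@^~ (y - x)) pE; rewrite /= (addrC x) subrK => <-.
by exists p; split=> [i|i]; have [] := Hp i.
Qed.

Lemma expansion_approx K p C : 0 <= C -> expansion K p C -> approx K.
Proof.
move=> C0 [hp H]; exists C => // i; exists (fun y => \sum_(m < K) p i m (y - x)); last exact: H.
under eq_fun do rewrite addrC.
by apply: (@pol_shift _ _ K (fun y => \sum_(m < K) p i m y)); exists (p i).
Qed.

(** Both polynomials approximate [f] a.e. on the smaller ball, so their difference is small there,
    everywhere by continuity, and [hom_part_bound] transfers this to each homogeneous part. *)
Lemma expansion_step K p C : 0 <= C -> expansion K p C -> exists2 D : R, 0 <= D &
  forall i m v, (m < K)%N -> cmod (p i.+1 m v - p i m v) <= D * q ^- i * (lam%:R ^+ i * `|v|) ^+ m.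
Proof.
move=> C0 [hp H]; have [C1 C10 H1] := @hom_part_bound R n K.
exists (C1 * (C + C) * (2 * lam%:R) ^+ K) => [|i m v mK].
  by rewrite !mulr_ge0 ?exprn_ge0 ?mulr_ge0 ?addr_ge0.
pose d m h := p i.+1 m h - p i m h.
have hd m' : hom m' (d m').
  by rewrite /d; under eq_fun do rewrite -mulN1r; apply: hom_add => //; exact: homZ.
have bd h : `|h| < lam%:R ^- i.+1 -> cmod (\sum_(m < K) d m h) <= (C + C) * q ^- i.
  move=> hi; have cd : continuous (fun y => cmod (\sum_(m < K) d m (y - x))).
    apply: (@pol_cmod_continuous K (fun y => \sum_(m < K) d m (y - x))).
    under eq_fun do rewrite addrC.
    by apply: (@pol_shift _ _ K (fun y => \sum_(m < K) d m y)); exists d.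
  have := @ae_ball_continuous R n x (lam%:R ^- i.+1) ((C + C) * q ^- i) _ cd _ (x + h).
  rewrite opprD addNKr normrN (addrC x) addrK; apply => //.
  move: (H i) (H i.+1); apply: filterS2 => y h1 h2; rewrite distrC => yx.
  have lt2 : `|y - x| < lam%:R ^- i.
    by apply: lt_le_trans yx _; rewrite lef_pV2 ?posrE // exprS ler_peMl // ltW.
  have -> : \sum_(m < K) d m (y - x) = (f y - \sum_(m < K) p i m (y - x)) -
             (f y - \sum_(m < K) p i.+1 m (y - x)) by rewrite sumrB; ring.
  apply: le_trans (cmodB _ _) _; rewrite mulrDl; apply: lerD; first exact: h1.
  apply: le_trans (h2 yx) _; rewrite ler_wpM2l // lef_pV2 ?posrE ?exprn_gt0 //.
  by rewrite exprS ler_peMl ?exprn_ge0 ?(ltW q_gt0) // ltW.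
apply: le_trans (H1 d _ _ hd (lamV_gt0 i.+1) bd m v mK) _.
rewrite invrK exprS [X in X ^+ m](_ : _ = (2 * lam%:R) * (lam%:R ^+ i * `|v|)); last by ring.
rewrite exprMn [leLHS](_ : _ = C1 * (C + C) * (2 * lam%:R) ^+ m * (q ^- i * (lam%:R ^+ i * `|v|) ^+ m)); last by ring.
rewrite -[leRHS]mulrA ler_wpM2r //.
  by rewrite mulr_ge0 ?(ltW (qV_gt0 _)) // exprn_ge0 // mulr_ge0 // ltW.
rewrite ler_wpM2l ?mulr_ge0 ?addr_ge0 // ler_weXn2l ?(ltnW mK) //.
by apply: le_trans lam_ge1 _; rewrite ler_peMl ?(ltW lam_gt0) // ler1n.
Qed.

(* The parts of degree m with q < lam ^ m have sizes O((lam ^ m / q) ^ i), so that dropping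
   them changes the i-th polynomial by O(q ^- i) on the i-th ball. *)
Lemma approx_reduce K K' : (K' <= K)%N -> q < lam%:R ^+ K' -> approx K -> approx K'.
Proof.
move=> KK' qK' /approx_expansion[C C0 [p Hp]].
have [D D0 HD] := expansion_step C0 Hp; have [hp HC] := Hp.
have r1 m : (K' <= m)%N -> 1 < lam%:R ^+ m / q.
  move=> Km; rewrite ltr_pdivlMr // mul1r; apply: lt_le_trans qK' _.
  by rewrite ler_weXn2l.
have big m : (K' <= m < K)%N -> exists2 G : R, 0 <= G & forall i v,
    cmod (p i m v) <= G * (lam%:R ^+ m / q) ^+ i * `|v| ^+ m.
  move=> /andP[Km mK]; have r := r1 m Km.
  have [G0 G00 HG0] := hom_bound (hp 0%N m).
  (* The summand [D / (r - 1)], with [r] the growth ratio, is what makes [G + D <= G * r], so that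
     the increments are absorbed at each scale. *)
  pose G := G0 + D / (lam%:R ^+ m / q - 1).
  have D1 : 0 <= D / (lam%:R ^+ m / q - 1) by rewrite divr_ge0 // subr_ge0 ltW.
  exists G => [|i v]; first exact: addr_ge0.
  elim: i => [|i IH].
    by rewrite mulr1; apply: le_trans (HG0 v) _; rewrite ler_wpM2r ?exprn_ge0 // lerDl.
  have -> : p i.+1 m v = p i m v + (p i.+1 m v - p i m v) by ring.
  apply: le_trans (cmodD _ _) _; apply: le_trans (lerD IH (HD i m v mK)) _.
  have -> : D * q ^- i * (lam%:R ^+ i * `|v|) ^+ m = D * (lam%:R ^+ m / q) ^+ i * `|v| ^+ m.
    by rewrite !exprMn exprVn exprAC; ring.
  have step : G + D <= G * (lam%:R ^+ m / q).
    move: r G00; rewrite /G; set rr := lam%:R ^+ m / q => r G00.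
    have -> : (G0 + D / (rr - 1)) * rr = G0 + D / (rr - 1) + D + G0 * (rr - 1).
      by field; rewrite subr_eq0 gt_eqF.
    by rewrite lerDl mulr_ge0 // subr_ge0 ltW.
  rewrite -mulrDl ler_wpM2r ?exprn_ge0 // -mulrDl exprS mulrA.
  by rewrite ler_wpM2r // exprn_ge0 // (le_trans ler01 (ltW r)).
have /choice[G HG] : forall m, exists G : R, 0 <= G /\ ((K' <= m < K)%N -> forall i v,
    cmod (p i m v) <= G * (lam%:R ^+ m / q) ^+ i * `|v| ^+ m).
  move=> m; have [mK|mK] := boolP (K' <= m < K)%N; last by exists 0.
  by have [G G0 H] := big m mK; exists G.
have S0 : 0 <= \sum_(m < K) G m by apply: sumr_ge0 => m _; case: (HG m).
apply: (@expansion_approx K' p (C + \sum_(m < K) G m)); first exact: addr_ge0.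
split=> // i; apply: filterS (HC i) => y Hy yx.
have -> : f y - \sum_(m < K') p i m (y - x) = (f y - \sum_(m < K) p i m (y - x)) +
    \sum_(m < K | (K' <= m)%N) p i m (y - x).
  have -> : \sum_(m < K') p i m (y - x) = \sum_(m < K | ~~ (K' <= m)%N) p i m (y - x).
    rewrite (big_ord_widen K (fun m => p i m (y - x)) KK').
    by apply: eq_bigl => m; rewrite -ltnNge.
  by rewrite [in RHS](bigID (fun m : 'I_K => (K' <= m)%N) predT) /=; ring.
apply: le_trans (cmodD _ _) _; rewrite mulrDl; apply: lerD; first exact: Hy.
apply: le_trans (cmod_sum _ _ _) _; rewrite mulr_suml [leRHS](bigID (fun m : 'I_K => (K' <= m)%N)) /=.
rewrite -[leLHS]addr0; apply: lerD; last first.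
  by apply: sumr_ge0 => m _; rewrite mulr_ge0 ?(ltW (qV_gt0 _)) //; case: (HG m).
apply: ler_sum => m Km; have [G0 H] := HG m.
have Km' : (K' <= m < K)%N by rewrite Km ltn_ord.
apply: le_trans (H Km' i (y - x)) _; rewrite -mulrA ler_wpM2l //.
rewrite exprMn exprVn -mulrA mulrCA -[leRHS]mulr1 ler_wpM2l ?(ltW (qV_gt0 _)) //.
rewrite exprAC -exprMn exprn_ile1 ?mulr_ge0 ?(ltW (lamX_gt0 _)) //.
by rewrite -ler_pdivlMl // mulr1 ltW.
Qed.

(* Beyond the i-th ball, 1 + lam ^ i |z - x| grows by a factor 4/3 from i to i + 1, which for
   a large power outweighs the loss of a factor 2 q. *)
Lemma expansion_global K p C : 0 <= C -> expansion K p C -> exists E, exists2 D : R, 0 <= D &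
  forall i, {ae mu, forall z, cmod (f z - \sum_(m < K) p i m (z - x)) <=
    D * q ^- i * (1 + lam%:R ^+ i * `|z - x|) ^+ E}.
Proof.
move=> C0 Hp; have [D1 D10 HD1] := expansion_step C0 Hp; have [hp HC] := Hp.
have Bf0 : 0 <= Bf := le_trans (cmod_ge0 _) (fB 0).
have [C1 C10 HC1] : exists2 C1 : R, 0 <= C1 & forall h, cmod (\sum_(m < K) p 0%N m h) <= C1 * wt h ^+ K.
  by apply: pol_bound; exists (p 0%N).
(* [(4 / 3)^3 >= 2], so the exponent [3 * b] gives at least [2^b >= b >= 2 * q] with [b] the bound
   of [2 * q]. *)
pose e := (3 * Num.bound (2 * q))%N; pose E := (K + e)%N.
have q2 : 2 * q <= (4 / 3) ^+ e.
  have q20 : 0 <= 2 * q by rewrite mulr_ge0 // ltW.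
  apply: le_trans (ltW (archi_boundP q20)) _; rewrite /e exprM.
  apply: (@le_trans _ _ (2 ^+ Num.bound (2 * q))); first by rewrite -natrX ler_nat ltnW // ltn_expl.
  by rewrite lerX_ge0 //; lra.
pose D := C + (Bf + C1) + K%:R * D1.
have KD1 : 0 <= K%:R * D1 by rewrite mulr_ge0.
have D0 : 0 <= D by rewrite !addr_ge0.
have wE (t : R) a b : 0 <= t -> (a <= b)%N -> (1 + t) ^+ a <= (1 + t) ^+ b.
  by move=> t0 ab; rewrite ler_weXn2l // lerDl.
exists E, D => //; elim=> [|i IH].
  apply/nearW => z; rewrite expr0 invr1 mulr1 mul1r.
  apply: le_trans (cmodB _ _) _; apply: le_trans (lerD (fB z) (HC1 _)) _.
  apply: (@le_trans _ _ ((Bf + C1) * wt (z - x) ^+ E)); last first.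
    by rewrite ler_wpM2r ?wtX_ge0 // /D addrAC lerDr addr_ge0.
  rewrite mulrDl; apply: lerD; first by rewrite ler_peMr // exprn_ege1 // wt_ge1.
  by rewrite ler_wpM2l // wE // leq_addr.
move: IH (HC i.+1); apply: filterS2 => z IH Hz.
have a0 : 0 <= lam%:R ^+ i * `|z - x| by rewrite mulr_ge0 // ltW.
have aS : lam%:R ^+ i.+1 * `|z - x| = lam%:R * (lam%:R ^+ i * `|z - x|) by rewrite exprS mulrA.
have [zx|zx] := ltP `|z - x| (lam%:R ^- i.+1).
  apply: le_trans (Hz zx) _; apply: (@le_trans _ _ (D * q ^- i.+1)).
    by rewrite ler_wpM2r ?(ltW (qV_gt0 _)) // /D -addrA lerDl addr_ge0 // addr_ge0.
  by rewrite ler_peMr ?mulr_ge0 ?(ltW (qV_gt0 _)) // exprn_ege1 // lerDl mulr_ge0 // ltW.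
have a1 : 1 <= lam%:R * (lam%:R ^+ i * `|z - x|).
  by rewrite -aS -ler_pdivrMl // mulr1.
rewrite aS; move: a0 a1 IH; set a := lam%:R ^+ i * `|z - x| => a0 a1 IH.
have -> : f z - \sum_(m < K) p i.+1 m (z - x) = (f z - \sum_(m < K) p i m (z - x)) -
   \sum_(m < K) (p i.+1 m (z - x) - p i m (z - x)) by rewrite sumrB; ring.
apply: le_trans (cmodB _ _) _.
apply: (@le_trans _ _ (D * q ^- i * (1 + a) ^+ E + D * q ^- i * (1 + a) ^+ E)).
  apply: lerD => //; apply: le_trans (cmod_sum _ _ _) _.
  apply: (@le_trans _ _ (\sum_(m < K) D1 * (q ^- i * (1 + a) ^+ E))).
    apply: ler_sum => m _; apply: le_trans (HD1 i m _ (ltn_ord m)) _; rewrite -mulrA ler_wpM2l //.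
    rewrite ler_wpM2l ?(ltW (qV_gt0 _)) //; apply: (@le_trans _ _ ((1 + a) ^+ m)).
      by rewrite lerX_ge0 // lerDr.
    by rewrite wE // ltnW // ltn_addr.
  rewrite sumr_const card_ord -[leLHS]mulr_natl !mulrA ler_wpM2r ?exprn_ge0 ?addr_ge0 //.
  by rewrite ler_wpM2r ?(ltW (qV_gt0 _)) // /D lerDr !addr_ge0.
have lam2 : 2 <= (lam%:R : R) by rewrite ler_nat.
(* The extreme case is [lam = 2], [a = 1 / 2], where equality holds. *)
have la : 4 / 3 * (1 + a) <= 1 + lam%:R * a by nra.
have : 2 * q * (1 + a) ^+ E <= (1 + lam%:R * a) ^+ E.
  apply: (@le_trans _ _ ((4 / 3) ^+ E * (1 + a) ^+ E)); last first.
    by rewrite -exprMn lerX_ge0 // mulr_ge0 ?addr_ge0 //; lra.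
  rewrite ler_wpM2r ?exprn_ge0 ?addr_ge0 //; apply: le_trans q2 _.
  by rewrite ler_weXn2l ?leq_addl //; lra.
have Dq : 0 <= D * q ^- i.+1 by rewrite mulr_ge0 // ltW.
move=> /(ler_wpM2l Dq); apply: le_trans.
rewrite le_eqVlt; apply/orP; left; apply/eqP; rewrite exprS invfM.
by field; rewrite gt_eqF ?exprn_gt0 // gt_eqF.
Qed.

End local_approximation.

Section powers.
Context (R : realType) (lam k : nat) (s : R).
Hypothesis lam_gt1 : (1 < lam)%N.
Hypotheses (s_gt0 : 0 < s) (s_ltk : s < k%:R).
Let q : R := lam%:R `^ s.
Let lam_gt0 : 0 < (lam%:R : R). Proof. by rewrite ltr0n ltnW. Qed.

Lemma powR_gt1 (r : R) : 0 < r -> 1 < (lam%:R : R) `^ r.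
Proof.
move=> r0; rewrite [ltLHS](_ : 1 = 1 `^ r); last by rewrite powR1.
apply: gt0_ltr_powR; rewrite ?nnegrE ?ltr1n //.
Qed.

Lemma powR_lt_expr (K : nat) : s < K%:R -> q < lam%:R ^+ K.
Proof.
move=> sK; rewrite -(powR_mulrn K (ltW lam_gt0)) /q -[X in _ < _ `^ X](subrK s).
rewrite powRD; last by rewrite (gt_eqF lam_gt0) implybT.
by rewrite ltr_pMl ?powR_gt0 // powR_gt1 // subr_gt0.
Qed.

Lemma powR_invX l : (lam%:R ^- l : R) `^ s = q ^- l.
Proof.
have q0 : q != 0 by rewrite gt_eqF // powR_gt0.
have l0 : (lam%:R ^+ l : R) != 0 by rewrite expf_neq0 // gt_eqF.
apply: (mulIf (expf_neq0 l q0)); rewrite mulVf ?expf_neq0 //.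
have -> : q ^+ l = (lam%:R ^+ l : R) `^ s.
  by rewrite /q -(powR_mulrn l (powR_ge0 _ _)) -(powR_mulrn l (ltW lam_gt0)) -!powRrM mulrC.
by rewrite -powRM ?invr_ge0 ?exprn_ge0 ?(ltW lam_gt0) // mulVf // powR1.
Qed.

(** Once [lam^-l] is factored out, the remaining base is at least 1, and its exponent [s] may be
    raised to the integer [k]; this puts the hypothesis (ii) in the form of a polynomial weight. *)
Lemma powR_dist_le l (t : R) : 0 <= t ->
  (lam%:R ^- l + t) `^ s <= q ^- l * (1 + lam%:R ^+ l * t) ^+ k.
Proof.
move=> t0; have L0 : 0 < (lam%:R ^+ l : R) by rewrite exprn_gt0.
have u1 : 1 <= 1 + lam%:R ^+ l * t by rewrite lerDl mulr_ge0 // ltW.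
have -> : lam%:R ^- l + t = lam%:R ^- l * (1 + lam%:R ^+ l * t).
  by field; rewrite gt_eqF.
rewrite powRM ?invr_ge0 ?(ltW L0) ?(le_trans ler01 u1) // powR_invX.
rewrite ler_wpM2l ?invr_ge0 ?exprn_ge0 ?powR_ge0 // -(powR_mulrn k) ?(le_trans ler01 u1) //.
by apply: ler_powR => //; exact: ltW.
Qed.

Lemma powR_dist_ge i (b : R) : 0 <= b -> lam%:R ^- i <= lam%:R * b -> q ^- i <= q * b `^ s.
Proof.
move=> b0 H; rewrite -powR_invX /q -powRM ?(ltW lam_gt0) //.
apply: ge0_ler_powR; rewrite ?nnegrE ?(ltW s_gt0) ?invr_ge0 ?exprn_ge0 ?mulr_ge0 ?(ltW lam_gt0) //.
Qed.

End powers.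

(** * The projections at scale l *)

Section scale_projections.
Context (R : realType) (n N : nat).
Hypothesis n_gt0 : (0 < n)%N.
Hypothesis N_gt0 : (0 < N)%N.
Local Notation lattice := 'rV[int]_n.
Local Notation vec := 'rV[R]_n.
Local Notation mu := (lebesgue_rV R n).
Variables (phi psi : 'I_N -> vec -> complex R) (k lam : nat).
Hypothesis reg : forall j, k_regular k (phi j).
Hypothesis mpsi : forall j, cmeas (psi j).
Hypothesis rpsi : forall j, rapid (psi j).
Hypothesis biorth : forall j k (eta nu : lattice),
  cint mu (fun y => phi j (y - zvec R eta) * conjc (psi k (y - zvec R nu))) =
  ((eta == nu) && (j == k))%:R.
Hypothesis lam_gt1 : (1 < lam)%N.
Hypothesis refi : refinable lam phi.
Implicit Types (F G H : vec -> complex R) (nu : lattice) (u h x : vec).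
Local Notation proj := (proj phi psi).
Local Notation spanV := (spanV phi).
Let mphi j := k_regular_cmeas (reg j).
Let rphi j := k_regular_rapid (reg j).

Let lam_gt0 : 0 < (lam%:R : R). Proof. by rewrite ltr0n ltnW. Qed.
Let lamV_gt0 l : 0 < (lam%:R : R) ^- l. Proof. by rewrite invr_gt0 exprn_gt0. Qed.
Let lamV_le1 l : (lam%:R : R) ^- l <= 1.
Proof. by rewrite invf_le1 ?exprn_gt0 // exprn_ege1 // ler1n ltnW. Qed.

(* [pr l] is the operator P_l. *)
Definition pr l G y := proj (fun z => G (lam%:R ^- l *: z)) (lam%:R ^+ l *: y).

Lemma tempered_dilate l G : tempered G -> tempered (fun z => G (lam%:R ^- l *: z)).
Proof.
move=> tG; have := tempered_scale 0 (lamV_gt0 l) (lamV_le1 l) tG.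
by under eq_fun do rewrite addr0.
Qed.

Lemma prB l G H y : tempered G -> tempered H -> pr l (fun z => G z - H z) y = pr l G y - pr l H y.
Proof. by move=> tG tH; rewrite /pr projB //; exact: tempered_dilate. Qed.

Lemma pr_pol l P y : pol k P -> pr l P y = P y.
Proof.
move=> hP; rewrite /pr (proj_pol n_gt0 N_gt0 reg mpsi rpsi biorth lam_gt1 refi (pol_scale _ hP)).
by rewrite scalerA mulVf ?scale1r // gt_eqF // exprn_gt0.
Qed.

Lemma pr_tempered l G : tempered G -> tempered (pr l G).
Proof.
move=> tG; have sF : spanV (proj (fun z => G (lam%:R ^- l *: z))).
  by apply: spanV_proj => //; exact: tempered_dilate.
have [E [Y Y0 HY]] := spanV_growth n_gt0 reg sF; have L0 : 0 < (lam%:R ^+ l : R) by rewrite exprn_gt0.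
split.
  have := cmeas_affine (lam%:R ^+ l) 0 (spanV_tempered n_gt0 mphi rphi sF).1.
  by under eq_fun do rewrite addr0.
exists E, (Y * (lam%:R ^+ l) ^+ E); split; first by rewrite mulr_ge0 // exprn_ge0 // ltW.
apply/nearW => y; apply: le_trans (HY _) _; rewrite -mulrA ler_wpM2l // -exprMn lerX_ge0 ?wt_ge0 //.
rewrite /wt normrZ (ger0_norm (ltW L0)) mulrDr mulr1 lerD2r exprn_ege1 //.
by rewrite ler1n ltnW.
Qed.

(** The range at scale [l] lies in the range at scale [l.+1] by refinability, and the projection is
    the identity there. *)
Lemma pr_nested l G y : tempered G -> pr l.+1 (pr l G) y = pr l G y.
Proof.
move=> tG; pose F := proj (fun z => G (lam%:R ^- l *: z)).
have sF : spanV F by apply: spanV_proj => //; exact: tempered_dilate.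
have E z : pr l G (lam%:R ^- l.+1 *: z) = F ((lam%:R)^-1 *: z).
  rewrite /pr scalerA; congr (F (_ *: z)).
  by rewrite exprS invfM mulrCA mulfV ?mulr1 // gt_eqF // exprn_gt0.
rewrite {1}/pr (eq_proj phi psi _ E).
rewrite (proj_spanV n_gt0 mphi rphi mpsi rpsi biorth (spanV_dilate n_gt0 mphi rphi mpsi rpsi biorth lam_gt1 refi sF)).
by rewrite scalerA exprS mulKf // gt_eqF.
Qed.

Variables (s Bf : R) (x : vec) (f : vec -> complex R).
Hypotheses (s_gt0 : 0 < s) (s_ltk : s < k%:R).
Hypotheses (mf : cmeas f) (fB : forall y, cmod (f y) <= Bf).
Let q : R := lam%:R `^ s.
Let q_gt1 : 1 < q. Proof. exact: powR_gt1. Qed.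
Let q_gt0 : 0 < q. Proof. exact: lt_trans ltr01 q_gt1. Qed.
Let qV_ge0 l : 0 <= q ^- l. Proof. by rewrite invr_ge0 exprn_ge0 // ltW. Qed.
Let Bf0 : 0 <= Bf. Proof. exact: le_trans (cmod_ge0 _) (fB 0). Qed.
Let lam_ge1 : 1 <= (lam%:R : R). Proof. by rewrite ler1n ltnW. Qed.

Definition pr_decay := exists C : R, forall l,
  {ae mu, forall y, cmod (f y - pr l f y) <= C * (lam%:R ^- l + enorm (x - y)) `^ s}.

Lemma tempered_f : tempered f.
Proof. by split => //; exists 0%N, Bf; split => //; apply/nearW => y; rewrite mulr1. Qed.

(** [i] is the last scale, at most [l], whose radius is still at least [t]; either [i = l], or the
    next radius is below [t], which costs one factor [lam]. *)
Lemma scale_choice l (t : R) : 0 <= t -> t <= 1 -> exists2 i, (i <= l)%N &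
  t <= lam%:R ^- i /\ lam%:R ^- i <= lam%:R * (lam%:R ^- l + t).
Proof.
move=> t0 t1; have [i il [ti tS]] : exists2 i, (i <= l)%N &
    t <= lam%:R ^- i /\ (i = l \/ lam%:R ^- i.+1 < t).
  elim: l => [|l [i il [ti tS]]]; first by exists 0%N => //; rewrite invr1; split => //; left.
  have [tl|tl] := leP t (lam%:R ^- l.+1); first by exists l.+1 => //; split => //; left.
  exists i; first exact: leq_trans il _; split => //; right.
  by case: tS => [->|].
exists i => //; split => //.
case: tS => [->|tS].
  apply: (@le_trans _ _ (lam%:R ^- l + t)); first by rewrite lerDl.
  by rewrite ler_peMl // addr_ge0 // ltW.
apply: (@le_trans _ _ (lam%:R * t)); last by rewrite ler_wpM2l ?(ltW lam_gt0) // lerDr ltW.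
by rewrite -ler_pdivrMl // -invfM -exprS ltW.
Qed.

Lemma approx_pr_decay : approx lam q x f k -> pr_decay.
Proof.
move=> /approx_expansion[C C0 [p Hp]].
have [E [D D0 HD]] := expansion_global lam_gt1 q_gt1 fB C0 Hp; have [hp _] := Hp.
have [C1 C10 HC1] := proj_growth n_gt0 rphi mpsi rpsi E.
have [C2 C20 HC2] := proj_growth n_gt0 rphi mpsi rpsi 0.
pose P i y := \sum_(m < k) p i m (y - x).
have hP i : pol k (P i).
  rewrite /P; under eq_fun do rewrite addrC.
  by apply: (@pol_shift _ _ k (fun y => \sum_(m < k) p i m y)); exists (p i).
(* The factor [2 ^+ E] covers both uses of the global estimate: at [y], where
   [1 + lam^i |y - x| <= 2], and for the weight seen by the projection, which is at most doubled. *)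
pose Y i := D * q ^- i * 2 ^+ E.
have Y0 i : 0 <= Y i by rewrite !mulr_ge0 // exprn_ge0.
exists ((Bf + C2 * Bf) + (1 + C1) * D * 2 ^+ E * q) => l.
have b0 y : 0 <= lam%:R ^- l + enorm (x - y) by rewrite addr_ge0 ?(ltW (lamV_gt0 _)) // sqrtr_ge0.
(* The scale [i] will depend on [y], so one null set has to serve all scales. *)
have aeD := ae_foralln HD.
apply: filterS aeD => y Hy.
have powb : 0 <= (lam%:R ^- l + enorm (x - y)) `^ s by exact: powR_ge0.
(* Far from [x] the right-hand side is bounded below, and boundedness of [f] and of [pr l f]
   suffices. *)
have [t1|t1] := leP 1 `|y - x|.
  apply: (@le_trans _ _ (Bf + C2 * Bf)).
    apply: le_trans (cmodB _ _) _; apply: lerD => //.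
    have := HC2 (fun z => f (lam%:R ^- l *: z)) 0 Bf (lam%:R ^+ l *: y) Bf0.
    rewrite mulr1; apply; split; first exact: (tempered_dilate l tempered_f).1.
    by apply/nearW => z; rewrite mulr1.
  rewrite -[leLHS]mulr1; apply: ler_pM => //; first by rewrite addr_ge0 // mulr_ge0.
    by rewrite lerDl !mulr_ge0 // ?addr_ge0 ?exprn_ge0 // ltW.
  rewrite [leLHS](_ : 1 = 1 `^ s); last by rewrite powR1.
  apply: ge0_ler_powR; rewrite ?nnegrE ?(ltW s_gt0) //.
  apply: le_trans t1 _; rewrite distrC; apply: le_trans (enorm_ge _) _.
  by rewrite lerDr ltW.
have [i il [ti it]] := scale_choice l (normr_ge0 (y - x)) (ltW t1).
have lamt : lam%:R ^+ i * `|y - x| <= 1 by rewrite -ler_pdivlMl ?exprn_gt0 // mulr1.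
have tR : tempered (fun z => f z - P i z) by apply: temperedB tempered_f (pol_tempered (hP i)).
have -> : f y - pr l f y = (f y - P i y) - pr l (fun z => f z - P i z) y.
  by rewrite prB ?(pr_pol l y (hP i)) //; [ring|exact: tempered_f|exact: pol_tempered (hP i)].
have R1 : cmod (f y - P i y) <= Y i.
  apply: le_trans (Hy i) _; apply: ler_wpM2l; first exact: mulr_ge0.
  apply: lerX_ge0; last by rewrite -[2]/(1 + 1) lerD2l.
  by rewrite addr_ge0 // mulr_ge0 // exprn_ge0 // ltW.
have R2 : cmod (pr l (fun z => f z - P i z) y) <= C1 * Y i.
  have := HC1 (fun z => f (lam%:R ^- l *: z) - P i (lam%:R ^- l *: z)) (lam%:R ^+ l *: y) (Y i) (lam%:R ^+ l *: y) (Y0 i).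
  rewrite /wt subrr normr0 addr0 expr1n mulr1; apply; split; first exact: (tempered_dilate l tR).1.
  have := ae_affine 0 (lamV_gt0 l) (HD i); apply: filterS => z; rewrite addr0 => Hz.
  apply: le_trans Hz _; rewrite /Y -!mulrA ler_wpM2l // ler_wpM2l ?qV_ge0 // -exprMn lerX_ge0 //.
  set w := lam%:R ^+ l *: y.
  have -> : lam%:R ^- l *: z - x = lam%:R ^- l *: (z - w) + (y - x).
    by rewrite scalerBr /w scalerA mulVf ?scale1r ?subrKA // gt_eqF // exprn_gt0.
  (* Because [i <= l], dilation by [lam^-l] makes the weight of scale [i] no steeper than the unit
     weight, here centred at the evaluation point [w]. *)
  have H1 : lam%:R ^+ i * `|lam%:R ^- l *: (z - w) + (y - x)| <= `|z - w| + 1.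
    apply: le_trans (ler_wpM2l _ (ler_normD _ _)) _; first by rewrite exprn_ge0 // ltW.
    rewrite mulrDr; apply: lerD => //; rewrite normrZ (ger0_norm (ltW (lamV_gt0 l))) mulrA.
    rewrite ler_piMl // ler_pdivrMr ?exprn_gt0 // mul1r.
    by rewrite ler_weXn2l.
  apply: le_trans (lerD (lexx 1) H1) _; rewrite /wt; have := normr_ge0 (z - w); lra.
apply: le_trans (cmodB _ _) _; apply: le_trans (lerD R1 R2) _.
rewrite mulrDl -[leLHS]add0r; apply: lerD; first by rewrite mulr_ge0 // addr_ge0 // mulr_ge0.
rewrite (_ : Y i + C1 * Y i = (1 + C1) * D * 2 ^+ E * q ^- i); last by rewrite /Y; ring.
rewrite -[leRHS]mulrA ler_wpM2l ?mulr_ge0 ?addr_ge0 ?exprn_ge0 //.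
apply: powR_dist_ge => //; apply: le_trans it _; rewrite ler_wpM2l ?(ltW lam_gt0) //.
by rewrite lerD2l distrC enorm_ge.
Qed.

Lemma pr_decay_approx : pr_decay -> approx lam q x f k.
Proof.
move=> [C0' HC']; pose C := `|C0'|.
have C0 : 0 <= C := normr_ge0 _.
have HC l : {ae mu, forall y, cmod (f y - pr l f y) <= C * (q ^- l * (1 + lam%:R ^+ l * enorm (x - y)) ^+ k)}.
  apply: filterS (HC' l) => y /le_trans; apply; apply: le_trans (ler_wpM2r (powR_ge0 _ _) (ler_norm C0')) _.
  by rewrite ler_wpM2l // powR_dist_le // sqrtr_ge0.
have [C1 C10 HC1] : exists2 C1 : R, 0 <= C1 & forall H u (Y : R) j nu, 0 <= Y ->
    bounded_growth H u k Y -> cmod (coef psi H j nu) <= C1 * Y * wt (zvec R nu - u) ^+ k.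
  have [C1 C10 H1] := coef_growth mpsi rpsi k; exists C1 => // H u Y j nu Y0 HH.
  exact: (H1 j H u Y nu Y0 HH).2.
have [C2 C20 HC2] := synth_taylor n_gt0 (@ler01 R) reg k.
have tay H u (Y : R) : 0 <= Y -> bounded_growth H u k Y -> exists2 T, pol k T &
    forall h, `|h| <= 1 -> cmod (proj H (u + h) - T h) <= C2 * (C1 * Y) * `|h| ^+ k.
  by move=> Y0 HH; apply: HC2 => [|j nu]; [exact: mulr_ge0|exact: HC1].
have tf := tempered_f.
have tpr l : tempered (pr l f) := pr_tempered l tf.
pose G l z := f z - pr l f z.
have tG l : tempered (G l) := temperedB tf (tpr l).
(* [n%:R ^+ k] is the cost of passing from the Euclidean norm to the sup norm. *)
pose Y l := C * n%:R ^+ k * q ^- l.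
have Y0 l : 0 <= Y l by rewrite !mulr_ge0 // exprn_ge0.
(* The base point [lam^(l+1) x] moves with [l], but the weight is centred there, so the constants
   depend on [l] only through [Y l]. *)
have /choice[T HT] : forall l, exists T, pol k T /\ forall h, `|h| <= 1 ->
    cmod (proj (fun z => G l (lam%:R ^- l.+1 *: z)) (lam%:R ^+ l.+1 *: x + h) - T h) <=
    C2 * (C1 * Y l) * `|h| ^+ k.
  move=> l; have [|T hT H] := @tay (fun z => G l (lam%:R ^- l.+1 *: z)) (lam%:R ^+ l.+1 *: x) (Y l) (Y0 l); last by exists T.
  split; first exact: (tempered_dilate l.+1 (tG l)).1.
  have := ae_affine 0 (lamV_gt0 l.+1) (HC l); apply: filterS => z; rewrite addr0 => Hz.
  apply: le_trans Hz _; rewrite /Y -!mulrA ler_wpM2l // [leRHS]mulrCA ler_wpM2l ?qV_ge0 // -exprMn.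
  set u := lam%:R ^+ l.+1 *: x.
  have xE : x - lam%:R ^- l.+1 *: z = lam%:R ^- l.+1 *: (u - z).
    by rewrite scalerBr /u scalerA mulVf ?scale1r // gt_eqF // exprn_gt0.
  have e0 : 0 <= lam%:R ^+ l * enorm (x - lam%:R ^- l.+1 *: z).
    by rewrite mulr_ge0 ?sqrtr_ge0 // exprn_ge0 // ltW.
  rewrite lerX_ge0 ?addr_ge0 // /wt mulrDr mulr1; apply: lerD; first by rewrite ler1n.
  apply: le_trans (ler_wpM2l _ (enorm_le _)) _; first by rewrite exprn_ge0 // ltW.
  rewrite xE normrZ (ger0_norm (ltW (lamV_gt0 _))) distrC mulrCA ler_wpM2l //.
  rewrite mulrA ler_piMl // exprS invfM mulrCA mulfV ?mulr1; last by rewrite gt_eqF // exprn_gt0.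
  by rewrite invf_le1.
have [T0 hT0 HT0] : exists2 T, pol k T & forall h, `|h| <= 1 ->
    cmod (pr 0 f (x + h) - T h) <= C2 * (C1 * Bf) * `|h| ^+ k.
  have [|T' hT' H] := @tay f x Bf Bf0.
    by split => //; apply/nearW => z; apply: le_trans (fB z) _; rewrite ler_peMr // exprn_ege1 // wt_ge1.
  have prE y : pr 0 f y = proj f y.
    by rewrite /pr scale1r; apply: eq_proj => z; rewrite invr1 scale1r.
  by exists T' => // h h1; rewrite prE; exact: H.
(* The ratio exceeds 1 because [s < k]. On the ball of radius [lam^-L] the Taylor remainders of the
   increments form a geometric sum of order [lam^(-L k) r^L = q^-L]. *)
pose r : R := lam%:R ^+ k / q.
have r1 : 1 < r by rewrite ltr_pdivlMr // mul1r; exact: powR_lt_expr.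
have rE L : (lam%:R ^- L) ^+ k * r ^+ L = q ^- L :> R.
  have LL : (lam%:R ^- L) ^+ k * (lam%:R ^+ k) ^+ L = 1 :> R.
    by rewrite exprAC -exprMn mulVf ?expr1n // gt_eqF // exprn_gt0.
  by rewrite /r exprMn mulrA LL mul1r exprVn.
pose Z := C2 * (C1 * (C * n%:R ^+ k)) * lam%:R ^+ k.
have Z0 : 0 <= Z by rewrite !mulr_ge0 ?exprn_ge0.
exists (C * (1 + n%:R) ^+ k + C2 * (C1 * Bf) + Z / (r - 1)) => [|L].
  rewrite !addr_ge0 ?mulr_ge0 ?exprn_ge0 ?addr_ge0 // invr_ge0 subr_ge0 ltW //.
exists (fun y => T0 (y - x) + \sum_(l < L) T l (lam%:R ^+ l.+1 *: (y - x))).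
  rewrite (_ : (fun y => _) = (fun y => (fun h => T0 h + \sum_(l < L) T l (lam%:R ^+ l.+1 *: h)) (- x + y))).
    apply: (pol_shift (P := fun h => T0 h + \sum_(l < L) T l (lam%:R ^+ l.+1 *: h))).
    apply: polD => //; apply: pol_sum => l; apply: pol_scale; by have [] := HT l.
  by apply/funext => y; rewrite [- x + y]addrC.
apply: filterS (HC L) => y Hy yx; set t := `|y - x| in yx.
have t0 : 0 <= t := normr_ge0 _.
have tk : t ^+ k <= (lam%:R ^- L) ^+ k by rewrite lerX_ge0 // ltW.
have dE l : pr l.+1 f y - pr l f y = proj (fun z => G l (lam%:R ^- l.+1 *: z))
    (lam%:R ^+ l.+1 *: x + lam%:R ^+ l.+1 *: (y - x)).
  rewrite -scalerDr (addrC x) subrK -[RHS]/(pr l.+1 (G l) y) prB // pr_nested //.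
(* [f] is compared with [pr L f], which telescopes down to [pr 0 f]; each increment is paired with
   its own Taylor polynomial. *)
have -> : f y - (T0 (y - x) + \sum_(l < L) T l (lam%:R ^+ l.+1 *: (y - x))) =
   (f y - pr L f y) + (pr 0 f (x + (y - x)) - T0 (y - x)) +
   \sum_(l < L) ((pr l.+1 f y - pr l f y) - T l (lam%:R ^+ l.+1 *: (y - x))).
  have := telescope_sumr (fun l => pr l f y) (leq0n L); rewrite big_mkord => tele.
  rewrite sumrB tele [x + (y - x)]addrC subrK; ring.
apply: le_trans (cmodD _ _) _; rewrite 2!mulrDl; apply: lerD; last first.
  apply: le_trans (cmod_sum _ _ _) _.
  apply: (@le_trans _ _ (\sum_(l < L) Z * (lam%:R ^- L) ^+ k * r ^+ l)).
    apply: ler_sum => l _; have [_ HTl] := HT l.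
    have hn : `|lam%:R ^+ l.+1 *: (y - x)| = lam%:R ^+ l.+1 * t.
      by rewrite normrZ ger0_norm // exprn_ge0 // ltW.
    rewrite dE; apply: le_trans (HTl _ _) _.
      rewrite hn -ler_pdivlMl ?exprn_gt0 // mulr1; apply: le_trans (ltW yx) _.
      by rewrite lef_pV2 ?posrE ?exprn_gt0 // ler_weXn2l.
    rewrite hn exprMn; apply: le_trans (ler_wpM2l _ (ler_wpM2l _ tk)) _.
    - by rewrite !mulr_ge0.
    - by rewrite !exprn_ge0 // ltW.
    have -> : (lam%:R ^+ l.+1) ^+ k = lam%:R ^+ k * (lam%:R ^+ k) ^+ l :> R.
      by rewrite exprAC exprS.
    by rewrite le_eqVlt; apply/orP; left; apply/eqP; rewrite /Y /Z /r exprMn (exprVn q l); ring.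
  rewrite -mulr_sumr; apply: le_trans (ler_wpM2l _ (geometric_sum L r1)) _.
    by rewrite mulr_ge0 // exprn_ge0 // ltW.
  by rewrite -(rE L) le_eqVlt; apply/orP; left; apply/eqP; ring.
apply: le_trans (cmodD _ _) _; apply: lerD.
  apply: le_trans Hy _; rewrite mulrCA [leRHS]mulrC ler_wpM2l ?qV_ge0 // ler_wpM2l //.
  have L0 : 0 <= (lam%:R ^+ L : R) by rewrite exprn_ge0 // ltW.
  rewrite lerX_ge0 ?addr_ge0 ?mulr_ge0 ?sqrtr_ge0 // lerD2l.
  apply: le_trans (ler_wpM2l L0 (enorm_le _)) _; rewrite distrC mulrCA -[leRHS]mulr1 ler_wpM2l //.
  by rewrite -ler_pdivlMl ?exprn_gt0 // mulr1 ltW.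
apply: le_trans (HT0 _ _) _.
  by apply: le_trans (ltW yx) _; exact: lamV_le1.
rewrite ler_wpM2l ?mulr_ge0 //; apply: le_trans tk _; rewrite -(rE L).
by rewrite ler_peMr ?exprn_ge0 ?(ltW (lamV_gt0 _)) // exprn_ege1 // ltW.
Qed.

End scale_projections.

(** * From balls to translates of the tile *)

Section pointwise_smoothness.
Context (R : realType) (n : nat).
Local Notation vec := 'rV[R]_n.
Local Notation mu := (lebesgue_rV R n).
Implicit Types (y h v : vec) (f g : vec -> complex R).
Variables (lam : nat) (s : R).
Hypotheses (lam_gt1 : (1 < lam)%N) (s_gt0 : 0 < s).
Let q : R := lam%:R `^ s.
Let lam_gt0 : 0 < (lam%:R : R). Proof. by rewrite ltr0n ltnW. Qed.
Let lam_ge1 : 1 <= (lam%:R : R). Proof. by rewrite ler1n ltnW. Qed.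
Let lamV_gt0 l : 0 < (lam%:R : R) ^- l. Proof. by rewrite invr_gt0 exprn_gt0. Qed.
Let q_gt1 : 1 < q. Proof. exact: powR_gt1. Qed.
Let q_gt0 : 0 < q. Proof. exact: lt_trans ltr01 q_gt1. Qed.
Let qV_gt0 l : 0 < q ^- l. Proof. by rewrite invr_gt0 exprn_gt0. Qed.

(** [Lnorm] at infinity is an essential supremum once the whole space has positive measure, which a
    unit ball ensures. *)
Lemma Linfnorm_onP (Q : set vec) g (e : R) : 0 <= e ->
  (Linfnorm_on Q g <= e%:E)%E <-> {ae mu, forall y, Q y -> cmod (g y) <= e}.
Proof.
move=> e0; have mu0 : (0 < mu setT)%E.
  apply: lt_le_trans (lebesgue_rV_ball (0 : vec) (@ltr01 R)) _.
  by apply: le_measure; rewrite ?inE //; exact: measurable_rV_ball.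
rewrite /Linfnorm_on Lnorm.unlock mu0; split.
  move/ess_supP; apply: filterS => y /= + Qy.
  by rewrite lee_fin indicE mem_set // mul1r ger0_norm // cmod_ge0.
move=> H; apply/ess_supP; apply: filterS H => y /= H.
rewrite lee_fin indicE; case: (asboolP (Q y)) => Qy.
  by rewrite mem_set // mul1r ger0_norm ?cmod_ge0 //; exact: H.
by rewrite memNset // mul0r normr0.
Qed.

Lemma approx_ae_eq f g x K : {ae mu, forall y, f y = g y} ->
  approx lam q x f K -> approx lam q x g K.
Proof.
move=> fg [C C0 H]; exists C => // i; have [P hP HP] := H i; exists P => //.
by move: fg HP; apply: filterS2 => y ->.
Qed.

Variables (Q0 : set vec) (f : vec -> complex R) (Bf : R) (x : vec).
Hypothesis fB : forall y, cmod (f y) <= Bf.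
Let Bf0 : 0 <= Bf. Proof. exact: le_trans (cmod_ge0 _) (fB 0). Qed.

Lemma powR_scale l : (lam%:R : R) `^ (l%:R * s) = q ^+ l.
Proof. by rewrite mulrC powRrM powR_mulrn // powR_ge0. Qed.

Lemma lam_dominates (r : R) : exists m, r <= lam%:R ^+ m.
Proof.
exists (Num.bound `|r|); apply: le_trans (ler_norm r) _.
apply: le_trans (ltW (archi_boundP (normr_ge0 r))) _.
by rewrite -natrX ler_nat ltnW // ltn_expl.
Qed.

(** [Q0] contains a ball of radius [lam^-r], so the ball of scale [i] lies in the tile of scale
    [i - r]. The shift costs a factor [q ^+ r], and at the scales below [r] the zero polynomial
    works because [f] is bounded. *)
Lemma C_pointwise_approx k' (delta : R) : 0 < delta -> (forall y, `|y| < delta -> Q0 y) ->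
  C_pointwise lam Q0 s k' f x -> approx lam q x f k'.+1.
Proof.
move=> d0 dQ; rewrite /C_pointwise; set S := ereal_sup _ => Soo.
have [M M0 SM] : exists2 M : R, 0 <= M & (S <= M%:E)%E.
  move: Soo; case: S => [S| |] // _; last by exists 0 => //; exact: leNye.
  by exists `|S|; rewrite ?lee_fin ?ler_norm.
have [r Hr] := lam_dominates delta^-1.
have dr : lam%:R ^- r <= delta by rewrite -[leRHS]invrK lef_pV2 ?posrE ?invr_gt0 ?exprn_gt0.
have M10 : 0 <= M + 1 by rewrite addr_ge0.
pose C := (M + 1 + Bf) * q ^+ r.
exists C => [|i]; first by rewrite mulr_ge0 ?exprn_ge0 ?addr_ge0 // ltW.
have [ri|ir] := leqP r i; last first.
  exists (fun=> 0); first exact: pol0.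
  apply/nearW => y _; rewrite subr0; apply: le_trans (fB y) _.
  apply: (@le_trans _ _ (M + 1 + Bf)); first by rewrite lerDr.
  rewrite /C -mulrA ler_peMr ?addr_ge0 // ler_pdivlMr ?exprn_gt0 // mul1r.
  by rewrite ler_weXn2l // ?(ltW q_gt1) // ltnW.
(* The infimum may not be attained; [M + 1] leaves room to pick a polynomial. *)
have /ereal_inf_lt[_ [P hP <-] HP] : (osc lam Q0 k' f x (i - r) < ((M + 1) * q ^- (i - r))%:E)%E.
  have : ((q ^+ (i - r))%:E * osc lam Q0 k' f x (i - r) <= M%:E)%E.
    apply: le_trans SM; apply: ereal_sup_ubound; exists (i - r)%N => //=.
    by rewrite powR_scale.
  case: (osc _ _ _ _ _ _) => [t| |].
  - rewrite -EFinM !lee_fin lte_fin ltr_pdivlMr ?exprn_gt0 // mulrC => H.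
    by apply: le_lt_trans H _; rewrite ltrDl.
  - by rewrite gt0_muley ?lte_fin ?exprn_gt0.
  - by rewrite ltNye.
exists P; first by apply/pol_is_polynomial.
have e0 : 0 <= (M + 1) * q ^- (i - r) by rewrite mulr_ge0 // ltW.
have /(Linfnorm_onP _ _ e0) := ltW HP; apply: filterS => y Hy yx.
apply: le_trans (Hy _) _.
  exists (y - x); last by rewrite subrK.
  exists (lam%:R ^+ (i - r) *: (y - x)); last by rewrite scalerA mulVf ?scale1r // gt_eqF // exprn_gt0.
  apply: dQ; apply: lt_le_trans dr.
  rewrite normrZ ger0_norm ?exprn_ge0 ?(ltW lam_gt0) // -ltr_pdivlMl ?exprn_gt0 //.
  by rewrite -invfM -exprD subnK.
rewrite /C -mulrA; have -> : q ^+ r * q ^- i = q ^- (i - r).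
  by rewrite -{1}(subnK ri) exprD invfM mulrCA mulfV ?mulr1 // gt_eqF // exprn_gt0.
by rewrite ler_wpM2r ?(ltW (qV_gt0 _)) // lerDl.
Qed.

(** The same shift in the other direction: [Q0] lies in the ball of radius [lam^r], so the tile of
    scale [l] lies in the ball of scale [l - r]. *)
Lemma approx_C_pointwise k' (rho : R) : (forall y, Q0 y -> `|y| <= rho) ->
  approx lam q x f k'.+1 -> C_pointwise lam Q0 s k' f x.
Proof.
move=> rQ [C C0 H]; have [r Hr] := lam_dominates (rho + 1).
pose D := (C + Bf) * q ^+ r.
apply: (@le_lt_trans _ _ D%:E); last exact: ltry.
apply: ge_ereal_sup => _ [l _ <-]; rewrite powR_scale.
have qr1 : 1 <= q ^+ r by rewrite exprn_ege1 // ltW.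
suff [P hP [e [e0 eD HP]]] : exists2 P, pol k'.+1 P & exists e : R, [/\ 0 <= e, q ^+ l * e <= D &
    {ae mu, forall y, cube_at lam Q0 l x y -> cmod (f y - P y) <= e}].
  apply: (@le_trans _ _ ((q ^+ l)%:E * e%:E)%E); last by rewrite -EFinM lee_fin.
  apply: lee_wpmul2l; first by rewrite lee_fin exprn_ge0 // ltW.
  apply: (@le_trans _ _ (Linfnorm_on (cube_at lam Q0 l x) (fun y => f y - P y))).
    by apply: ereal_inf_lbound; exists P => //; apply/pol_is_polynomial.
  exact/Linfnorm_onP.
have [rl|lr] := leqP r l; last first.
  exists (fun=> 0); first exact: pol0.
  exists Bf; split => //; last by apply/nearW => y _; rewrite subr0.
  rewrite /D mulrC; apply: ler_pM => //; rewrite ?exprn_ge0 ?(ltW q_gt0) ?lerDr //.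
  by rewrite ler_weXn2l ?(ltW q_gt1) // ltnW.
have [P hP HP] := H (l - r)%N; exists P => //; exists (C * q ^- (l - r)); split.
- by rewrite mulr_ge0 // ltW.
- have -> : q ^+ l * (C * q ^- (l - r)) = C * q ^+ r.
    by rewrite -{1}(subnK rl) exprD; field; rewrite gt_eqF // exprn_gt0.
  by rewrite ler_wpM2r ?exprn_ge0 ?(ltW q_gt0) // lerDl.
apply: filterS HP => y Hy [_ [z Qz <-] yE]; apply: Hy.
rewrite -yE addrK normrZ ger0_norm ?(ltW (lamV_gt0 _)) //.
rewrite ltr_pdivrMl ?exprn_gt0 //.
have -> : lam%:R ^+ l * lam%:R ^- (l - r) = lam%:R ^+ r :> R.
  by rewrite -{1}(subnK rl) exprD; field; rewrite gt_eqF // exprn_gt0.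
apply: lt_le_trans Hr; apply: le_lt_trans (rQ z Qz) _; by rewrite ltrDl.
Qed.

End pointwise_smoothness.

(** * Passage to Borel representatives *)

Section borel_representative.
Context (R : realType) (n : nat).
Local Notation vec := 'rV[R]_n.
Local Notation mu := (lebesgue_rV R n).

(** The Borel representatives of the real and imaginary parts may exceed the bound on a null set;
    clamping them to the interval from [- B] to [B] restores it everywhere and changes them only on
    a null set. *)
Lemma bounded_borel (f : vec -> complex R) : bounded_measurable f ->
  exists g, exists2 B : R, cmeas g & (forall y, cmod (g y) <= B) /\ {ae mu, forall y, f y = g y}.
Proof.
move=> [[[h1 mh1 E1] [h2 mh2 E2]] [B fB]].
have B0 : 0 <= B := le_trans (cmod_ge0 _) (fB 0).
pose cl (h : vec -> R) y := Num.max (- B) (Num.min B (h y)).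
have mcl h : measurable_fun setT (h : vec -> measurableTypeR R) ->
    measurable_fun setT (cl h : vec -> measurableTypeR R).
  move=> mh; apply: measurable_maxr; first exact: measurable_cst.
  by apply: measurable_minr => //; exact: measurable_cst.
have clB h y : `|cl h y| <= B.
  rewrite /cl ler_norml le_max lexx /= ge_max ge_min lexx /= andbT.
  by rewrite (le_trans _ B0) // oppr_le0.
have clE h y : `|h y| <= B -> cl h y = h y.
  rewrite /cl ler_norml => /andP[h1' h2'].
  by rewrite (min_idPr h2') (max_idPr h1').
exists (fun y => Complex (cl h1 y) (cl h2 y)), (B + B); first by split; exact: mcl.
split=> [y|]; first by apply: le_trans (cmod_le_ReIm _) _; apply: lerD; exact: clB.
move: E1 E2; apply: filterS2 => y E1 E2.
have H1 : `|h1 y| <= B by rewrite -E1; apply: le_trans (Re_le_cmod _) _.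
have H2 : `|h2 y| <= B by rewrite -E2; apply: le_trans (Im_le_cmod _) _.
by rewrite !clE // -E1 -E2; case: (f y).
Qed.

End borel_representative.

Section shift_projection.
Context (R : realType) (n N lam : nat).
Local Notation lattice := 'rV[int]_n.
Local Notation vec := 'rV[R]_n.
Local Notation mu := (lebesgue_rV R n).
Variables (phi psi tphi : 'I_N -> vec -> complex R) (f g : vec -> complex R).
Hypothesis lam_gt1 : (1 < lam)%N.
Hypothesis mpsi : forall j, cmeas (psi j).
Hypothesis tpsi : forall j, {ae mu, forall y, tphi j y = psi j y}.
Hypothesis mg : cmeas g.
Hypothesis fg : {ae mu, forall y, f y = g y}.
Let lam_gt0 : 0 < (lam%:R : R). Proof. by rewrite ltr0n ltnW. Qed.

(** The normalisation [(lam ^ n) ^ l] is cancelled by the Jacobian of the dilation. The coefficients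
    are integrals, insensitive to null sets, so the equality holds at every [y]. *)
Lemma shift_projE l y : shift_proj lam phi tphi l f y = pr phi psi lam l g y.
Proof.
have L0 : 0 < (lam%:R ^+ l : R) by rewrite exprn_gt0.
have L1 : (lam%:R ^+ l : R) != 0 by rewrite gt_eqF.
apply: eq_bigr => j _; apply: eq_csum => nu; congr (_ * _).
pose G z := g (lam%:R ^- l *: z) * conjc (psi j (z - zvec R nu)).
have mG : cmeas G.
  apply: cmeasM; last by apply: cmeasJ; exact: cmeas_subr.
  by have := cmeas_affine (lam%:R ^- l) 0 mg; under eq_fun do rewrite addr0.
have E1 : inner f (fun y => tphi j (lam%:R ^+ l *: y - zvec R nu)) =
          cint mu (fun y => G (lam%:R ^+ l *: y + 0)).
  apply: (ae_eq_cint (m := mu)); first exact: cmeas_affine.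
  move: fg (ae_affine (- zvec R nu) L0 (tpsi j)); apply: filterS2 => z -> ->.
  by rewrite /G addr0 scalerA mulVf // scale1r.
rewrite E1 cint_affine // mulrA -[(_ ^ l)%:R](rmorph_nat (real_complex R)) -rmorphM /=.
have -> : ((lam ^ n) ^ l)%:R * (lam%:R ^+ l)^-1 ^+ n = 1 :> R.
  by rewrite -expnM mulnC expnM !natrX -exprMn mulfV ?expr1n.
by rewrite mul1r.
Qed.

End shift_projection.

Theorem proposition4 (R : realType) (n lambda0 N k : nat) (s : R)
    (hn : (0 < n)%N) (hlambda0 : (1 < lambda0)%N) (hN : (0 < N)%N)
    (hk : (0 < k)%N) (hs : 0 < s) (hsk : s < k%:R)
    (Gamma0 : set 'rV[int]_n) (T Q0 : set 'rV[R]_n)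
    (hT : self_affine_tile lambda0 Gamma0 T)
    (hQ0 : (exists a : 'rV[R]_n, Q0 = translate a T) /\ interior Q0 0)
    (Phi tPhi : 'I_N -> 'rV[R]_n -> complex R)
    (hreg : forall j, k_regular k (Phi j))
    (hstable : L2_stable_shifts Phi)
    (hrefine : refinable lambda0 Phi)
    (hdual : is_dual T Phi tPhi)
    (k' : nat) (hk' : s < k'%:R + 1)
    (x : 'rV[R]_n) (f : 'rV[R]_n -> complex R) (hf : bounded_measurable f) :
  C_pointwise lambda0 Q0 s k' f x
  <->
  exists C : R, forall l : nat,
    {ae lebesgue_rV R n, forall y,
      ComplexField.Normc.normc (f y - shift_proj lambda0 Phi tPhi l f y)
        <= C * (lambda0%:R ^- l + enorm (x - y)) `^ s}.
Proof.
have [_ span dual] := hdual.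
have mPhi j := k_regular_cmeas (hreg j); have rPhi j := k_regular_rapid (hreg j).
have /choice[psi Hpsi] : forall j, exists psi, [/\ cmeas psi, rapid psi &
    {ae lebesgue_rV R n, forall x, tPhi j x = psi x}].
  move=> j; apply: (dual_decay hn mPhi rPhi hstable (span j)) => i eta.
  have := dual i j eta 0; congr (inner _ _ = _).
  by apply/funext => y; rewrite zvec0 subr0.
have mpsi j : cmeas (psi j) by have [] := Hpsi j.
have rpsi j : rapid (psi j) by have [] := Hpsi j.
have tpsi j : {ae lebesgue_rV R n, forall y, tPhi j y = psi j y} by have [] := Hpsi j.
have biorth i j (eta nu : 'rV[int]_n) :
    cint (lebesgue_rV R n) (fun y => Phi i (y - zvec R eta) * conjc (psi j (y - zvec R nu))) =
    ((eta == nu) && (i == j))%:R.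
  rewrite -dual; apply/esym/(ae_eq_cint (m := lebesgue_rV R n)).
    by apply: cmeasM; [exact: cmeas_subr|apply: cmeasJ; exact: cmeas_subr].
  have := ae_affine (- zvec R nu) ltr01 (tpsi j); apply: filterS => y.
  by rewrite scale1r => ->.
have [g [B mg [gB fg]]] := bounded_borel hf.
have gf : {ae lebesgue_rV R n, forall y, g y = f y} by apply: filterS fg => y ->.
have [_ [B' fB]] := hf.
have [[a Q0E] Q0int] := hQ0; have [[Tc _] _] := hT.
have [delta d0 dQ] : exists2 delta : R, 0 < delta & forall y, `|y| < delta -> Q0 y.
  have /nbhs_ballP[delta /= d0 H] := Q0int; exists delta => // y yd.
  by apply: H; rewrite -ball_normE /= sub0r normrN.
have [rho rQ] : exists rho : R, forall y, Q0 y -> `|y| <= rho.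
  have [M [_ HM]] := compact_bounded Tc.
  exists (M + 1 + `|a|) => y; rewrite Q0E => -[z Tz <-].
  apply: le_trans (ler_normD _ _) _; rewrite lerD2r.
  by apply: (HM (M + 1)) => //; rewrite ltrDl.
have sk' : s < (k'.+1)%:R by rewrite -natr1.
have projE l y : shift_proj lambda0 Phi tPhi l f y = pr Phi psi lambda0 l g y.
  exact: shift_projE.
have decayP : pr_decay Phi psi lambda0 s x g <-> exists C : R, forall l : nat,
    {ae lebesgue_rV R n, forall y, cmod (f y - shift_proj lambda0 Phi tPhi l f y)
        <= C * (lambda0%:R ^- l + enorm (x - y)) `^ s}.
  by split=> -[C HC]; exists C => l; move: fg (HC l); apply: filterS2 => y ->; rewrite projE.
have q1 : 1 < (lambda0%:R : R) `^ s by exact: powR_gt1.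
(* [approx] does not depend on [K] as long as [K > s]: this joins the degree [k'] of the oscillation
   to the degrees below [k] that the projections reproduce. *)
have change h K K' : s < K'%:R ->
    approx lambda0 (lambda0%:R `^ s) x h K -> approx lambda0 (lambda0%:R `^ s) x h K'.
  move=> sK' aK; have [KK'|K'K] := leqP K K'.
    have [C C0 H] := aK; exists C => // i; have [P hP HP] := H i; exists P => //.
    exact: pol_le hP.
  by apply: (approx_reduce hlambda0 q1 (ltnW K'K) _ aK); exact: powR_lt_expr.
split=> [Cf|/decayP dg].
  apply/decayP; apply: (approx_pr_decay hn hN hreg mpsi rpsi biorth hlambda0 hrefine hs mg gB).
  apply: (change _ k'.+1) => //; apply: approx_ae_eq fg _.
  exact: (C_pointwise_approx hlambda0 hs fB d0 dQ).
apply: (approx_C_pointwise hlambda0 hs fB rQ); apply: (change _ k) => //.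
apply: approx_ae_eq gf _.
exact: (pr_decay_approx hn hreg mpsi rpsi biorth hlambda0 hrefine hs hsk mg gB).
Qed.
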